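(* Let $(c,Q)$ be a sufficiently smooth solution, with values in $(\mathcal{Q}_{\mathrm{phys}}^M)^\circ$ in $\Omega$, of the gradient flow system $$\frac{\partial c}{\partial t}=-\mathscr{G}\frac{\delta E}{\delta c},\qquad \frac{\partial Q}{\partial t}=-\mathscr{P}\frac{\delta E}{\delta Q}\quad\text{in }\Omega,$$ $$c=c_{\mathrm{bnd}},\qquad Q=Q_{\mathrm{bnd}},\qquad \frac{\partial(\partial_{\mathbf n}c)}{\partial t}=-\Delta c\quad\text{on }\partial\Omega,$$ where $c_{\mathrm{bnd}},Q_{\mathrm{bnd}}$ do not depend on time. Then $$\frac{\mathrm d}{\mathrm dt}E[c,Q]=-\left(\mathscr{G}\frac{\delta E}{\delta c},\mathscr{G}\frac{\delta E}{\delta c}\right)-\left(\mathscr{P}\frac{\delta E}{\delta Q},\mathscr{P}\frac{\delta E}{\delta Q}\right)-2c_{40}\int_{\partial\Omega}(\Delta c)^2\,\mathrm dS .$$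
   Context: $\Omega\subset\mathbb{R}^2$ is a bounded region with area $V(\Omega)$ and outward unit normal $\mathbf n$; $\partial_{\mathbf n}$ is the normal derivative. The unknowns are a scalar $c$ and a symmetric traceless $2\times2$ tensor $Q$. Repeated indices are summed over $1,2$; $\Delta=\partial_{ii}$, $\Delta^2=\partial_{iijj}$; $(U,V)=\int_\Omega U\cdot V\,\mathrm d\mathbf r$ with $U\cdot V$ the sum of products of corresponding components; $|Q|^2=Q_{ij}Q_{ij}$. Let $M>0,\nu>0$, $q(S)=-\log\det(S+I/2)+\log\det(I/2)$ for symmetric traceless $S$ with eigenvalues in $(-1/2,1/2)$, and $\Xi(c,Q)=c\log c+(M-c)\log(1-c/M)+c\nu q(Q/c)$, with $(\mathcal{Q}_{\mathrm{phys}}^M)^\circ=\{(c,Q):0<c<M,\ Q=Q^t,\ \mathrm{tr}\,Q=0,\ \text{eigenvalues of }Q\text{ in }(-c/2,c/2)\}$. There $$\frac{\partial\Xi}{\partial c}=\log\frac{Mc}{M-c}+\nu q(Q/c)+\frac{\nu}{c}\Big(\frac Qc+\frac I2\Big)^{-1}_{ij}Q_{ij},\qquad \frac{\partial\Xi}{\partial Q_{ij}}=-\nu\Big(\frac Qc+\frac I2\Big)^{-1}_{ij}.$$ The free energy is $$E[c,Q]=\int_\Omega \Xi(c,Q)+c_{00}c^2+c_{02}|Q|^2+g_e(c,Q)\,\mathrm d\mathbf r,$$ $$g_e=c_{20}\partial_kc\,\partial_kc+c_{21}\partial_kQ_{ij}\partial_kQ_{ij}+c_{22}\partial_iQ_{ij}\partial_kQ_{kj}+c_{23}\partial_jc\,\partial_iQ_{ij}+c_{40}\partial_{ii}c\,\partial_{jj}c,$$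 with real constants, $c_{40},c_{21},c_{22}>0$, $c_{20}<0$. The variational derivatives are $$\frac{\delta E}{\delta c}=\frac{\partial\Xi}{\partial c}+2c_{00}c-2c_{20}\Delta c-c_{23}\partial_{ij}Q_{ij}+2c_{40}\Delta^2c,$$ $$\frac{\delta E}{\delta Q_{ij}}=\frac{\partial\Xi}{\partial Q_{ij}}+2c_{02}Q_{ij}-2c_{21}\Delta Q_{ij}-2c_{22}\partial_{ik}Q_{kj}-c_{23}\partial_{ij}c.$$ The projections are $\mathscr{G}A=A-\frac1{V(\Omega)}\int_\Omega A\,\mathrm d\mathbf r$ and $(\mathscr{P}Q)_{ij}=\frac12(Q_{ij}+Q_{ji})-\frac12\delta_{ij}Q_{kk}$. *)

(* Defs.v *)
From HB Require Import structures.
From mathcomp Require Import all_boot all_order all_algebra.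
From mathcomp Require Import all_classical all_reals all_analysis.

Set Implicit Arguments.
Unset Strict Implicit.
Unset Printing Implicit Defensive.

Import Order.TTheory GRing.Theory Num.Theory.
Import numFieldNormedType.Exports.

Local Open Scope classical_set_scope.
Local Open Scope ring_scope.

(* The library norm on R * R is the sup norm, hence the explicit Euclidean
   one. *)
Definition euclid_norm (R : realType) (v : R * R) : R :=
  Num.sqrt (v.1 ^+ 2 + v.2 ^+ 2).

Definition lebesgue2 (R : realType) :=
  (@lebesgue_measure R \x @lebesgue_measure R)%E.
Arguments lebesgue2 : clear implicits.

Definition unit_vec (R : realType) (i : 'I_2) : R * R :=
  ((i == 0)%:R, (i == 1)%:R).

Definition partial (R : realType) (i : 'I_2) (f : R * R -> R) : R * R -> R :=
  fun r => 'D_(unit_vec R i) f r.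

Definition laplacian (R : realType) (f : R * R -> R) : R * R -> R :=
  fun r => \sum_i partial i (partial i f) r.

Definition bilaplacian (R : realType) (f : R * R -> R) : R * R -> R :=
  laplacian (laplacian f).

(* Space-time points are (t, (x, y)). *)
Definition spacetime_axes (R : realType) : seq (R * (R * R)) :=
  [:: (1, (0, 0)); (0, (1, 0)); (0, (0, 1))].

(* f is of class C^k on the open set W: the iterated partial derivatives of
   order at most k, in any order, exist and are continuous on W. *)
Fixpoint Ck_on (R : realType) (k : nat) (W : set (R * (R * R)))
    (f : R * (R * R) -> R) : Prop :=
  (forall p, W p -> {for p, continuous f}) /\
  match k with
  | 0 => True
  | k'.+1 => forall v, v \in spacetime_axes R ->
      (forall p, W p -> derivable f p v) /\ Ck_on k' W ('D_v f)
  end.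

(* f is of class C^k on ]0, T[ x D, up to the boundary when D is closed: f is
   C^k on an open neighbourhood of that set. *)
Definition Ck_spacetime (R : realType) (k : nat) (T : R) (D : set (R * R))
    (f : R -> R * R -> R) : Prop :=
  exists W : set (R * (R * R)),
    [/\ open W,
        (forall t r, 0 < t < T -> D r -> W (t, r)) &
        Ck_on k W (fun p => f p.1 p.2)].

(* The tangent (x', y') rotated clockwise by a right angle and normalised. *)
Definition unit_normal (R : realType) (g : R -> R * R) (t : R) : R * R :=
  let v := derive1 g t in (v.2 / euclid_norm v, - v.1 / euclid_norm v).

(* A bounded region of the plane whose boundary is a finite union of regular
   C^1 arcs parametrised by [0, 1], which may only meet at their endpoints
   (a smooth closed boundary curve is an arc whose two endpoints coincide, so
   C^1 regions and polygons are both covered).  The arcs are oriented so that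
   [unit_normal] points out of the region. *)
Record region (R : realType) := Region {
  dom : set (R * R);
  narcs : nat;
  bdry_arc : 'I_narcs -> R -> R * R;
  dom_open : open dom;
  dom_connected : connected dom;
  dom_nonempty : dom !=set0;
  dom_bounded : bounded_set dom;
  arc_derivable : forall k t, derivable (bdry_arc k) t 1;
  arc_C1 : forall k, continuous (derive1 (bdry_arc k));
  arc_regular : forall k t, 0 <= t <= 1 -> derive1 (bdry_arc k) t != 0;
  arc_simple : forall k l s t, 0 < s < 1 -> 0 <= t <= 1 ->
    bdry_arc k s = bdry_arc l t -> k = l /\ s = t;
  arc_boundary : closure dom `\` dom = \bigcup_k (bdry_arc k @` `[0, 1]);
  arc_outward : forall k t, 0 < t < 1 ->
    \forall s \near 0^'+,
      ~ closure dom (bdry_arc k t + s *: unit_normal (bdry_arc k) t) /\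
      dom (bdry_arc k t - s *: unit_normal (bdry_arc k) t)
}.

Definition boundary (R : realType) (Omega : region R) : set (R * R) :=
  closure (dom Omega) `\` dom Omega.

Definition area (R : realType) (Omega : region R) : R :=
  fine (lebesgue2 R (dom Omega)).

Definition integral_dom (R : realType) (Omega : region R) (f : R * R -> R) : R :=
  (\int[lebesgue2 R]_(r in dom Omega) f r)%R.

Definition integral_boundary (R : realType) (Omega : region R)
    (f : R * R -> R) : R :=
  \sum_(k < narcs Omega)
    (\int[@lebesgue_measure R]_(t in `[0%R, 1%R])
       (f (bdry_arc k t) * euclid_norm (derive1 (bdry_arc k) t)))%R.

Definition directional_derivative (R : realType) (n : R * R)
    (f : R * R -> R) (r : R * R) : R :=
  n.1 * partial 0 f r + n.2 * partial 1 f r.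

Definition inner_scalar (R : realType) (Omega : region R)
    (U V : R * R -> R) : R :=
  integral_dom Omega (fun r => U r * V r).

Definition inner_tensor (R : realType) (Omega : region R)
    (U V : R * R -> 'M[R]_2) : R :=
  integral_dom Omega (fun r => \sum_i \sum_j U r i j * V r i j).

Record model (R : realType) := Model {
  M : R; nu : R;
  c00 : R; c02 : R; c20 : R; c21 : R; c22 : R; c23 : R; c40 : R;
  M_gt0 : 0 < M;
  nu_gt0 : 0 < nu;
  c40_gt0 : 0 < c40;
  c21_gt0 : 0 < c21;
  c22_gt0 : 0 < c22;
  c20_lt0 : c20 < 0
}.

Section Energy.
Variables (R : realType) (m : model R) (Omega : region R).

Definition physical (c : R) (Q : 'M[R]_2) : Prop :=
  [/\ 0 < c < M m, Q = Q^T, \tr Q = 0 &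
      forall a, eigenvalue Q a -> - (c / 2) < a < c / 2].

Definition half_id : 'M[R]_2 := (2^-1)%:M.

Definition q (S : 'M[R]_2) : R := - ln (\det (S + half_id)) + ln (\det half_id).

Definition Xi (c : R) (Q : 'M[R]_2) : R :=
  c * ln c + (M m - c) * ln (1 - c / M m) + c * nu m * q (c^-1 *: Q).

Definition dXi_dc (c : R) (Q : 'M[R]_2) : R :=
  ln (M m * c / (M m - c)) + nu m * q (c^-1 *: Q)
  + nu m / c * \sum_i \sum_j invmx (c^-1 *: Q + half_id) i j * Q i j.

Definition dXi_dQ (c : R) (Q : 'M[R]_2) : 'M[R]_2 :=
  - nu m *: invmx (c^-1 *: Q + half_id).

Definition entry (Q : R * R -> 'M[R]_2) (i j : 'I_2) : R * R -> R :=
  fun r => Q r i j.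

Definition g_e (c : R * R -> R) (Q : R * R -> 'M[R]_2) (r : R * R) : R :=
  c20 m * (\sum_k partial k c r * partial k c r)
  + c21 m * (\sum_i \sum_j \sum_k
               partial k (entry Q i j) r * partial k (entry Q i j) r)
  + c22 m * (\sum_i \sum_j \sum_k
               partial i (entry Q i j) r * partial k (entry Q k j) r)
  + c23 m * (\sum_i \sum_j partial j c r * partial i (entry Q i j) r)
  + c40 m * (\sum_i \sum_j
               partial i (partial i c) r * partial j (partial j c) r).

Definition energy (c : R * R -> R) (Q : R * R -> 'M[R]_2) : R :=
  integral_dom Omega (fun r =>
    Xi (c r) (Q r) + c00 m * c r ^+ 2
    + c02 m * (\sum_i \sum_j Q r i j * Q r i j) + g_e c Q r).

Definition dE_dc (c : R * R -> R) (Q : R * R -> 'M[R]_2) (r : R * R) : R :=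
  dXi_dc (c r) (Q r) + 2 * c00 m * c r - 2 * c20 m * laplacian c r
  - c23 m * (\sum_i \sum_j partial i (partial j (entry Q i j)) r)
  + 2 * c40 m * bilaplacian c r.

Definition dE_dQ (c : R * R -> R) (Q : R * R -> 'M[R]_2) (r : R * R) :
    'M[R]_2 :=
  \matrix_(i, j)
    (dXi_dQ (c r) (Q r) i j + 2 * c02 m * Q r i j
     - 2 * c21 m * laplacian (entry Q i j) r
     - 2 * c22 m * (\sum_k partial i (partial k (entry Q k j)) r)
     - c23 m * partial i (partial j c) r).

Definition projG (A : R * R -> R) (r : R * R) : R :=
  A r - (area Omega)^-1 * integral_dom Omega A.

Definition projP (A : R * R -> 'M[R]_2) (r : R * R) : 'M[R]_2 :=
  \matrix_(i, j)
    (2^-1 * (A r i j + A r j i) - 2^-1 * (i == j)%:R * (\sum_k A r k k)).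

Definition gradient_flow_solution (T : R)
    (c_bnd : R * R -> R) (Q_bnd : R * R -> 'M[R]_2)
    (c : R -> R * R -> R) (Q : R -> R * R -> 'M[R]_2) : Prop :=
  forall t, 0 < t < T ->
  [/\ forall r, dom Omega r ->
        derive1 (fun s => c s r) t = - projG (dE_dc (c t) (Q t)) r,
      forall r, dom Omega r -> forall i j,
        derive1 (fun s => Q s r i j) t = - projP (dE_dQ (c t) (Q t)) r i j,
      forall r, boundary Omega r -> c t r = c_bnd r,
      forall r, boundary Omega r -> Q t r = Q_bnd r &
      forall (k : 'I_(narcs Omega)) s, 0 < s < 1 ->
        derive1 (fun u => directional_derivative (unit_normal (bdry_arc k) s)
                            (c u) (bdry_arc k s)) t
        = - laplacian (c t) (bdry_arc k s)].

End Energy.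

(* Main.v *)
(* Differentiation under the integral sign and integration by parts write
   dE/dt as (dE/dc, d_t c) + (dE/dQ, d_t Q) plus the outward flux of a field V.
   Since the boundary values do not depend on time, d_t c and d_t Q vanish on
   the boundary, where V reduces to 2 c40 (Delta c) grad (d_t c); the dynamic
   boundary condition makes its normal component -2 c40 (Delta c)^2. In the
   interior the flow equations turn the two products into -(G, G) and -(P, P),
   because both projections are orthogonal.

   The logarithmic terms must be bounded up to the boundary, although (c, Q) is
   only assumed physical in the open region. At a fixed time all other terms of
   the flow equations are bounded; the equation for Q then bounds det (Q/c + I/2)
   away from 0, and after that the equation for c keeps c away from 0 and M.

   The divergence theorem is proved by slicing: on almost every line the integral
   of a derivative is a signed sum over the points where the line crosses the
   boundary (the exceptional lines are a null set by Sard's theorem in dimension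
   one), and integrating these sums over the lines gives a limit of
   Riemann-Stieltjes sums along the boundary arcs. *)
Require Import Defs.
From mathcomp Require Import all_boot all_order all_algebra.
From mathcomp Require Import all_classical all_reals all_analysis.
From mathcomp Require Import measurable_realfun ring lra.
Import Order.TTheory GRing.Theory Num.Theory.
Import numFieldNormedType.Exports.
Local Open Scope classical_set_scope.
Local Open Scope ring_scope.

Set Implicit Arguments.
Unset Strict Implicit.

(** * Riemann-Stieltjes sums and level sets *)

(** The arcs are only C^1 and a coordinate [b] along an arc may oscillate infinitely often, so in
    general the region cannot be cut into finitely many pieces bounded by graphs over a fixed axis.
    Instead, the increments of [b] over dyadic parameter intervals are written as integrals over the
    level [y] of the jumps of the indicator of [y < b]. For almost every [y] these jumps see
    finitely many transversal crossings. The limit passes under the integral because the total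
    number of crossings of a level is an integrable function of the level, the arcs being Lipschitz.

    To sign a crossing one must know on which side the region lies, and this is given along the unit
    normal alone; hence the argument that all transversal directions see the same two sides.

    The projection in the equation for [Q] removes the trace of dXi/dQ, which is
    [- nu / det (Q/c + I/2)]. The determinant is therefore bounded below through the traceless part:
    if it were small, the bounded traceless part would force the entries of [Q/c] to be small, and
    then the determinant would be close to 1/4. *)

Section DyadicSums.
Variable R : realType.
Implicit Types (g b : R -> R) (m i : nat).
Local Notation mu := (@lebesgue_measure R).

Definition dyad m i : R := i%:R / 2 ^+ m.

Lemma dyad_itv m i : (i <= 2 ^ m)%N -> 0 <= dyad m i <= 1.
Proof.
move=> im; rewrite divr_ge0 ?ler0n ?exprn_ge0//=.
by rewrite ler_pdivrMr ?exprn_gt0// mul1r -natrX ler_nat.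
Qed.

Lemma dyadS m i : dyad m i.+1 = dyad m i + 2 ^- m.
Proof. by rewrite /dyad -natr1 mulrDl mul1r. Qed.

Lemma dyad0 m : dyad m 0 = 0. Proof. by rewrite /dyad mul0r. Qed.

Lemma dyad1 m : dyad m (2 ^ m) = 1.
Proof. by rewrite /dyad natrX divff// expf_neq0. Qed.

Lemma dyad_double m i : dyad m.+1 i.*2 = dyad m i.
Proof.
rewrite /dyad exprS -mul2n natrM invfM mulrACA divff ?mul1r//.
Qed.

Lemma big_nat_double (V : nmodType) (F : nat -> V) n :
  \sum_(i < n.*2) F i = \sum_(i < n) (F i.*2 + F i.*2.+1).
Proof.
elim: n => [|n IH]; first by rewrite !big_ord0.
by rewrite doubleS !big_ord_recr/= IH addrA.
Qed.

Lemma cvg_expVn2 : (fun m => 2 ^- m : R) @ \oo --> (0 : R).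
Proof.
have := @cvg_expr R (2^-1); rewrite ger0_norm ?invr_ge0//.
move=> /(_ _)/wrap[]; first by rewrite invf_lt1// ltr1n.
suff -> : (GRing.exp (2^-1 : R)) = (fun m => 2 ^- m) by [].
by apply/funext => m; rewrite exprVn.
Qed.

(** Compactness of the segment in its near-covering form. Only [s] is confined to the segment:
    continuity is meant in the whole line, so [t] may leave it. *)
Lemma unif_continuous_itv (f : R -> R) (u v : R) :
  (forall t, u <= t <= v -> {for t, continuous f}) ->
  forall e, 0 < e -> exists2 d, 0 < d &
  forall s t, u <= s <= v -> `|s - t| < d -> `|f s - f t| < e.
Proof.
move=> cf e e0.
have /compact_near_coveringP K := @segment_compact R u v.
have [] := K _ (0^'+ : set_system R)
   (fun d x => forall t, `|x - t| < d -> `|f x - f t| < e).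
- move=> x /=; rewrite in_itv/= => /cf/cvgrPdist_lt/(_ (e / 2)).
  rewrite divr_gt0// => /(_ isT)/nbhs_ballP[d/= d0 dP].
  exists (ball x (d / 2), [set y | y < d / 2]).
    split=> /=; first by apply: nbhsx_ballx; rewrite divr_gt0.
    by apply: nbhs_right_lt; rewrite divr_gt0.
  move=> [y s]/= [xy sd] t yt.
  have h1 : `|f x - f y| < e / 2 by apply: dP; apply: le_ball xy; lra.
  have h2 : `|f x - f t| < e / 2.
    apply: dP; rewrite -ball_normE/=; move: xy; rewrite -ball_normE/= => xy.
    by have := ler_distD y x t; lra.
  by have := ler_distD (f x) (f y) (f t); rewrite (distrC (f y) (f x)); lra.
move=> d/= d0 H; exists (d / 2); first by rewrite divr_gt0.
move=> s t st; apply: (H (d / 2)) => /=.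
- by rewrite sub0r normrN ger0_norm; lra.
- by rewrite divr_gt0.
- by rewrite in_itv.
Qed.

Lemma bounded_itv (f : R -> R) (u v : R) : u <= v ->
  (forall t, u <= t <= v -> {for t, continuous f}) ->
  exists2 C, 0 <= C & forall t, u <= t <= v -> `|f t| <= C.
Proof.
move=> uv cf.
have cn : {within `[u, v], continuous (fun t => `|f t|)}.
  apply: continuous_in_subspaceT => t; rewrite inE/= in_itv/= => /cf cft.
  by apply: cvg_norm.
have [c _ cP] := EVT_max uv cn.
by exists `|f c|; [exact: normr_ge0|move=> t tuv; apply: cP; rewrite in_itv].
Qed.

Lemma dist_dyad m i : (i < 2 ^ m)%N -> forall t,
  dyad m i <= t <= dyad m i.+1 -> `|dyad m i - t| <= 2 ^- m.
Proof.
move=> im t; rewrite dyadS => /andP[h1 h2].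
by rewrite distrC ger0_norm; lra.
Qed.

Lemma ltr_dyadS m i : dyad m i < dyad m i.+1.
Proof. by rewrite dyadS ltrDl invr_gt0 exprn_gt0. Qed.

Section RiemannStieltjes.
Variables g b : R -> R.
Hypothesis cg : forall t, 0 <= t <= 1 -> {for t, continuous g}.
Hypothesis db : forall t, derivable b t 1.
Hypothesis cb : continuous (derive1 b).

Lemma continuous_derivable1 : continuous b.
Proof. by move=> t; apply: differentiable_continuous; apply/derivable1_diffP. Qed.

Let h := fun t => g t * derive1 b t.

Let ch t : 0 <= t <= 1 -> {for t, continuous h}.
Proof. by move=> t01; apply: cvgM; [exact: cg|exact: cb]. Qed.

Let ih : mu.-integrable `[0, 1] (EFin \o h).
Proof.
apply: continuous_compact_integrable; first exact: segment_compact.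
apply: continuous_in_subspaceT => t; rewrite inE/= in_itv/=.
exact: ch.
Qed.

(** Let [G] be a primitive of [g * b']. On each dyadic interval the mean value theorem for
    [g (dyad m i) * b - G] gives the error as [(g (dyad m i) - g x) * b' x * 2^-m], which uniform
    continuity of [g] makes small. *)
Lemma riemann_stieltjes_cvg :
  (fun m => \sum_(i < 2 ^ m) g (dyad m i) * (b (dyad m i.+1) - b (dyad m i)))
     @ \oo --> \int[mu]_(t in `[0, 1]) (g t * derive1 b t).
Proof.
pose G x := \int[mu]_(t in `[0, x]) h t.
have dG x : 0 < x < 1 -> derivable G x 1 /\ derive1 G x = h x.
  move=> /andP[x0 x1]; apply: (continuous_FTC1_closed x1) => //.
  by apply: ch; rewrite !ltW.
have cG : {within `[0, 1], continuous G} by apply: parameterized_integral_continuous.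
have G0 : G 0 = 0 by rewrite /G set_itv1 Rintegral_set1.
have [C C0 bC] := bounded_itv ler01 (fun t _ => @cb t).
apply/cvgrPdist_le => e e0.
(* The tolerance is [e / (C + 1)] because the bound [C] on [b'] may be 0. *)
have [d d0 dP] := unif_continuous_itv cg (divr_gt0 e0 (ltr_pwDr ltr01 C0)).
have := cvg_expVn2; move=> /cvgrPdist_lt/(_ _ d0)[N _ NP].
exists N => // m /NP; rewrite sub0r normrN ger0_norm ?invr_ge0// => md.
rewrite -/(G 1) distrC.
have -> : G 1 = \sum_(i < 2 ^ m) (G (dyad m i.+1) - G (dyad m i)).
  rewrite -(big_mkord xpredT (fun i => G (dyad m i.+1) - G (dyad m i))).
  by rewrite telescope_sumr// dyad0 G0 dyad1 subr0.
rewrite -sumrB (le_trans (ler_norm_sum _ _ _))//.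
have -> : e = \sum_(i < 2 ^ m) (e * 2 ^- m).
  by rewrite sumr_const card_ord -mulrnAr -mulr_natr natrX mulVf ?mulr1// expf_neq0.
apply: ler_sum => /= -[i im] _ /=.
have /andP[i0 _] := dyad_itv (ltnW im).
have /andP[_ i1] := dyad_itv im.
pose H t := g (dyad m i) * b t - G t.
have tin t : dyad m i < t < dyad m i.+1 -> 0 < t < 1.
  by move=> /andP[h1 h2]; rewrite (le_lt_trans i0 h1) (lt_le_trans h2 i1).
have [] := @MVT _ H (fun t => (g (dyad m i) - g t) * derive1 b t) _ _ (ltr_dyadS m i).
- move=> t; rewrite in_itv/= => /tin/dG[dGt GE].
  have -> : (g (dyad m i) - g t) * derive1 b t = g (dyad m i) *: derive1 b t - derive1 G t.
    by rewrite GE mulrBl.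
  apply: is_deriveB; rewrite derive1E.
  + have hb : is_derive t 1 b ('D_1 b t) by exact: (DeriveDef (@db t) (erefl _)).
    exact: is_deriveZ.
  + exact/derivableP.
- move=> t; apply: cvgB.
    by apply: cvgM; [exact: cvg_cst|apply: continuous_subspaceT; exact: continuous_derivable1].
  apply: (continuous_subspaceW _ cG) => x/=; rewrite !in_itv/= => /andP[h1 h2].
  by rewrite (le_trans i0 h1) (le_trans h2 i1).
move=> x; rewrite in_itv/= => xi.
have E : dyad m i.+1 - dyad m i = 2 ^- m by rewrite dyadS; ring.
rewrite E => HE.
have -> : g (dyad m i) * (b (dyad m i.+1) - b (dyad m i)) -
  (G (dyad m i.+1) - G (dyad m i)) = (g (dyad m i) - g x) * derive1 b x * 2 ^- m.
  by rewrite -HE /H; ring.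
rewrite !normrM [`|2 ^- m|]ger0_norm ?invr_ge0// ler_wpM2r ?invr_ge0//.
have gx : `|g (dyad m i) - g x| <= e / (C + 1).
  apply/ltW/dP; first exact: dyad_itv (ltnW im).
  apply: le_lt_trans md; apply: dist_dyad => //.
  by case/andP: xi => h1 h2; rewrite !ltW.
have bx : `|derive1 b x| <= C by apply: bC; have /andP[h1 h2] := tin _ xi; rewrite !ltW.
rewrite (le_trans (ler_pM _ _ gx bx))// mulrAC ler_pdivrMr ?ltr_wpDl// ler_wpM2l; lra.
Qed.

End RiemannStieltjes.

End DyadicSums.

(** * Critical values of a C^1 function of one variable *)

Section Sard.
Variable R : realType.
Local Notation mu := (@lebesgue_measure R).

Lemma dyad_floor m (t : R) : 0 <= t < 1 ->
  exists2 i, (i < 2 ^ m)%N & dyad R m i <= t < dyad R m i.+1.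
Proof.
move=> /andP[t0 t1]; have p0 : 0 < 2 ^+ m :> R by rewrite exprn_gt0.
have /andP[h1 h2] := truncn_itv (mulr_ge0 t0 (ltW p0)).
exists (Num.truncn (t * 2 ^+ m)).
  rewrite -(ltr_nat R) (le_lt_trans h1)// natrX gtr_pMl//.
by rewrite /dyad ler_pdivrMr// h1 ltr_pdivlMr.
Qed.

Lemma dyad_cover m (t : R) : 0 <= t <= 1 ->
  exists2 i, (i < 2 ^ m)%N & dyad R m i <= t <= dyad R m i.+1.
Proof.
move=> /andP[t0]; rewrite le_eqVlt => /predU1P[->|t1]; last first.
  have [|i im /andP[h1 h2]] := @dyad_floor m t; first by rewrite t0.
  by exists i => //; rewrite h1 ltW.
have m0 : (0 < 2 ^ m)%N by rewrite expn_gt0.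
exists (2 ^ m).-1; first by rewrite prednK.
by rewrite prednK// dyad1 lexx andbT -[leRHS](dyad1 _ m) -{2}(prednK m0) ltW// ltr_dyadS.
Qed.

(** Once [b'] oscillates by less than [e / 2] on dyadic intervals, the critical points in one of
    them have values in an interval of length [e * 2^-m]; there are at most [2^m] of these. The set
    of critical values is compact, hence measurable. *)
Lemma critical_values_null (b : R -> R) :
  (forall t, derivable b t 1) -> continuous (derive1 b) ->
  mu.-negligible (b @` [set t | 0 <= t <= 1 /\ derive1 b t = 0]).
Proof.
move=> db cb; set C := [set t | _]; set Z := b @` C.
have cC : compact C.
  apply: (@subclosed_compact _ _ (`[0, 1]%classic : set R)).
  - have -> : C = `[0, 1] `&` (derive1 b) @^-1` [set 0].
      by apply/seteqP; split=> t /=; rewrite in_itv.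
    apply: closedI; first exact: itv_closed.
    by apply: closed_comp => [t _|]; [exact: cb|exact: closed_eq].
  - exact: segment_compact.
  - by move=> t [t01 _]; rewrite /= in_itv.
have cZ : compact Z.
  apply: continuous_compact => //; apply: continuous_subspaceT.
  exact: continuous_derivable1.
have mZ : measurable Z by exact: compact_measurable.
exists Z; split => //; apply/eqP; rewrite eq_le measure_ge0 andbT.
apply/lee_addgt0Pr => e e0; rewrite add0e.
have e20 : 0 < e / 2 by rewrite divr_gt0.
have [d d0 dP] := unif_continuous_itv (fun t (_ : 0 <= t <= 1) => @cb t) e20.
have /cvgrPdist_lt/(_ _ d0)[m _ /(_ m (leqnn m))] := @cvg_expVn2 R.
rewrite sub0r normrN ger0_norm ?invr_ge0// => md.
pose A i : set R := if `[< exists2 c, C c & dyad R m i <= c <= dyad R m i.+1 >] then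
  `[b (dyad R m i) - e / 2 * 2 ^- m, b (dyad R m i) + e / 2 * 2 ^- m]%classic else set0.
have mA i : measurable (A i) by rewrite /A; case: asboolP.
have ZA : Z `<=` \big[setU/set0]_(i < 2 ^ m) A i.
  move=> _ [c [c01 c0] <-]; have [i im ci] := dyad_cover m c01.
  rewrite -(big_mkord xpredT A) bigcup_mkord_ord in_setE// || idtac.
  rewrite -bigcup_mkord; exists i => //=; rewrite /A asboolT; last by exists c.
  rewrite /= in_itv/=; have /andP[ci1 ci2] := ci.
  rewrite -ler_distl.
  have [z z1 ->] : exists2 z, dyad R m i <= z <= c &
      b c - b (dyad R m i) = derive1 b z * (c - dyad R m i).
    have [<-|nc] := eqVneq (dyad R m i) c.
      by exists (dyad R m i); rewrite ?lexx// !subrr mulr0.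
    have [|||z zi zE] := @MVT R b (derive1 b) (dyad R m i) c.
    - by rewrite lt_neqAle nc.
    - by move=> z _; rewrite derive1E; exact: (DeriveDef (@db z) (erefl _)).
    - by apply: continuous_subspaceT; exact: continuous_derivable1.
    by exists z => //; move: zi; rewrite in_itv/= => /andP[h1 h2]; rewrite !ltW.
  rewrite normrM ler_pM//.
    apply/ltW; rewrite -[derive1 b z]subr0 -c0 distrC; apply: dP => //.
    apply: le_lt_trans md; case/andP: z1 => h1 h2.
    rewrite ger0_norm ?subr_ge0//; rewrite dyadS in ci2; lra.
  by rewrite distrC dist_dyad.
have mAs : measurable (\big[setU/set0]_(i < 2 ^ m) A i).
  by apply: bigsetU_measurable => i _; exact: mA.
apply: (@le_trans _ _ (mu (\big[setU/set0]_(i < 2 ^ m) A i))).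
  by apply: le_measure => //; rewrite inE.
apply: (@le_trans _ _ (\sum_(i < 2 ^ m) mu (A i))%E).
  by apply: Boole_inequality => i _; exact: mA.
apply: (@le_trans _ _ (\sum_(i < 2 ^ m) (e * 2 ^- m)%:E)%E); last first.
  rewrite sumEFin sumr_const card_ord -mulrnAr -mulr_natr natrX mulVf ?mulr1//.
apply: lee_sum => i _; rewrite /A; case: ifPn => _; last first.
  by rewrite measure0 lee_fin mulr_ge0 ?invr_ge0// ltW.
rewrite lebesgue_measure_itv/=; case: ifPn => _; rewrite ?lee_fin.
  by rewrite le_eqVlt; apply/orP; left; apply/eqP; field; rewrite expf_neq0.
by rewrite mulr_ge0 ?invr_ge0// ltW.
Qed.

End Sard.

(** Within [A] the set [U] is both open and closed, because [A] meets the closure of [U] only in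
    [U]. *)
Lemma connected_frontier (T : topologicalType) (A U : set T) :
  open U -> connected A -> (forall x, A x -> closure U x -> U x) ->
  A `&` U !=set0 -> A `<=` U.
Proof.
move=> oU cA fr AU; have E := cA _ AU; rewrite -[X in X `<=` _]E.
- by apply: subIsetr.
- by exists U.
- exists (closure U); first exact: closed_closure.
  apply/seteqP; split => x [Ax Ux]; split => //; first exact: subset_closure.
  exact: fr.
Qed.

Lemma exists_lt2 (R : realType) (a b : R) : 0 < a -> 0 < b ->
  exists t, [/\ 0 < t, t < a & t < b].
Proof.
move=> a0 b0; have m0 : 0 < Num.min a b by rewrite lt_min a0.
have ma : Num.min a b <= a by rewrite ge_min lexx.
have mb : Num.min a b <= b by rewrite ge_min lexx orbT.
by exists (Num.min a b / 2); split; lra.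
Qed.

Lemma exists_lt3 (R : realType) (a b c : R) : 0 < a -> 0 < b -> 0 < c ->
  exists t, [/\ 0 < t, t < a, t < b & t < c].
Proof.
move=> a0 b0 /(exists_lt2 b0)[d [d0 db dc]].
have [t [t0 ta td]] := exists_lt2 a0 d0.
by exists t; split => //; lra.
Qed.

Lemma closure_itv (R : realType) (u v x : R) : u < v -> u <= x <= v ->
  closure `]u, v[%classic x.
Proof.
move=> uv /andP[ux xv] B /nbhs_ballP[e /= e0 eB].
have [t [t0 te]] : exists t, [/\ 0 < t, t < e & t < (v - u) / 2].
  by apply: exists_lt2 => //; rewrite divr_gt0// subr_gt0.
move=> tuv.
exists (if x <= u + t then x + t else x - t).
case: leP => xt; split; rewrite /= ?in_itv/=; try lra; apply: eB;
  rewrite -ball_normE/= ltr_norml; lra.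
Qed.

Lemma one_neqN1 (R : realType) : (1 == -1 :> R) = false.
Proof. by apply/eqP; lra. Qed.

(** * The fundamental theorem of calculus on an open subset of the line *)

Section FTCOpen.
Variables (R : realType) (U : set R) (h h' : R -> R) (K : R).
Local Notation mu := (@lebesgue_measure R).
Hypothesis oU : open U.
Hypothesis bU : forall x, U x -> `|x| < K.
Hypothesis dh : forall x, closure U x -> is_derive x 1 h (h' x).
Hypothesis ch : forall x, closure U x -> {for x, continuous h'}.

(* [j] is the direction in which one leaves [U] at its frontier point [x]. *)
Definition crosses (U : set R) (j x : R) :=
  exists2 e, 0 < e & forall s, 0 < s < e -> U (x - j * s) /\ ~ U (x + j * s).

Let itv_sub u v z : (forall x, u < x < v -> closure U x -> U x) ->
  u < z < v -> U z -> `]u, v[%classic `<=` U.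
Proof.
move=> fr zuv Uz; apply: connected_frontier => //.
- by apply/connected_intervalP; exact: interval_is_interval.
- by exists z; split.
Qed.

Lemma open_bounded_integrable : mu.-integrable U (EFin \o h').
Proof.
have cl x : closure U x -> `|x| <= K.
  move=> Ux; suff : `[- K, K]%classic x by rewrite /= in_itv/= ler_norml.
  rewrite ((closure_id `[- K, K]%classic).1 (@itv_closed _ _ _ _)).
  by apply: closure_subset Ux => y /bU/ltW; rewrite /= in_itv/= ler_norml.
have cU : compact (closure U).
  apply: (@subclosed_compact _ _ (`[- K, K]%classic : set R)).
  - exact: closed_closure.
  - exact: segment_compact.
  - by move=> x /cl; rewrite /= in_itv/= ler_norml.
apply: (@integrableS _ _ _ mu (closure U)).
- exact: compact_measurable.
- exact: open_measurable.
- exact: subset_closure.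
apply: continuous_compact_integrable => //.
by apply: continuous_in_subspaceT => x; rewrite inE; exact: ch.
Qed.

Let ih (A : set R) : measurable A -> A `<=` U -> mu.-integrable A (EFin \o h').
Proof.
move=> mA AU; apply: (@integrableS _ _ _ mu U) => //; first exact: open_measurable.
exact: open_bounded_integrable.
Qed.

Let ftc u v : u < v -> `]u, v[%classic `<=` U ->
  \int[mu]_(x in `]u, v[) h' x = h v - h u.
Proof.
move=> uv uvU.
have cuv x : u <= x <= v -> closure U x.
  by move=> xuv; apply: (closure_subset uvU); exact: closure_itv.
have iuv : mu.-integrable `[u, v] (EFin \o h').
  apply: continuous_compact_integrable; first exact: segment_compact.
  by apply: continuous_in_subspaceT => x; rewrite inE/= in_itv/= => /cuv/ch.
have mh : measurable_fun `[u, v] h'.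
  by apply/measurable_EFinP; exact: (measurable_int mu).
have dx x : u <= x <= v -> derivable h x 1.
  by move=> /cuv/dh[].
have cx x : u <= x <= v -> {for x, continuous h}.
  by move=> /dx/derivable1_diffP/differentiable_continuous.
have -> : \int[mu]_(x in `]u, v[) h' x = \int[mu]_(x in `[u, v]) h' x.
  rewrite /Rintegral [in RHS]integral_itv_bndoo//; apply/measurable_EFinP.
  by apply: measurable_funS mh => //; exact: subset_itv_oo_cc.
rewrite /Rintegral (@continuous_FTC2 _ h' h)//.
- by apply: continuous_in_subspaceT => x; rewrite inE/= in_itv/= => /cuv/ch.
- split.
  + by move=> x; rewrite in_itv/= => /andP[? ?]; apply: dx; rewrite !ltW.
  + by apply: cvg_at_right_filter; apply: cx; rewrite lexx ltW.
  + by apply: cvg_at_left_filter; apply: cx; rewrite lexx ltW.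
- move=> x; rewrite in_itv/= => /andP[? ?].
  have /dh ? : closure U x by apply: cuv; rewrite !ltW.
  by rewrite derive1E derive_val.
Qed.

(** Induction on the frontier points to the right of [x], in increasing order. Between consecutive
    ones [U] contains everything or nothing; [r] records which of the two holds just to the right of
    [x], and [- r * h x] is the lower end of the integral then under way. *)
Let ray x (r : bool) (s : seq R) (j : R -> R) :
  path <%R x s -> (forall z, x < z -> closure U z -> ~ U z -> z \in s) ->
  {in s, forall z, (j z = 1 \/ j z = -1) /\ crosses U (j z) z} ->
  (exists2 e, 0 < e & forall d, 0 < d < e -> U (x + d) <-> r) ->
  \int[mu]_(z in U `&` `]x, +oo[) h' z = \sum_(z <- s) j z * h z - r%:R * h x.
Proof.
elim: s x r => [|y s IH] x r /=.
  move=> _ fr _ [e e0 He].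
  (* Past the last frontier point, a point of [U] would drag into [U] points beyond the bound
     [K]. *)
  have noU z : x < z -> ~ U z.
    move=> xz Uz; pose w := Num.max z K + 1.
    have zw : z < w by rewrite ltr_pwDr// le_max lexx.
    have Kw : K < w by rewrite ltr_pwDr// le_max lexx orbT.
    have sub : `]x, w + 1[%classic `<=` U.
      apply: (@itv_sub _ _ z) => //; last by rewrite xz (lt_trans zw) ?ltrDl.
      move=> t /andP[xt _] ct; apply: contrapT => nUt.
      by have := fr t xt ct nUt.
    have /bU : U w by apply: sub; rewrite /= in_itv/= (lt_trans xz zw) ltrDl ltr01.
    by have := ler_norm w; lra.
  have -> : U `&` `]x, +oo[ = set0.
    by rewrite -subset0 => z [Uz]; rewrite /= in_itv/= andbT => /noU.
  have -> : r = false.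
    case: r He => // He; have /He[_ /(_ isT)] : 0 < e / 2 < e by lra.
    by move=> /noU[]; lra.
  by rewrite big_nil mul0r subr0 Rintegral_set0.
move=> /andP[xy ps] fr js [e e0 He].
have [jy [ey ey0 Hy]] := js y (mem_head _ _).
have nUy : ~ U y.
  move=> Uy; have /nbhs_ballP[d /= d0 dP] := open_nbhs_nbhs (conj oU Uy).
  have [t [t0 td te]] := exists_lt2 d0 ey0.
  have [|_] := Hy t; first by rewrite t0.
  apply; apply: dP; rewrite -ball_normE/= opprD addNKr normrN normrM (gtr0_norm t0).
  by case: jy => ->; rewrite ?normrN normr1 mul1r.
have frxy z : x < z < y -> closure U z -> U z.
  move=> /andP[xz zy] cz; apply: contrapT => /(fr z xz cz).
  rewrite inE => /predU1P[zE|zs]; first by rewrite zE ltxx in zy.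
  have /allP/(_ z zs) := order_path_min (@lt_trans _ R) ps.
  by move=> /(lt_trans zy); rewrite ltxx.
have UE : U `&` `]x, +oo[ = (U `&` `]x, y[) `|` (U `&` `]y, +oo[).
  apply/seteqP; split=> z /=; rewrite !in_itv/= !andbT.
    move=> [Uz xz]; have [zy|yz|zy] := ltgtP z y; [left|right|by rewrite zy in Uz] => //.
    by rewrite xz.
  move=> [[Uz /andP[xz _]]|[Uz yz]]; split => //; exact: lt_trans yz.
have mU : measurable U by exact: open_measurable.
rewrite UE Rintegral_setU//; first last.
- apply/disj_setPS => z [[_]]/=; rewrite !in_itv/= andbT => /andP[_ zy] [_ yz].
  by have := lt_trans zy yz; rewrite ltxx.
- by apply: ih; [apply: measurableU; apply: measurableI|rewrite -UE; exact: subIsetl].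
- exact: measurableI.
- exact: measurableI.
(* [j y = -1] means that [U] is left towards smaller values at [y], so [U] lies just to the right of
   [y]. *)
rewrite (IH y (j y == -1))//.
- rewrite big_cons.
  have yx0 : 0 < y - x by rewrite subr_gt0.
  have [t [t0 te tey txy]] := exists_lt3 e0 ey0 yx0.
  have [|Hy1 Hy2] := Hy t; first by rewrite t0.
  case: r He => He.
    have sub : `]x, y[%classic `<=` U.
      by apply: (@itv_sub _ _ (x + t)) => //; [lra|apply/He => //; rewrite t0].
    have jy1 : j y = 1.
      case: jy => // jyN; exfalso; apply: Hy2; rewrite jyN; apply: sub.
      by rewrite /= in_itv/=; lra.
    by rewrite setIidr// ftc// jy1 one_neqN1 /= ?mulr0n ?mulr1n; ring.
  have -> : U `&` `]x, y[ = set0.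
    rewrite -subset0 => z [Uz]; rewrite /= in_itv/= => zxy.
    have sub := itv_sub frxy zxy Uz.
    have /He : 0 < t < e by rewrite t0.
    by case=> h1 _; suff: false by []; apply: h1; apply: sub; rewrite /= in_itv/=; lra.
  have jyN : j y = -1.
    case: jy => // jy1; exfalso; move: Hy1; rewrite jy1 => Uyt.
    have yx : x < y - 1 * t < y by lra.
    have sub := itv_sub frxy yx Uyt.
    have /He : 0 < t < e by rewrite t0.
    by case=> h1 _; suff: false by []; apply: h1; apply: sub; rewrite /= in_itv/=; lra.
  by rewrite Rintegral_set0 jyN eqxx /= ?mulr0n ?mulr1n; ring.
- move=> z yz cz nUz; have := fr z (lt_trans xy yz) cz nUz.
  by rewrite inE => /predU1P[zE|//]; rewrite zE ltxx in yz.
- by move=> z zs; apply: js; rewrite inE zs orbT.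
- exists ey => // d /Hy; case: jy => ->.
    by rewrite !mul1r one_neqN1 => -[].
  by rewrite !mulN1r opprK eqxx => -[].
Qed.

Lemma FTC_open (s : seq R) (j : R -> R) : uniq s ->
  (forall z, closure U z -> ~ U z -> z \in s) ->
  {in s, forall z, (j z = 1 \/ j z = -1) /\ crosses U (j z) z} ->
  \int[mu]_(z in U) h' z = \sum_(z <- s) j z * h z.
Proof.
move=> us fr js.
pose s' := sort <=%R s.
(* A base point to the left of [U] and of every point of [s]; [ray] starts there with
   [r = false]. *)
pose x := - (\sum_(z <- s) `|z| + `|K| + 1).
have lts z : z \in s -> x < z.
  move=> zs; rewrite ltrNl /x opprK || idtac.
  have : `|z| <= \sum_(z <- s) `|z|.
    rewrite (perm_big _ (perm_to_rem zs))/= big_cons lerDl.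
    by apply: sumr_ge0.
  by have := ler_norm (- z); rewrite normrN; have := normr_ge0 K; rewrite /x; lra.
have sum0 : 0 <= \sum_(z <- s) `|z| by apply: sumr_ge0.
have xU z : U z -> x + 1 < z.
  move=> /bU; have := ler_norm K; have := ler_norm (- z); rewrite normrN /x; lra.
have UE : U = U `&` `]x, +oo[.
  by apply/seteqP; split=> z; [move=> Uz; split => //=; rewrite in_itv/= andbT; have := xU _ Uz; lra|case].
rewrite {1}UE (@ray x false s' j).
- by rewrite mul0r subr0; apply: perm_big; rewrite perm_sort.
- rewrite path_sortedE; last exact: lt_trans.
  apply/andP; split; first by apply/allP => z; rewrite mem_sort; exact: lts.
  by rewrite lt_sorted_uniq_le sort_uniq us sort_le_sorted.
- by move=> z _ cz nz; rewrite mem_sort; exact: fr.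
- by move=> z; rewrite mem_sort; exact: js.
- by exists 1 => // d /andP[d0 d1]; split => // /xU; lra.
Qed.

End FTCOpen.

Lemma cvg_sum_seq (R : realType) (T : Type) (F : set_system T) (FF : Filter F)
    (I : eqType) (s : seq I) (f : I -> T -> R) (l : I -> R) :
  (forall i, i \in s -> f i @ F --> l i) ->
  (fun x => \sum_(i <- s) f i x) @ F --> \sum_(i <- s) l i.
Proof.
elim: s => [|i s IH] H.
  by rewrite big_nil; under eq_fun do rewrite big_nil; exact: cvg_cst.
rewrite big_cons; under eq_fun do rewrite big_cons.
apply: cvgD; first by apply: H; rewrite mem_head.
by apply: IH => j js; apply: H; rewrite inE js orbT.
Qed.

(** * Level sets at a regular value *)

Section LevelSets.
Variable R : realType.
Variables (b : R -> R) (y : R).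
Hypothesis db : forall t, derivable b t 1.
Hypothesis cb : continuous (derive1 b).
Hypothesis regular : forall t, 0 <= t <= 1 -> b t = y -> derive1 b t != 0.
Hypothesis nodyad : forall m i, b (dyad R m i) != y.

Let cb0 : continuous b. Proof. exact: continuous_derivable1. Qed.

Lemma C1_MVT (u v : R) : u < v ->
  exists2 z, u < z < v & b v - b u = derive1 b z * (v - u).
Proof.
move=> uv; have [||z zi zE] := @MVT R b (derive1 b) u v uv.
- by move=> z _; rewrite derive1E; exact: (DeriveDef (@db z) (erefl _)).
- exact: continuous_subspaceT.
- by exists z => //; move: zi; rewrite in_itv.
Qed.

(** The continuous function [|b t - y| + |b' t|] has a minimum on [0, 1], positive because [y] is a
    regular value. *)
Let slope_bound : exists2 d, 0 < d &
  forall t, 0 <= t <= 1 -> b t = y -> d <= `|derive1 b t|.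
Proof.
have cf : {within `[0, 1], continuous (fun t => `|b t - y| + `|derive1 b t|)}.
  apply: continuous_subspaceT => t; apply: cvgD; apply: cvg_norm; last exact: cb.
  by apply: cvgB; [exact: cb0|exact: cvg_cst].
have [c c01 cP] := EVT_min ler01 cf.
exists (`|b c - y| + `|derive1 b c|).
  rewrite lt_neqAle addr_ge0// andbT eq_sym paddr_eq0// !normr_eq0 subr_eq0.
  by apply/negP => /andP[/eqP bc]; apply/negP/regular.
by move=> t t01 bt; have := cP t; rewrite in_itv/= bt subrr normr0 add0r; apply.
Qed.

(** On a dyadic interval so short that [b'] varies by less than [d], the lower bound of its modulus
    on the level set, [b'] keeps the sign that it has at a crossing. Such an interval then contains
    at most one crossing. *)
Let near_monotone : exists2 N, True & forall m, (N <= m)%N -> forall i, (i < 2 ^ m)%N ->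
  forall t, dyad R m i <= t <= dyad R m i.+1 -> b t = y ->
  forall z, dyad R m i <= z <= dyad R m i.+1 -> 0 < derive1 b z * Num.sg (derive1 b t).
Proof.
have [d d0 dP] := slope_bound.
have [e e0 eP] := unif_continuous_itv (fun t (_ : 0 <= t <= 1) => @cb t) d0.
have /cvgrPdist_lt/(_ _ e0)[N _ NP] := @cvg_expVn2 R.
exists N => // m /NP; rewrite sub0r normrN ger0_norm ?invr_ge0// => me i im t ti bt z zi.
have t01 : 0 <= t <= 1.
  have /andP[h1 _] := @dyad_itv R _ _ (ltnW im); have /andP[_ h2] := @dyad_itv R _ _ im.
  by move: ti => /andP[h3 h4]; rewrite (le_trans h1 h3) (le_trans h4 h2).
have := dP t t01 bt.
have : `|derive1 b t - derive1 b z| < d.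
  apply: eP => //; apply: le_lt_trans me.
  by move: ti zi; rewrite dyadS ler_norml; lra.
rewrite ltr_norml; case: (ltgtP (derive1 b t) 0) => [bn|bp|b0].
- by rewrite ltr0_norm// ltr0_sg//; lra.
- by rewrite gtr0_norm// gtr0_sg//; lra.
- by have := regular t01 bt; rewrite b0 eqxx.
Qed.

Let uniq_crossing m i t w : (forall z, dyad R m i <= z <= dyad R m i.+1 ->
    0 < derive1 b z * Num.sg (derive1 b t)) ->
  dyad R m i <= t <= dyad R m i.+1 -> dyad R m i <= w <= dyad R m i.+1 ->
  b t = y -> b w = y -> t = w.
Proof.
move=> H ti wi bt bw.
have aux u v : dyad R m i <= u <= dyad R m i.+1 -> dyad R m i <= v <= dyad R m i.+1 ->
    b u = y -> b v = y -> u < v -> False.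
  move=> ui vi bu bv uv; have [z zi] := C1_MVT uv.
  rewrite bu bv subrr => /esym/eqP; rewrite mulf_eq0 subr_eq0 (gt_eqF uv) orbF => /eqP z0.
  by have := H z; rewrite z0 mul0r ltxx => /(_ _)/wrap[]//; lra.
by case: (ltgtP t w) => // /aux; [move/(_ ti wi bt bw)|move/(_ wi ti bw bt)].
Qed.

(** On a fine dyadic interval with a crossing, [b] is strictly monotone and the indicator of [y < b]
    jumps by the sign of [b']; without a crossing, the intermediate value theorem excludes a jump.
    [nodyad] keeps the crossings off the division points. *)
Lemma level_set_jumps : exists s : seq R, [/\ uniq s,
  forall t, t \in s <-> 0 <= t <= 1 /\ b t = y &
  \forall m \near \oo, forall i, (i < 2 ^ m)%N ->
    (y < b (dyad R m i.+1))%R%:R - (y < b (dyad R m i))%R%:R =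
    \sum_(t <- s | dyad R m i < t < dyad R m i.+1) Num.sg (derive1 b t) :> R].
Proof.
have [N _ NP] := near_monotone.
pose A m i : set R := [set t | dyad R m i <= t <= dyad R m i.+1 /\ b t = y].
(* [c i] is the crossing in the [i]-th interval of level [N]. The default 0 occurs only where there
   is none, and [s] skips these intervals; one crossing per interval makes the level set finite. *)
pose c i := xget 0 (A N i).
pose s := [seq c i | i <- iota 0 (2 ^ N) & `[< A N i !=set0 >]].
have cA i : A N i !=set0 -> A N i (c i).
  by move=> [t At]; apply: (@xgetPex _ 0 (A N i)); exists t.
have sP t : t \in s <-> 0 <= t <= 1 /\ b t = y.
  split.
    move=> /mapP[i]; rewrite mem_filter mem_iota add0n leq0n/= => /andP[/asboolP/cA[h1 h2] im] ->.
    split=> //; have /andP[h3 _] := @dyad_itv R _ _ (ltnW im).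
    have /andP[_ h4] := @dyad_itv R _ _ im.
    by move: h1 => /andP[h5 h6]; rewrite (le_trans h3 h5) (le_trans h6 h4).
  move=> [t01 bt]; have [i im ti] := dyad_cover N t01.
  have [ci bci] : A N i (c i) by apply: cA; exists t.
  apply/mapP; exists i.
    by rewrite mem_filter mem_iota add0n leq0n im /= andbT; apply/asboolP; exists t.
  by apply: (@uniq_crossing N i) => //; apply: NP.
have us : uniq s.
  rewrite map_inj_in_uniq ?filter_uniq ?iota_uniq// => i j.
  rewrite !mem_filter => /andP[/asboolP/cA[ci bci] _] /andP[/asboolP/cA[cj bcj] _] cE.
  have aux k l : A N k (c k) -> A N l (c l) -> c k = c l -> (k < l)%N -> False.
    move=> [ck bck] [cl bcl] ckl kl.
    have dkl : dyad R N k.+1 <= dyad R N l.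
      by rewrite /dyad ler_pM2r ?invr_gt0 ?exprn_gt0// ler_nat.
    have E : c k = dyad R N k.+1 by rewrite -ckl in cl; lra.
    by have := nodyad N k.+1; rewrite -E bck eqxx.
  by case: (ltngtP i j) => // /aux; [move/(_ (conj ci bci) (conj cj bcj) cE)|
     move/(_ (conj cj bcj) (conj ci bci) (esym cE))].
exists s; split => //.
exists N => // m /= Nm i im.
have ds : dyad R m i < dyad R m i.+1 by exact: ltr_dyadS.
have n1 := nodyad m i; have n2 := nodyad m i.+1.
have d01 t : dyad R m i <= t <= dyad R m i.+1 -> 0 <= t <= 1.
  have /andP[h1 _] := @dyad_itv R _ _ (ltnW im); have /andP[_ h2] := @dyad_itv R _ _ im.
  by move=> /andP[h3 h4]; rewrite (le_trans h1 h3) (le_trans h4 h2).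
have [[t [ti bt]]|none] := pselect (A m i !=set0).
  have H := NP m Nm i im t ti bt.
  have tn1 : t != dyad R m i by apply: contra_neq n1 => <-.
  have tn2 : t != dyad R m i.+1 by apply: contra_neq n2 => <-.
  have tio : dyad R m i < t < dyad R m i.+1.
    by case/andP: ti => h1 h2; rewrite !lt_neqAle h1 h2 eq_sym tn1 tn2.
  have ts : t \in s by apply/sP; split => //; exact: d01.
  rewrite big_mkcond (bigD1_seq t)//= tio big1_seq ?addr0; last first.
    move=> w /andP[wt /sP[_ bw]]; case: ifP => // wi; exfalso; move/eqP: wt; apply.
    by apply/esym; apply: (uniq_crossing H) => //; case/andP: wi => h1 h2; rewrite !ltW.
  have [z1 z1i E1] : exists2 z, dyad R m i <= z <= dyad R m i.+1 &
      y - b (dyad R m i) = derive1 b z * (t - dyad R m i).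
    case/andP: tio => h1 h2; have [z zi] := C1_MVT h1.
    by rewrite bt => E; exists z => //; lra.
  have [z2 z2i E2] : exists2 z, dyad R m i <= z <= dyad R m i.+1 &
      b (dyad R m i.+1) - y = derive1 b z * (dyad R m i.+1 - t).
    case/andP: tio => h1 h2; have [z zi] := C1_MVT h2.
    by rewrite bt => E; exists z => //; lra.
  have t1 : 0 < t - dyad R m i by lra.
  have t2 : 0 < dyad R m i.+1 - t by lra.
  have := H z1 z1i; have := H z2 z2i.
  case: (ltgtP (derive1 b t) 0) => [bn|bp|b0].
  - rewrite ltr0_sg// !mulrN1 !oppr_gt0 => p2 p1.
    have q1 : derive1 b z1 * (t - dyad R m i) < 0 by rewrite nmulr_rlt0.
    have q2 : derive1 b z2 * (dyad R m i.+1 - t) < 0 by rewrite nmulr_rlt0.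
    have -> : y < b (dyad R m i) by lra.
    have -> : (y < b (dyad R m i.+1)) = false by apply/negbTE; rewrite -leNgt; lra.
    by rewrite /= sub0r.
  - rewrite gtr0_sg// !mulr1 => p2 p1.
    have q1 : 0 < derive1 b z1 * (t - dyad R m i) by rewrite mulr_gt0.
    have q2 : 0 < derive1 b z2 * (dyad R m i.+1 - t) by rewrite mulr_gt0.
    have -> : (y < b (dyad R m i)) = false by apply/negbTE; rewrite -leNgt; lra.
    have -> : y < b (dyad R m i.+1) by lra.
    by rewrite /= subr0.
  - by have := regular (d01 _ ti) bt; rewrite b0 eqxx.
rewrite big1_seq; last first.
  move=> t /andP[ti /sP[_ bt]]; exfalso; apply: none; exists t; split => //.
  by case/andP: ti => h1 h2; rewrite !ltW.
have noc : Num.min (b (dyad R m i)) (b (dyad R m i.+1)) <= y <=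
    Num.max (b (dyad R m i)) (b (dyad R m i.+1)) -> False.
  move=> H; have [||c' c'i c'E] := @IVT R b (dyad R m i) (dyad R m i.+1) y _ _ H.
  - exact: ltW.
  - exact: continuous_subspaceT.
  - by apply: none; exists c'; split => //; move: c'i; rewrite in_itv.
case: (ltP y (b (dyad R m i))) => h1; case: (ltP y (b (dyad R m i.+1))) => h2;
  rewrite ?subrr//; exfalso; apply: noc.
  by rewrite ge_min h2 orbT le_max (ltW h1).
by rewrite ge_min h1 le_max (ltW h2) orbT.
Qed.

(** For each [m] exactly one dyadic interval contains [t], so the sum has a single term, whose tag
    tends to [t]. *)
Lemma dyad_tag_cvg (g : R -> R) (t : R) : {for t, continuous g} -> 0 < t < 1 ->
  (forall m i, t != dyad R m i) ->
  (fun m => \sum_(i < 2 ^ m | dyad R m i < t < dyad R m i.+1) g (dyad R m i)) @ \oo --> g t.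
Proof.
move=> cg /andP[t0 t1] nt.
have t01 : 0 <= t < 1 by rewrite ltW.
pose i_ m := s2val (cid2 (dyad_floor m t01)).
have i_lt m : (i_ m < 2 ^ m)%N by rewrite /i_; case: cid2.
have i_P m : dyad R m (i_ m) <= t < dyad R m (i_ m).+1 by rewrite /i_; case: cid2.
have -> : (fun m => \sum_(i < 2 ^ m | dyad R m i < t < dyad R m i.+1) g (dyad R m i)) =
    (fun m => g (dyad R m (i_ m))).
  apply/funext => m; rewrite (big_pred1 (Ordinal (i_lt m)))// => -[i im] /=.
  rewrite -val_eqE/=; apply/idP/eqP.
    move=> /andP[h1 h2]; have /andP[h3 h4] := i_P m.
    have dlt k l : dyad R m k < dyad R m l -> (k < l)%N.
      by rewrite /dyad ltr_pM2r ?invr_gt0 ?exprn_gt0// ltr_nat.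
    have l1 : (i < (i_ m).+1)%N by apply: dlt; exact: lt_trans h1 h4.
    have l2 : (i_ m < i.+1)%N by apply: dlt; exact: le_lt_trans h3 h2.
    by apply/eqP; rewrite eqn_leq; apply/andP; split.
  move=> ->; have /andP[h1 h2] := i_P m; rewrite h2 andbT lt_neqAle h1 andbT.
  by rewrite eq_sym; exact: nt.
suff : (fun m => dyad R m (i_ m)) @ \oo --> t by move=> h; exact: (cvg_comp _ _ h cg).
apply/cvgrPdist_lt => e e0; have /cvgrPdist_lt/(_ _ e0)[N _ NP] := @cvg_expVn2 R.
exists N => // m /NP/=; rewrite sub0r normrN ger0_norm ?invr_ge0//; apply: le_lt_trans.
by rewrite distrC; apply: dist_dyad => //; have /andP[-> /ltW] := i_P m.
Qed.

(* For a regular value [y], the Riemann-Stieltjes sums of [g] against the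
   indicator of [y < b] only see the finitely many crossings of the level [y]. *)
Lemma level_set_cvg : exists s : seq R, [/\ uniq s,
  forall t, t \in s <-> 0 <= t <= 1 /\ b t = y &
  forall g : R -> R, (forall t, 0 <= t <= 1 -> {for t, continuous g}) ->
    (fun m => \sum_(i < 2 ^ m) g (dyad R m i) *
       ((y < b (dyad R m i.+1))%R%:R - (y < b (dyad R m i))%R%:R)) @ \oo -->
    \sum_(t <- s) g t * Num.sg (derive1 b t)].
Proof.
have [s [us sP sE]] := level_set_jumps.
exists s; split => // g cg.
have : (fun m => \sum_(t <- s) (\sum_(i < 2 ^ m | dyad R m i < t < dyad R m i.+1)
    g (dyad R m i)) * Num.sg (derive1 b t)) @ \oo --> \sum_(t <- s) g t * Num.sg (derive1 b t).
  apply: cvg_sum_seq => t /sP[t01 bt]; apply: cvgMl; apply: dyad_tag_cvg.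
  - exact: cg.
  - have := nodyad 0 0; have := nodyad 0 1.
    rewrite dyad0 (dyad1 _ 0) -bt => n1 n0; case/andP: t01 => h0 h1.
    rewrite !lt_neqAle h0 h1 !andbT; apply/andP; split.
      by apply: contra_neq n0 => ->.
    by apply: contra_neq n1 => ->.
  - by move=> m i; apply: contra_neq (nodyad m i) => <-.
apply: cvg_trans; apply: near_eq_cvg; near=> m.
have sEm : forall i, (i < 2 ^ m)%N ->
    (y < b (dyad R m i.+1))%R%:R - (y < b (dyad R m i))%R%:R =
    \sum_(t <- s | dyad R m i < t < dyad R m i.+1) Num.sg (derive1 b t) :> R.
  by near: m; exact: sE.
apply/esym; rewrite (eq_bigr (fun i : 'I_(2 ^ m) => \sum_(t <- s | dyad R m i < t < dyad R m i.+1)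
    (g (dyad R m i) * Num.sg (derive1 b t)))); last first.
  by move=> i _; rewrite sEm// mulr_sumr.
rewrite (exchange_big_dep xpredT)//=; apply: eq_bigr => t _.
by rewrite mulr_suml.
Unshelve. all: by end_near. Qed.

End LevelSets.

(** * The divergence theorem *)

Section Jumps.
Variable R : realType.
Local Notation mu := (@lebesgue_measure R).
Implicit Types u v y : R.

(** Integrated over the level [y] this gives [v - u]: increments of an arc coordinate become
    integrals over the slices. *)
Definition jump u v y : R := (y < v)%R%:R - (y < u)%R%:R.

Lemma jumpN u v y : jump v u y = - jump u v y.
Proof. by rewrite /jump opprB. Qed.

Lemma jumpD u v w y : jump u v y + jump v w y = jump u w y.
Proof. by rewrite /jump; ring. Qed.

Lemma jump_indic u v : u <= v -> jump u v = \1_(`[u, v[%classic).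
Proof.
move=> uv; apply/funext => y; rewrite /jump indicE mem_setE in_itv/=.
case: (ltP y u) => yu; last by rewrite subr0.
by rewrite (lt_le_trans yu uv) subrr.
Qed.

Lemma integrable_jump u v : mu.-integrable setT (EFin \o jump u v).
Proof.
wlog uv : u v / u <= v.
  move=> H; have [/H//|/ltW/H] := leP u v.
  move=> /integrableN; apply: eq_integrable => //= y _.
  by rewrite (jumpN u v) opprK.
by rewrite jump_indic//; exact: integrable_indic_itv.
Qed.

Lemma integral_jump u v : (\int[mu]_y (jump u v y)%:E = (v - u)%:E)%E.
Proof.
wlog uv : u v / u <= v.
  move=> H; have [/H//|/ltW/H E] := leP u v.
  rewrite (_ : (fun y => _) = (fun y => - (jump v u y)%:E)%E); last first.
    by apply/funext => y; rewrite jumpN EFinN.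
  rewrite integralN/=; last exact: integrable_add_def (integrable_jump _ _).
  by rewrite E -EFinN opprB.
rewrite (jump_indic uv) integral_indic// setIT.
apply: (etrans (lebesgue_measure_itv `[u, v[)); rewrite /= lte_fin.
by case: ltP => // vu; congr (_%:E); apply/esym/eqP; rewrite subr_eq0 eq_le vu uv.
Qed.

Lemma integral_norm_jump u v : (\int[mu]_y (`|jump u v y|)%:E = `|v - u|%:E)%E.
Proof.
wlog uv : u v / u <= v.
  move=> H; have [/H//|/ltW/H E] := leP u v.
  by rewrite distrC -E; apply: eq_integral => y _; rewrite jumpN normrN.
rewrite ger0_norm ?subr_ge0// -integral_jump; apply: eq_integral => y _.
by rewrite (jump_indic uv) ger0_norm// indicE ler0n.
Qed.

End Jumps.

Lemma ex2_ex1 (T : Type) (P Q : T -> Prop) :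
  (exists2 x, P x & Q x) -> exists x, P x /\ Q x.
Proof. by move=> [x Px Qx]; exists x. Qed.

(** * Green's formula by slices *)

Section SliceGreen.
(** [U y] is the slice at level [y]. Along the arcs, [a] is the coordinate within the slice and [b]
    the level. [sigma] is the orientation: 1 for horizontal slices, -1 for vertical ones. *)
Variables (R : realType) (n : nat) (U : R -> set R) (a b : 'I_n -> R -> R).
Variables (f fx : R -> R -> R) (K sigma : R).
Local Notation mu := (@lebesgue_measure R).
Hypothesis sigmaE : sigma = 1 \/ sigma = -1.
Hypothesis oU : forall y, open (U y).
Hypothesis bU : forall y x, U y x -> `|x| < K.
Hypothesis db : forall k t, derivable (b k) t 1.
Hypothesis cb : forall k, continuous (derive1 (b k)).
Hypothesis frontier : forall y x, closure (U y) x -> ~ U y x ->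
  exists k t, [/\ 0 <= t <= 1, a k t = x & b k t = y].
Hypothesis simple : forall k l s t, 0 < s < 1 -> 0 <= t <= 1 ->
  a k s = a l t -> b k s = b l t -> k = l /\ s = t.
Hypothesis cross : forall k t, 0 < t < 1 -> derive1 (b k) t != 0 ->
  crosses (U (b k t)) (sigma * Num.sg (derive1 (b k) t)) (a k t).
Hypothesis cg : forall k t, 0 <= t <= 1 -> {for t, continuous (fun t => f (a k t) (b k t))}.
Hypothesis df : forall y x, closure (U y) x -> is_derive x 1 (f ^~ y) (fx x y).
Hypothesis cf : forall y x, closure (U y) x -> {for x, continuous (fx ^~ y)}.

Let D y := \int[mu]_(x in U y) fx x y.
Hypothesis mD : measurable_fun setT D.

Let g k t := f (a k t) (b k t).
(* As a function of [y], [F m] integrates to a Riemann-Stieltjes sum of [g] along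
   the arcs; pointwise it tends to [sigma] times the slice integral [D y]. *)
Let F m y := \sum_k \sum_(i < 2 ^ m)
  g k (dyad R m i) * jump (b k (dyad R m i)) (b k (dyad R m i.+1)) y.

Let crosses_uniq (V : set R) x : crosses V 1 x -> crosses V (-1) x -> False.
Proof.
move=> [d d0 dP] [e e0 eP]; have [t [t0 td te]] := exists_lt2 d0 e0.
have /dP[H _] : 0 < t < d by rewrite t0.
have /eP[_ ] : 0 < t < e by rewrite t0.
by apply; move: H; rewrite mul1r mulN1r.
Qed.

(** The fundamental theorem on [U y] and [level_set_cvg] yield the same sum over the crossings,
    since by [cross] the exit direction at a crossing is [sigma] times the sign of [b']. *)
Let slice_cvg y :
  (forall k t, 0 <= t <= 1 -> b k t = y -> derive1 (b k) t != 0) ->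
  (forall k m i, b k (dyad R m i) != y) ->
  F ^~ y @ \oo --> sigma * D y.
Proof.
move=> reg nd.
have [s sP] := boolp.choice (fun k => level_set_cvg (@db k) (@cb k) (reg k) (nd k)).
(* 0 and 1 are dyadic, so [nd] keeps the crossings away from the ends of the arcs, where nothing is
   known about the two sides. *)
have sin k t : t \in s k -> 0 < t < 1 /\ b k t = y.
  have [_ H _] := sP k; move=> /H[t01 bt]; split => //.
  have := nd k 0 0; have := nd k 0 1; rewrite dyad0 (dyad1 _ 0) -bt => n1 n0.
  case/andP: t01 => h0 h1; rewrite !lt_neqAle h0 h1 !andbT; apply/andP; split.
    by apply: contra_neq n0 => ->.
  by apply: contra_neq n1 => ->.
have sg1 k t : t \in s k -> let j := sigma * Num.sg (derive1 (b k) t) in j = 1 \/ j = -1.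
  move=> /sin[t01 bt] /=.
  have : derive1 (b k) t != 0 by apply: reg => //; case/andP: t01 => h1 h2; rewrite !ltW.
  case: (ltgtP (derive1 (b k) t) 0) => // h _; rewrite ?(ltr0_sg h) ?(gtr0_sg h);
    by case: sigmaE => ->; rewrite ?mulr1 ?mulrN1 ?opprK; auto.
have scross k t : t \in s k -> crosses (U y) (sigma * Num.sg (derive1 (b k) t)) (a k t).
  move=> /sin[t01 bt]; rewrite -bt; apply: cross => //.
  by apply: reg => //; case/andP: t01 => h1 h2; rewrite !ltW.
(* [FTC_open] wants the direction as a function of the point, not of the arc parameter;
   [crosses_uniq] makes the two agree. *)
pose j x : R := if `[< crosses (U y) 1 x >] then 1 else -1.
have jE k t : t \in s k -> j (a k t) = sigma * Num.sg (derive1 (b k) t).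
  move=> ts; rewrite /j; have := scross _ _ ts.
  case: (sg1 _ _ ts) => -> h; first by rewrite asboolT.
  by case: asboolP => // h1; case: (crosses_uniq h1 h).
pose L := [seq a k t | k <- enum 'I_n, t <- s k].
have DE : D y = \sum_(x <- L) j x * f x y.
  apply: (@FTC_open R (U y) (f ^~ y) (fx ^~ y) K) => //.
  - exact: bU.
  - exact: cf.
  - apply: allpairs_uniq_dep; first exact: enum_uniq.
      by move=> k _; case: (sP k).
    move=> p1 p2 /allpairsPdep[k1 [t1 [_ t1s ->]]] /allpairsPdep[k2 [t2 [_ t2s ->]]] /= aE.
    have [t101 b1] := sin _ _ t1s; have [t201 b2] := sin _ _ t2s.
    have [||kE tE] := simple t101 _ aE; last 1 first.
    + by move: t2s; rewrite -kE -tE.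
    + by case/andP: t201 => h1 h2; rewrite !ltW.
    + by rewrite b1 b2.
  - move=> x cx nx; have [k [t [t01 ax bx]]] := frontier cx nx.
    apply/allpairsPdep; exists k, t; split => //; first by rewrite mem_enum.
    by case: (sP k) => _ H _; apply/H.
  - move=> x /allpairsPdep[k [t [_ ts ->]]]; rewrite jE//; split; first exact: sg1.
    exact: scross.
have -> : sigma * D y = \sum_k \sum_(t <- s k) g k t * Num.sg (derive1 (b k) t).
  rewrite DE big_allpairs_dep big_enum/= mulr_sumr; apply: eq_bigr => k _.
  rewrite mulr_sumr big_seq [RHS]big_seq; apply: eq_bigr => t ts.
  rewrite (jE _ _ ts) /g; have [_ ->] := sin _ _ ts.
  by case: sigmaE => ->; ring.
apply: (@cvg_sum_seq R _ _ _ 'I_n (index_enum 'I_n)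
  (fun k m => \sum_(i < 2 ^ m) g k (dyad R m i) * jump (b k (dyad R m i)) (b k (dyad R m i.+1)) y)
  (fun k => \sum_(t <- s k) g k t * Num.sg (derive1 (b k) t))) => k _.
by have [_ _ H] := sP k; apply: H => t; exact: cg.
Qed.

(** For almost every [y] this increases with [m] to the number of crossings of the level [y] by all
    arcs, their Banach indicatrix. A multiple of the limit dominates every [F m]. *)
Let V m y : R := \sum_k \sum_(i < 2 ^ m) `|jump (b k (dyad R m i)) (b k (dyad R m i.+1)) y|.

(** Halving a dyadic interval splits its jump into two, whose norms add up to at least the norm of
    the whole. *)
Let V_nd y : {homo V^~ y : m p / (m <= p)%N >-> (m <= p)%R}.
Proof.
apply: homo_leq => [//|m p q|m]; first exact: le_trans.
apply: ler_sum => k _; rewrite expnS mul2n.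
rewrite (big_nat_double (fun i => `|jump (b k (dyad R m.+1 i)) (b k (dyad R m.+1 i.+1)) y|)).
apply: ler_sum => i _.
by rewrite -doubleS !dyad_double -(jumpD _ (b k (dyad R m.+1 i.*2.+1))) ler_normD.
Qed.

Let V_ge0 m y : 0 <= V m y. Proof. by apply: sumr_ge0 => k _; apply: sumr_ge0. Qed.

Let mjump u v : measurable_fun setT (jump u v : R -> R).
Proof. by apply/measurable_EFinP; exact: (measurable_int _ (integrable_jump u v)). Qed.

Let mV m : measurable_fun setT (V m).
Proof.
apply: measurable_sum => k; apply: measurable_sum => i.
by apply: measurableT_comp => //; exact: mjump.
Qed.

Let Lip k : exists2 C, 0 <= C & forall u v, 0 <= u -> u < v -> v <= 1 ->
  `|b k v - b k u| <= C * (v - u).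
Proof.
have [C C0 bC] := bounded_itv ler01 (fun t _ => @cb k t).
exists C => // u v u0 uv v1; have [z zi ->] := C1_MVT (@db k) uv.
rewrite normrM [`|v - u|]ger0_norm ?subr_ge0 ?(ltW uv)// ler_wpM2r ?subr_ge0 ?(ltW uv)//.
by apply: bC; lra.
Qed.

(** The norm of a jump integrates to the size of an increment, so the sum is at most the Lipschitz
    constant of each arc over [0, 1], whatever [m]. *)
Let V_int : exists C : R, forall m, (\int[mu]_y (V m y)%:E <= C%:E)%E.
Proof.
have [C CP] := boolp.choice (fun k => ex2_ex1 (Lip k)).
exists (\sum_k C k) => m.
have -> : (fun y => (V m y)%:E) = (fun y => \sum_k \sum_(i < 2 ^ m)
    (`|jump (b k (dyad R m i)) (b k (dyad R m i.+1)) y|)%:E)%E.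
  apply/funext => y; rewrite /V -sumEFin; apply: eq_bigr => k _.
  by rewrite -sumEFin.
have mj u v : measurable_fun setT (fun y => `|jump u v y|%:E : \bar R).
  by apply/measurable_EFinP; apply: measurableT_comp => //; exact: mjump.
rewrite ge0_integral_sum//; last 2 first.
  by move=> k; apply: emeasurable_sum => i; exact: mj.
  by move=> k y _; apply: sume_ge0 => i _; rewrite lee_fin.
rewrite -sumEFin; apply: lee_sum => k _.
rewrite ge0_integral_sum//; last by move=> i; exact: mj.
have -> : C k = \sum_(i < 2 ^ m) C k * (dyad R m i.+1 - dyad R m i).
  rewrite -mulr_sumr -(big_mkord xpredT (fun i => dyad R m i.+1 - dyad R m i)).
  by rewrite telescope_sumr// dyad0 dyad1 subr0 mulr1.
rewrite -sumEFin; apply: lee_sum => i _; rewrite integral_norm_jump lee_fin.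
have [_ CkP] := CP k; apply: CkP; last by case/andP: (@dyad_itv R m i.+1 (ltn_ord i)).
  by case/andP: (@dyad_itv R m i (ltnW (ltn_ord i))).
exact: ltr_dyadS.
Qed.

Let intF m : (\int[mu]_y (F m y)%:E = (\sum_k \sum_(i < 2 ^ m)
  g k (dyad R m i) * (b k (dyad R m i.+1) - b k (dyad R m i)))%:E)%E.
Proof.
have -> : (fun y => (F m y)%:E) = (fun y => \sum_k \sum_(i < 2 ^ m)
   (g k (dyad R m i))%:E * (jump (b k (dyad R m i)) (b k (dyad R m i.+1)) y)%:E)%E.
  apply/funext => y; rewrite /F -sumEFin; apply: eq_bigr => k _.
  by rewrite -sumEFin; apply: eq_bigr => i _; rewrite EFinM.
have ij c u v : mu.-integrable setT (fun y => c%:E * (jump u v y)%:E)%E.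
  by apply: integrableZl => //; exact: integrable_jump.
rewrite integral_sum//; last by move=> k; apply: integrable_sum => // i _.
rewrite -sumEFin; apply: eq_bigr => k _; rewrite integral_sum//.
rewrite -sumEFin; apply: eq_bigr => i _; rewrite integralZl//; last exact: integrable_jump.
by rewrite integral_jump EFinM.
Qed.

Let mF m : measurable_fun setT (F m).
Proof.
apply: measurable_sum => k; apply: measurable_sum => i.
by apply: measurable_funM => //; exact: mjump.
Qed.

Let gbound : exists2 C, 0 <= C & forall k t, 0 <= t <= 1 -> `|g k t| <= C.
Proof.
have [C CP] := boolp.choice (fun k => ex2_ex1 (bounded_itv ler01 (@cg k))).
have C0 k : 0 <= C k by case: (CP k).
exists (\sum_k C k); first by apply: sumr_ge0.
move=> k t t01; have [_ H] := CP k; rewrite (le_trans (H t t01))// (bigD1 k)//= lerDl.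
by apply: sumr_ge0.
Qed.

(** The exceptional levels are the critical values of the [b k] and the countably many values at
    dyadic points. *)
Let null_cvg : exists N : set R, [/\ measurable N, mu N = 0 &
  forall y, ~ N y -> F ^~ y @ \oo --> sigma * D y].
Proof.
have h1 : {ae mu, forall y, forall k t, 0 <= t <= 1 -> b k t = y -> derive1 (b k) t != 0}.
  apply: filter_forall => k; have [A [mA A0 AP]] := critical_values_null (@db k) (@cb k).
  exists A; split => // y /= ny; apply: AP; apply: contrapT => nZ; apply: ny => t t01 bt.
  by apply/eqP => b0; apply: nZ; exists t.
have h2 : {ae mu, forall y, forall k m i, b k (dyad R m i) != y}.
  apply: filter_forall => k; apply: ae_foralln => m; apply: ae_foralln => i.
  exists [set b k (dyad R m i)]; split => //; first exact: lebesgue_measure_set1.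
  by move=> y /= /negP; rewrite negbK => /eqP.
have [N1 [mN1 N10 N1P]] := h1; have [N2 [mN2 N20 N2P]] := h2.
exists (N1 `|` N2); split; first exact: measurableU.
  by rewrite -N10; exact: measureU0.
move=> y /not_orP[n1 n2]; apply: slice_cvg; apply: contrapT => nh.
  by apply: n1; exact: N1P.
by apply: n2; exact: N2P.
Qed.

(** The integral of [F m] is evaluated in two ways in the limit: by dominated convergence, and as a
    Riemann-Stieltjes sum along the arcs. *)
Lemma slice_green : mu.-integrable setT (EFin \o D) /\
  sigma * \int[mu]_y D y = \sum_k \int[mu]_(t in `[0, 1]) (f (a k t) (b k t) * derive1 (b k) t).
Proof.
have [C C0 gC] := gbound.
have [L LP] := V_int.
pose h y := (C%:E * limn (fun m => (V m y)%:E))%E.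
have cvgV y : cvgn (fun m => (V m y)%:E).
  by apply: ereal_nondecreasing_is_cvgn => m p mp; rewrite lee_fin; exact: V_nd.
have leV m y : ((V m y)%:E <= limn (fun m => (V m y)%:E))%E.
  have nd : {homo (fun m => (V m y)%:E) : p q / (p <= q)%N >-> (p <= q)%E}.
    by move=> p q pq; rewrite lee_fin; exact: V_nd.
  rewrite (cvg_lim _ (ereal_nondecreasing_cvgn nd))//.
  by apply: ereal_sup_ubound; exists m.
have mlim : measurable_fun setT (fun y => limn (fun m => (V m y)%:E) : \bar R).
  apply: (@emeasurable_fun_cvg _ _ _ _ (fun m y => (V m y)%:E)) => //.
    by move=> m; apply/measurable_EFinP; exact: mV.
(* Monotone convergence turns the uniform bound [L] on the integrals of the [V m] into integrability
   of their limit. *)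
have ilim : mu.-integrable setT (fun y => limn (fun m => (V m y)%:E) : \bar R).
  apply/integrableP; split => //.
  have -> : (fun y => `|limn (fun m => (V m y)%:E)|%E) = (fun y => limn (fun m => (V m y)%:E)).
    apply/funext => y; rewrite gee0_abs// (le_trans _ (leV 0 y))// lee_fin; exact: V_ge0.
  rewrite monotone_convergence//; first last.
  - by move=> y _ m p mp; rewrite lee_fin; exact: V_nd.
  - by move=> m y _; rewrite lee_fin; exact: V_ge0.
  - by move=> m; apply/measurable_EFinP; exact: mV.
  apply: (@le_lt_trans _ _ L%:E); last by rewrite ltry.
  apply: lime_le; last by apply: nearW => m; exact: LP.
  apply: ereal_nondecreasing_is_cvgn => m p mp; apply: ge0_le_integral => //.
  - by move=> y _; rewrite lee_fin; exact: V_ge0.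
  - by apply/measurable_EFinP; exact: mV.
  - by apply/measurable_EFinP; exact: mV.
  - by move=> y _; rewrite lee_fin; exact: V_nd.
have [N [mN N0 NP]] := null_cvg.
have ih : mu.-integrable setT h by apply: integrableZl.
have leF y m : (`|(F m y)%:E| <= h y)%E.
  apply: (@le_trans _ _ (C%:E * (V m y)%:E)%E); last first.
    by apply: lee_wpmul2l; [rewrite lee_fin|exact: leV].
  rewrite -EFinM lee_fin /F /V mulr_sumr (le_trans (ler_norm_sum _ _ _))//.
  apply: ler_sum => k _; rewrite mulr_sumr (le_trans (ler_norm_sum _ _ _))//.
  apply: ler_sum => i _; rewrite normrM ler_wpM2r//.
  by apply: gC; exact: (@dyad_itv R m i (ltnW (ltn_ord i))).
have mFE m : measurable_fun setT (fun y => (F m y)%:E) by apply/measurable_EFinP; exact: mF.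
have msD : measurable_fun setT (fun y => (sigma * D y)%:E).
  by apply/measurable_EFinP; exact: measurable_funM.
have [||iD _ cvgI] := @dominated_convergence _ _ R mu setT measurableT _ _ _ mFE msD _ ih _.
- exists N; split => // y /= ny; apply: contrapT => Ny; apply: ny => _.
  by apply: cvg_EFin; [exact: nearW|exact: NP].
- by apply: aeW => y m _; exact: leF.
have s2 : sigma * sigma = 1 by case: sigmaE => ->; ring.
have iD' : mu.-integrable setT (EFin \o D).
  have := integrableZl measurableT sigma iD.
  by apply: eq_integrable => //= y _; rewrite -EFinM mulrA s2 mul1r.
split=> //.
have : (fun m => (\sum_k \sum_(i < 2 ^ m)
    g k (dyad R m i) * (b k (dyad R m i.+1) - b k (dyad R m i)))%:E) @ \oo -->
    (\int[mu]_y (sigma * D y)%:E)%E.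
  by move: cvgI; under eq_fun do rewrite intF.
have : (fun m => (\sum_k \sum_(i < 2 ^ m)
    g k (dyad R m i) * (b k (dyad R m i.+1) - b k (dyad R m i)))%:E) @ \oo -->
    (\sum_k \int[mu]_(t in `[0, 1]) (f (a k t) (b k t) * derive1 (b k) t))%:E.
  apply: cvg_EFin; first exact: nearW.
  apply: (@cvg_sum_seq R _ _ _ 'I_n (index_enum 'I_n)
    (fun k m => \sum_(i < 2 ^ m) g k (dyad R m i) *
      (b k (dyad R m i.+1) - b k (dyad R m i)))
    (fun k => \int[mu]_(t in `[0, 1]) (f (a k t) (b k t) * derive1 (b k) t))) => k _.
  by apply: riemann_stieltjes_cvg; [exact: cg|exact: db|exact: cb].
move=> h1 h2; have E := cvg_unique (@ereal_hausdorff R) h1 h2.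
by rewrite -RintegralZl// /Rintegral -E.
Qed.

End SliceGreen.

(** * Measure and iterated integrals in the plane *)

Section PlaneMeasure.
Variable R : realType.
Local Notation mu := (@lebesgue_measure R).
Local Notation mu2 := (lebesgue2 R).

(** The product sigma-algebra is generated by rectangles, so [D] is exhibited as the countable union
    of the boxes inside it with rational centre and half-width some [r n]. *)
Lemma open_measurable_plane (D : set (R * R)) : open D -> measurable D.
Proof.
move=> oD.
have [r [r0 rP]] : exists r : nat -> R, (forall n, 0 < r n) /\
    forall e, 0 < e -> exists n, r n < e.
  exists (fun n => n.+1%:R^-1); split=> [n|e e0]; first by rewrite invr_gt0.
  have := near_infty_natSinv_lt (PosNum e0).
  by move=> [n _ /(_ n (leqnn n)) nP]; exists n.
pose B (i : rat * rat * nat) : set (R * R) :=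
  `]ratr i.1.1 - r i.2, ratr i.1.1 + r i.2[%classic `*`
  `]ratr i.1.2 - r i.2, ratr i.1.2 + r i.2[%classic.
pose F i := if `[< B i `<=` D >] then B i else set0.
have -> : D = \bigcup_i F i.
  apply/seteqP; split => [[x y] Dxy|p [i _]]; last first.
    by rewrite /F; case: asboolP => // H; exact: H.
  have /nbhs_ballP[e /= e0 eD] := open_nbhs_nbhs (conj oD Dxy).
  have [n n0] : exists n : nat, r n < e / 2 by apply: rP; rewrite divr_gt0.
  have m0 := r0 n.
  have rat_near (z : R) : exists q : rat, `|ratr q - z| < r n.
    have [q qP] : exists q : rat, ratr q \in `]z - r n, z + r n[.
      by have [|q qP] := @rat_in_itvoo R (z - r n) (z + r n); [lra|exists q].
    by exists q; move: qP; rewrite in_itv/= ltr_norml; lra.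
  have [q1 q1P] := rat_near x; have [q2 q2P] := rat_near y.
  exists (q1, q2, n) => //; rewrite /F asboolT /B.
    split; rewrite /= in_itv/=; [move: q1P|move: q2P]; rewrite ltr_norml; lra.
  move=> [u v] [/=]; rewrite !in_itv/= => hu hv; apply: eD; split => /=;
    rewrite -ball_normE/= ltr_norml; move: q1P q2P; rewrite !ltr_norml; lra.
apply: countable_bigcupT_measurable; first exact: countableP.
move=> i; rewrite /F; case: asboolP => // _.
by apply: measurableX; exact: measurable_itv.
Qed.

Lemma continuous_measurable_plane (D : set (R * R)) (F : R * R -> R) :
  open D -> (forall p, D p -> {for p, continuous F}) -> measurable_fun D F.
Proof.
move=> oD cF; apply: (measurability _ (RGenOpens.measurableE R)).
move=> _ [_ [u [v ->] <-]]; apply: open_measurable_plane.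
rewrite openE => p [Dp Fp]; apply: filterI; first exact: open_nbhs_nbhs.
apply: (cF p Dp); by apply: open_nbhs_nbhs; split => //; exact: interval_open.
Qed.

Lemma bounded_plane (D : set (R * R)) : bounded_set D ->
  exists2 K, 0 < K & forall p, D p -> `|p.1| < K /\ `|p.2| < K.
Proof.
move=> [M [_ MP]]; exists (`|M| + 2) => [|p Dp]; first by have := normr_ge0 M; lra.
have : `|p| <= `|M| + 1.
  by apply: MP Dp; have := ler_norm M; lra.
rewrite prod_normE ge_max => /andP[h1 h2].
by split; [apply: le_lt_trans h1 _|apply: le_lt_trans h2 _]; lra.
Qed.

Lemma bounded_plane_measure (D : set (R * R)) : open D -> bounded_set D ->
  (mu2 D < +oo)%E.
Proof.
move=> oD /bounded_plane[K K0 KP].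
pose I := `]-K, K[%classic : set R.
have DI : D `<=` I `*` I.
  by move=> p /KP[h1 h2]; split; rewrite /I/= in_itv/= -ltr_norml.
have mI : measurable (I `*` I) by apply: measurableX; exact: measurable_itv.
apply: (@le_lt_trans _ _ (mu2 (I `*` I))).
  by apply: le_measure => //; rewrite inE//; exact: open_measurable_plane.
rewrite /lebesgue2 product_measure1E//; try exact: measurable_itv.
have E : (mu I < +oo)%E by rewrite /I lebesgue_measure_itv/=; case: ifPn => _; rewrite ltry.
by apply: lte_mul_pinfty => //; rewrite ge0_fin_numE.
Qed.

Lemma closure_bounded_compact (D : set (R * R)) : bounded_set D -> compact (closure D).
Proof.
move=> /bounded_plane[K K0 KP].
have cI : compact (`[-K, K]%classic `*` `[-K, K]%classic : set (R * R)).
  by apply: compact_setX; exact: segment_compact.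
apply: (subclosed_compact _ cI); first exact: closed_closure.
have cl : closed (`[-K, K]%classic `*` `[-K, K]%classic : set (R * R)).
  by apply: compact_closed => //; exact: norm_hausdorff.
rewrite ((closure_id _).1 cl); apply: closure_subset => p /KP[h1 h2].
by split; rewrite /= in_itv/= -ler_norml ltW.
Qed.

Lemma continuous_integrable_plane (D : set (R * R)) (F : R * R -> R) :
  open D -> bounded_set D -> (forall p, closure D p -> {for p, continuous F}) ->
  mu2.-integrable D (EFin \o F).
Proof.
move=> oD bD cF; apply: measurable_bounded_integrable.
- exact: open_measurable_plane.
- exact: bounded_plane_measure.
- by apply: continuous_measurable_plane => // p Dp; apply: cF; exact: subset_closure.
have [->|/set0P D0] := eqVneq D set0.
  by apply: nearW => M p [].
have cn : {within closure D, continuous (fun p => `|F p|)}.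
  apply: continuous_in_subspaceT => p; rewrite inE => /cF cp.
  by apply: cvg_norm.
have cD0 : closure D !=set0 by case: D0 => p Dp; exists p; exact: subset_closure.
have [p _ pP] := compact_EVT_max cD0 (closure_bounded_compact bD) cn.
exists `|F p|; split; first exact: num_real.
move=> M FM x Dx /=; apply: le_trans (ltW FM); apply: pP; rewrite inE.
exact: subset_closure.
Qed.

(** Every section of [D] is open and bounded with [F] continuous on its closure, so all section
    integrals are finite and the real-valued iterated integrals are those of Fubini's theorem. The
    measurability of the section integrals is what [slice_green] requires of [D]. *)
Lemma fubini_dom (D : set (R * R)) (F : R * R -> R) :
  open D -> bounded_set D -> (forall p, closure D p -> {for p, continuous F}) ->
  [/\ measurable_fun setT (fun y => \int[mu]_(x in [set x | D (x, y)]) F (x, y)),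
      measurable_fun setT (fun x => \int[mu]_(y in [set y | D (x, y)]) F (x, y)),
      \int[mu]_y \int[mu]_(x in [set x | D (x, y)]) F (x, y) = \int[mu2]_(p in D) F p &
      \int[mu]_x \int[mu]_(y in [set y | D (x, y)]) F (x, y) = \int[mu2]_(p in D) F p].
Proof.
move=> oD bD cF; have iF := continuous_integrable_plane oD bD cF.
have mD := open_measurable_plane oD.
have [K K0 KP] := bounded_plane bD.
have iG : mu2.-integrable setT ((EFin \o F) \_ D).
  by apply/(integrable_mkcond _ _).1.
pose Dy (y : R) := [set x | D (x, y)].
pose Dx (x : R) := [set y | D (x, y)].
have px_cont (y : R) : continuous (fun x : R => (x, y)).
  move=> x B [[A1 A2]/= [h1 h2] H]; apply: filterS h1 => z A1z.
  by apply: H; split => //=; exact: nbhs_singleton.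
have py_cont (x : R) : continuous (fun y : R => (x, y)).
  move=> y B [[A1 A2]/= [h1 h2] H]; apply: filterS h2 => z A2z.
  by apply: H; split => //=; exact: nbhs_singleton.
have oDy y : open (Dy y) by apply: (open_comp _ oD) => x _; exact: px_cont.
have oDx x : open (Dx x) by apply: (open_comp _ oD) => y _; exact: py_cont.
have clDy y x : closure (Dy y) x -> closure D (x, y).
  move=> cx B /(px_cont y x)/cx[z [Dz Bz]]; by exists (z, y).
have clDx x y : closure (Dx x) y -> closure D (x, y).
  move=> cx B /(py_cont x y)/cx[z [Dz Bz]]; by exists (x, z).
have iDy y : mu.-integrable (Dy y) (EFin \o (fun x => F (x, y))).
  apply: (@open_bounded_integrable R (Dy y) (fun x => F (x, y)) K) => //.
    by move=> x /KP[].
  by move=> x /clDy/cF c; apply: (cvg_comp _ _ (px_cont y x) c).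
have iDx x : mu.-integrable (Dx x) (EFin \o (fun y => F (x, y))).
  apply: (@open_bounded_integrable R (Dx x) (fun y => F (x, y)) K) => //.
    by move=> y /KP[].
  by move=> y /clDx/cF c; apply: (cvg_comp _ _ (py_cont x y) c).
have GE : fubini_G mu ((EFin \o F) \_ D) =
    (fun y => (\int[mu]_(x in Dy y) F (x, y))%:E).
  apply/funext => y; rewrite /fubini_G /Rintegral fineK; last first.
    by apply: integrable_fin_num; [exact: open_measurable|exact: iDy].
  rewrite [RHS]integral_mkcond; apply: eq_integral => x _.
  by rewrite !patchE /Dy; congr (if _ then _ else _); apply/idP/idP; rewrite !inE.
have FE : fubini_F mu ((EFin \o F) \_ D) =
    (fun x => (\int[mu]_(y in Dx x) F (x, y))%:E).
  apply/funext => x; rewrite /fubini_F /Rintegral fineK; last first.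
    by apply: integrable_fin_num; [exact: open_measurable|exact: iDx].
  rewrite [RHS]integral_mkcond; apply: eq_integral => y _.
  by rewrite !patchE /Dx; congr (if _ then _ else _); apply/idP/idP; rewrite !inE.
have mG := measurable_fubini_G iG; have mF := measurable_fubini_F iG.
have eG := integral21_prod_meas1 iG; have eF := integral12_prod_meas1 iG.
have {}mG := eq_rect _ (fun h : R -> \bar R => measurable_fun (setT : set R) h) mG _ GE.
have {}mF := eq_rect _ (fun h : R -> \bar R => measurable_fun (setT : set R) h) mF _ FE.
have {}eG := eq_rect _ (fun h : R -> \bar R => (\int[mu]_y h y = _)%E) eG _ GE.
have {}eF := eq_rect _ (fun h : R -> \bar R => (\int[mu]_y h y = _)%E) eF _ FE.
split.
- by move/measurable_EFinP : mG.
- by move/measurable_EFinP : mF.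
- by rewrite /Rintegral [in RHS]integral_mkcond -eG.
- by rewrite /Rintegral [in RHS]integral_mkcond -eF.
Qed.

End PlaneMeasure.

Section DeriveAffine.
Variables (R : realType) (V W X : normedModType R) (f : W -> X) (phi : V -> W).
Variables (p v : V) (w : W).
Hypothesis phiE : forall h : R, phi (h *: v + p) = h *: w + phi p.

(** The difference quotients along [v] and along [w] are the same function of [h]. This moves
    derivatives between slices, lines and space-time without a chain rule. *)
Let E : (fun h : R => h^-1 *: ((f \o phi \o shift p) (h *: v) - (f \o phi) p)) =
  (fun h : R => h^-1 *: ((f \o shift (phi p)) (h *: w) - f (phi p))).
Proof. by apply/funext => h; rewrite /= phiE. Qed.

Lemma derive_affine : 'D_v (f \o phi) p = 'D_w f (phi p).
Proof. by rewrite /derive E. Qed.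

Lemma derivable_affine : derivable (f \o phi) p v <-> derivable f (phi p) w.
Proof. by rewrite /derivable E. Qed.

Lemma is_derive_affine df : is_derive (phi p) w f df -> is_derive p v (f \o phi) df.
Proof.
move=> [h1 h2]; apply: DeriveDef; first exact/derivable_affine.
by rewrite derive_affine.
Qed.

End DeriveAffine.

Section PlaneCurves.
Variable R : realType.
Implicit Types g : R -> R * R.

Lemma derive1_fst g t : derivable g t 1 ->
  is_derive t 1 (fun t => (g t).1) (derive1 g t).1.
Proof.
move=> dg; have h : (fun h => (h^-1 *: ((g \o shift t) (h *: 1) - g t)).1) @ 0^' -->
    (derive1 g t).1.
  rewrite derive1E; exact: (cvg_comp _ _ dg cvg_fst).
apply: DeriveDef; first by apply/cvg_ex; exists (derive1 g t).1.
exact: (cvg_lim (@Rhausdorff R) h).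
Qed.

Lemma derive1_snd g t : derivable g t 1 ->
  is_derive t 1 (fun t => (g t).2) (derive1 g t).2.
Proof.
move=> dg; have h : (fun h => (h^-1 *: ((g \o shift t) (h *: 1) - g t)).2) @ 0^' -->
    (derive1 g t).2.
  rewrite derive1E; exact: (cvg_comp _ _ dg cvg_snd).
apply: DeriveDef; first by apply/cvg_ex; exists (derive1 g t).2.
exact: (cvg_lim (@Rhausdorff R) h).
Qed.

End PlaneCurves.

(** * The two sides of a boundary arc *)

Definition dot (R : realType) (u v : R * R) : R := u.1 * v.1 + u.2 * v.2.

(** As [k < T / (2 * S)], the last inequality gives [x <= 2 * s * C * S / T]. Inserted in the one
    before it, this gives [c <= 2 * S ^+ 2 * k * C / T], which the second bound on [k] makes less
    than [c / 2]. *)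
Lemma cone_arith (R : realType) (T S C c k s x : R) :
  0 < T -> 0 < S -> 0 < C -> 0 < c -> 0 < k -> 0 < s -> 0 <= x ->
  k < T / (2 * S) -> k < c * T / (4 * S ^+ 2 * C) ->
  s * c <= S * k * x -> T * x <= s * (C * S) + S * k * x -> False.
Proof.
move=> T0 S0 C0 c0 k0 s0 x0 k1 k2 I1 I2.
have {}k1 : S * k < T / 2.
  have -> : T / 2 = S * (T / (2 * S)) by field; rewrite gt_eqF.
  by rewrite ltr_pM2l.
have {}k2 : S * k * (C * S) < c * T / 4.
  have -> : c * T / 4 = S * (c * T / (4 * S ^+ 2 * C)) * (C * S).
    by field; rewrite !gt_eqF.
  by rewrite ltr_pM2r ?mulr_gt0// ltr_pM2l.
have I3 : T / 2 * x <= s * (C * S) by have := ler_wpM2r x0 (ltW k1); lra.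
have I4 : s * c * (T / 2) <= S * k * (s * (C * S)).
  apply: (@le_trans _ _ (S * k * x * (T / 2))).
    by apply: ler_wpM2r => //; rewrite divr_ge0 ?ltW.
  rewrite -mulrA; apply: ler_wpM2l; first by rewrite mulr_ge0 ?ltW.
  by rewrite mulrC.
have : c * (T / 2) <= S * k * (C * S).
  rewrite -(ler_pM2l s0); have -> : s * (c * (T / 2)) = s * c * (T / 2) by ring.
  by have -> : s * (S * k * (C * S)) = S * k * (s * (C * S)) by ring.
have : 0 < c * T by rewrite mulr_gt0.
lra.
Qed.

Section Cone.
Variables (R : realType) (Omega : region R).
Local Notation D := (dom Omega).
Local Notation gam := (@bdry_arc _ Omega).

Let a k t : R := (gam k t).1.
Let b k t : R := (gam k t).2.
Let a' k t : R := (derive1 (gam k) t).1.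
Let b' k t : R := (derive1 (gam k) t).2.

Lemma arc_is_derive1 k t : is_derive (t : R) (1 : R) (a k) (a' k t).
Proof. exact: derive1_fst (@arc_derivable _ Omega k t). Qed.

Lemma arc_is_derive2 k t : is_derive (t : R) (1 : R) (b k) (b' k t).
Proof. exact: derive1_snd (@arc_derivable _ Omega k t). Qed.

Lemma arc_derive1E1 k : derive1 (a k) = a' k.
Proof. by apply/funext => t; rewrite derive1E; have [_ ->] := arc_is_derive1 k t. Qed.

Lemma arc_derive1E2 k : derive1 (b k) = b' k.
Proof. by apply/funext => t; rewrite derive1E; have [_ ->] := arc_is_derive2 k t. Qed.

Lemma arc_derivable1 k t : derivable (a k) t 1.
Proof. by have [] := arc_is_derive1 k t. Qed.

Lemma arc_derivable2 k t : derivable (b k) t 1.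
Proof. by have [] := arc_is_derive2 k t. Qed.

Lemma arc_continuous1 k : continuous (derive1 (a k)).
Proof.
rewrite arc_derive1E1 => t; apply: (cvg_comp _ _ (@arc_C1 _ Omega k t)).
exact: cvg_fst.
Qed.

Lemma arc_continuous2 k : continuous (derive1 (b k)).
Proof.
rewrite arc_derive1E2 => t; apply: (cvg_comp _ _ (@arc_C1 _ Omega k t)).
exact: cvg_snd.
Qed.

Lemma arc_continuous k : continuous (gam k).
Proof.
by move=> t; apply: differentiable_continuous; apply/derivable1_diffP; exact: arc_derivable.
Qed.

Lemma frontier_arc p : closure D p -> ~ D p -> exists k t, 0 <= t <= 1 /\ gam k t = p.
Proof.
move=> cp np; have : (closure D `\` D) p by [].
by rewrite arc_boundary => -[k _ [t /= + <-]]; rewrite in_itv/= => t01; exists k, t.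
Qed.

Lemma arc_frontier k t : 0 <= t <= 1 -> closure D (gam k t) /\ ~ D (gam k t).
Proof.
move=> t01; have : (\bigcup_k (gam k @` `[0, 1])) (gam k t).
  by exists k => //; exists t => //=; rewrite in_itv.
by rewrite -arc_boundary.
Qed.

(** An interior point of an arc is passed only once by the arcs, so its distance to each compact
    piece of boundary in question has a positive minimum. For each arc all small [d] work, hence
    some [d] works for the finitely many arcs together. *)
Let far_arcs k t eta : 0 < t < 1 -> 0 < eta ->
  exists2 d, 0 < d & forall l tau, 0 <= tau <= 1 ->
    (l = k -> eta <= `|tau - t|) -> d <= `|gam l tau - gam k t|.
Proof.
move=> t01 eta0.
have H : \forall d \near (0 : R)^'+, forall l, forall tau, 0 <= tau <= 1 ->
    (l = k -> eta <= `|tau - t|) -> d <= `|gam l tau - gam k t|.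
  apply: filter_forall => l.
  pose A := [set tau | 0 <= tau <= 1 /\ (l = k -> eta <= `|tau - t|)].
  have [A0|nA] := pselect (A !=set0); last first.
    by apply: nearW => d tau t1 t2; exfalso; apply: nA; exists tau.
  have cA : compact A.
    apply: (@subclosed_compact _ _ (`[0, 1]%classic : set R)).
    - have [lk|lk] := eqVneq l k; last first.
        have -> : A = `[0, 1]%classic; last exact: itv_closed.
        apply/seteqP; split=> tau; rewrite /= in_itv/=; first by case.
        by move=> t1; split => // lk'; rewrite lk' eqxx in lk.
      have -> : A = `[0, 1]%classic `&` ((fun tau => `|tau - t|) @^-1` [set x | eta <= x]).
        apply/seteqP; split=> tau; rewrite /= in_itv/=.
          by move=> [t1 t2]; split => //; exact: t2.
        by move=> [t1 t2].
      apply: closedI; first exact: itv_closed.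
      apply: closed_comp => [tau _|]; last exact: closed_ge.
      by apply: cvg_norm; apply: cvgB; [exact: cvg_id|exact: cvg_cst].
    - exact: segment_compact.
    - by move=> tau [t1 _]; rewrite /= in_itv.
  have cf : {within A, continuous (fun tau => `|gam l tau - gam k t|)}.
    apply: continuous_subspaceT => tau; apply: cvg_norm; apply: cvgB; last exact: cvg_cst.
    exact: arc_continuous.
  have [c] := compact_EVT_min A0 cA cf; rewrite inE => -[c01 cl] cP.
  have c0 : 0 < `|gam l c - gam k t|.
    rewrite normr_gt0 subr_eq0; apply/eqP => /esym E.
    have [kl tc] := arc_simple t01 c01 E.
    by have := cl (esym kl); rewrite -tc subrr normr0 leNgt eta0.
  near=> d => tau t1 t2; apply: (@le_trans _ _ `|gam l c - gam k t|).
    by near: d; exact: nbhs_right_le.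
  by apply: cP; rewrite inE.
have [e /= e0 eP] := H; exists (e / 2); first by rewrite divr_gt0.
apply: (eP (e / 2)) => /=; last by rewrite divr_gt0.
by rewrite sub0r normrN ger0_norm; lra.
Unshelve. all: by end_near. Qed.

Let nrm k t : R * R := (b' k t, - a' k t).

(* [arc_outward] only tells the two sides of the arc apart along the normal; any
   other transversal direction is joined to it by segments off the boundary. *)
Let cone_avoids k t (v w : R * R) : 0 < t < 1 ->
  0 < dot v (nrm k t) -> 0 < dot w (nrm k t) ->
  exists2 e, 0 < e & forall s, 0 < `|s| < e -> forall lam, 0 <= lam <= 1 ->
    forall l tau, 0 <= tau <= 1 -> gam l tau <> gam k t + s *: (v + lam *: (w - v)).
Proof.
move=> t01 vn wn.
pose c0 := Num.min (dot v (nrm k t)) (dot w (nrm k t)).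
have c00 : 0 < c0 by rewrite lt_min vn.
(* A bound for both coordinates of every convex combination of [v] and [w]; the 1 keeps it
   positive. *)
pose C := `|v.1| + `|v.2| + `|w.1| + `|w.2| + 1.
have hC : [/\ 0 <= `|v.1|, 0 <= `|v.2|, 0 <= `|w.1| & 0 <= `|w.2|] by [].
have C0 : 0 < C by case: hC => ????; rewrite /C; lra.
pose S := `|a' k t| + `|b' k t|.
have S0 : 0 < S.
  rewrite lt_neqAle addr_ge0// andbT eq_sym paddr_eq0// !normr_eq0.
  apply/negP => /andP[/eqP e1 /eqP e2].
  have : derive1 (gam k) t != 0 by apply: arc_regular; case/andP: t01 => h1 h2; rewrite !ltW.
  by move/eqP; apply; rewrite [LHS]surjective_pairing; congr (_, _).
pose T2 := a' k t ^+ 2 + b' k t ^+ 2.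
have T20 : 0 < T2.
  rewrite lt_neqAle addr_ge0 ?sqr_ge0// andbT eq_sym paddr_eq0 ?sqr_ge0// !sqrf_eq0.
  by apply/negP => /andP[/eqP e1 /eqP e2]; move: S0; rewrite /S e1 e2 normr0 addr0 ltxx.
(* [kap] limits the variation of the tangent near [t]; its two bounds are those of [cone_arith]. *)
have [kap [kap0 kap1 kap2]] : exists kap, [/\ 0 < kap, kap < T2 / (2 * S) &
    kap < c0 * T2 / (4 * S ^+ 2 * C)].
  by apply: exists_lt2; rewrite divr_gt0 ?mulr_gt0 ?exprn_gt0.
have near_t (h : R -> R) : continuous (derive1 h) ->
    exists2 eta, 0 < eta & forall z, `|z - t| < eta -> `|derive1 h z - derive1 h t| < kap.
  move=> ch; have /cvgrPdist_lt/(_ _ kap0)/nbhs_ballP[eta /= eta0 etaP] := ch t.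
  exists eta => // z zt; rewrite distrC; apply: etaP; rewrite -ball_normE/= distrC.
  exact: zt.
have [e1 e10 H1] := near_t _ (@arc_continuous1 k).
have [e2 e20 H2] := near_t _ (@arc_continuous2 k).
have [eta [eta0 eta1 eta2]] := exists_lt2 e10 e20.
have rem (h : R -> R) tau : (forall z, derivable h z 1) -> continuous (derive1 h) ->
    (forall z, `|z - t| < eta -> `|derive1 h z - derive1 h t| < kap) ->
    `|tau - t| < eta -> exists2 r, `|r| <= kap & h tau - h t = (derive1 h t + r) * (tau - t).
  move=> dh ch hz tt; case: (ltgtP tau t) => [lt|gt|->]; last first.
  - by exists 0; [rewrite normr0 ltW|rewrite !subrr mulr0].
  - have [z zi E] := C1_MVT dh gt; exists (derive1 h z - derive1 h t).
      by apply/ltW/hz; move: tt; rewrite !ltr_norml; lra.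
    by rewrite E; ring.
  - have [z zi E] := C1_MVT dh lt; exists (derive1 h z - derive1 h t).
      by apply/ltW/hz; move: tt; rewrite !ltr_norml; lra.
    by rewrite -opprB E; ring.
(* Within distance [d] of [gam k t], the boundary consists of points of arc [k] with parameter
   closer than [eta] to [t]. *)
have [d d0 dP] := far_arcs k t01 eta0.
exists (d / C); first by rewrite divr_gt0.
move=> s /andP[s0 sd] lam /andP[l0 l1] l tau tau01 E.
set u := v + lam *: (w - v) in E.
have u1E : u.1 = (1 - lam) * v.1 + lam * w.1.
  by transitivity (v.1 + lam * (w.1 - v.1)) => //; ring.
have u2E : u.2 = (1 - lam) * v.2 + lam * w.2.
  by transitivity (v.2 + lam * (w.2 - v.2)) => //; ring.
have u1 : `|u.1| <= C.
  rewrite u1E.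
  apply: (le_trans (ler_normD _ _)); rewrite !normrM.
  have n1 : `|1 - lam| <= 1 by rewrite ler_norml; lra.
  have n2 : `|lam| <= 1 by rewrite ler_norml; lra.
  have m1 := ler_wpM2r (normr_ge0 v.1) n1; have m2 := ler_wpM2r (normr_ge0 w.1) n2.
  by case: hC => ????; rewrite /C; lra.
have u2 : `|u.2| <= C.
  rewrite u2E.
  apply: (le_trans (ler_normD _ _)); rewrite !normrM.
  have n1 : `|1 - lam| <= 1 by rewrite ler_norml; lra.
  have n2 : `|lam| <= 1 by rewrite ler_norml; lra.
  have m1 := ler_wpM2r (normr_ge0 v.2) n1; have m2 := ler_wpM2r (normr_ge0 w.2) n2.
  by case: hC => ????; rewrite /C; lra.
have un : c0 <= dot u (nrm k t).
  have -> : dot u (nrm k t) = (1 - lam) * dot v (nrm k t) + lam * dot w (nrm k t).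
    by rewrite /dot u1E u2E; ring.
  have m1 : c0 <= dot v (nrm k t) by rewrite ge_min lexx.
  have m2 : c0 <= dot w (nrm k t) by rewrite ge_min lexx orbT.
  have p1 : 0 <= 1 - lam by lra.
  by have := ler_wpM2l p1 m1; have := ler_wpM2l l0 m2; lra.
have close : `|gam l tau - gam k t| < d.
  rewrite E addrAC subrr add0r normrZ.
  have un' : `|u| <= C by rewrite prod_normE ge_max u1 u2.
  by apply: (le_lt_trans (ler_wpM2l (normr_ge0 s) un')); rewrite -ltr_pdivlMr.
have [lk tt] : l = k /\ `|tau - t| < eta.
  have [lk|lk] := pselect (l = k); last first.
    by have := dP l tau tau01 (fun h => False_ind _ (lk h)); rewrite leNgt close.
  split => //; rewrite ltNge; apply/negP => h.
  by have := dP l tau tau01 (fun _ => h); rewrite leNgt close.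
rewrite lk in E.
have [r1 r1k E1] := rem (a k) tau (@arc_derivable1 k) (@arc_continuous1 k)
  (fun z h => H1 z (lt_trans h eta1)) tt.
have [r2 r2k E2] := rem (b k) tau (@arc_derivable2 k) (@arc_continuous2 k)
  (fun z h => H2 z (lt_trans h eta2)) tt.
rewrite arc_derive1E1 in E1; rewrite arc_derive1E2 in E2.
have F1 : a k tau - a k t = s * u.1.
  by rewrite /a E; transitivity ((gam k t).1 + s * u.1 - (gam k t).1) => //; ring.
have F2 : b k tau - b k t = s * u.2.
  by rewrite /b E; transitivity ((gam k t).2 + s * u.2 - (gam k t).2) => //; ring.
set x := tau - t in E1 E2.
(* [E] resolved along the normal, where the tangent cancels and only the remainders are left; [N2]
   resolves it along the tangent, which controls [tau - t]. *)
have N1 : s * dot u (nrm k t) = (b' k t * r1 - a' k t * r2) * x.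
  by rewrite /dot/= mulrDr !mulrA -F1 -F2 E1 E2; ring.
have N2 : T2 * x = s * (u.1 * a' k t + u.2 * b' k t) - (a' k t * r1 + b' k t * r2) * x.
  have -> : s * (u.1 * a' k t + u.2 * b' k t) = (s * u.1) * a' k t + (s * u.2) * b' k t by ring.
  by rewrite -F1 -F2 E1 E2 /T2; ring.
have b1 : `|b' k t * r1 - a' k t * r2| <= S * kap.
  apply: (le_trans (ler_normB _ _)); rewrite !normrM /S mulrDl addrC.
  by apply: lerD; apply: ler_wpM2l.
have b2 : `|a' k t * r1 + b' k t * r2| <= S * kap.
  apply: (le_trans (ler_normD _ _)); rewrite !normrM /S mulrDl.
  by apply: lerD; apply: ler_wpM2l.
have b3 : `|u.1 * a' k t + u.2 * b' k t| <= C * S.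
  apply: (le_trans (ler_normD _ _)); rewrite !normrM /S mulrDr.
  by apply: lerD; apply: ler_wpM2r.
have I1 : `|s| * c0 <= S * kap * `|x|.
  apply: (@le_trans _ _ (`|s| * `|dot u (nrm k t)|)).
    by apply: ler_wpM2l => //; rewrite (le_trans un)// ler_norm.
  by rewrite -normrM N1 normrM ler_wpM2r.
have I2 : T2 * `|x| <= `|s| * (C * S) + S * kap * `|x|.
  rewrite -{1}(gtr0_norm T20) -normrM N2 (le_trans (ler_normB _ _))// !normrM.
  by apply: lerD; [apply: ler_wpM2l|apply: ler_wpM2r].
exact: (cone_arith T20 S0 C0 c00 kap0 s0 (normr_ge0 x) kap1 kap2 I1 I2).
Qed.

(** The segment joining the directions [v] and [w], scaled by [s] or by [- s], avoids the boundary,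
    so it lies in [D] as soon as one of its ends does; [arc_outward] decides at the end [w]. *)
Lemma arc_side k t (v : R * R) : 0 < t < 1 -> 0 < dot v (nrm k t) ->
  exists2 e, 0 < e & forall s, 0 < s < e ->
    D (gam k t - s *: v) /\ ~ D (gam k t + s *: v).
Proof.
move=> t01 vn; pose w := unit_normal (gam k) t.
have nt0 : derive1 (gam k) t != 0.
  by apply: arc_regular; case/andP: t01 => h1 h2; rewrite !ltW.
have T20 : 0 < a' k t ^+ 2 + b' k t ^+ 2.
  rewrite lt_neqAle addr_ge0 ?sqr_ge0// andbT eq_sym paddr_eq0 ?sqr_ge0// !sqrf_eq0.
  apply: contra nt0 => /andP[/eqP e1 /eqP e2].
  by apply/eqP; rewrite [LHS]surjective_pairing; congr (_, _).
have wn : 0 < dot w (nrm k t).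
  have n0 : 0 < euclid_norm (derive1 (gam k) t) by rewrite sqrtr_gt0.
  have -> : dot w (nrm k t) = (a' k t ^+ 2 + b' k t ^+ 2) / euclid_norm (derive1 (gam k) t).
    by rewrite /dot /w /unit_normal/= /nrm /a' /b'/=; ring.
  by rewrite divr_gt0.
have [e e0 eP] := cone_avoids t01 vn wn.
have [d /= d0 dP] := @arc_outward _ Omega k t t01.
exists (Num.min e d); first by rewrite lt_min e0.
move=> s; rewrite lt_min => /andP[s0 /andP[se sd]].
have sball : `|0 - s| < d by rewrite sub0r normrN gtr0_norm.
have [out1 in1] := dP s sball s0.
pose path (s lam : R) := gam k t + s *: (v + lam *: (w - v)).
have cp z : connected (path z @` `[0, 1]).
  apply: connected_continuous_connected.
    by apply/connected_intervalP; exact: interval_is_interval.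
  apply: continuous_subspaceT => lam; apply: cvgD; first exact: cvg_cst.
  apply: cvgZr_tmp || apply: cvgZl_tmp || apply: cvgZr.
  apply: cvgD; first exact: cvg_cst.
  by apply: cvgZl_tmp || apply: cvgZr_tmp || apply: cvgZl.
have nf z : 0 < `|z| < e -> forall x, (path z @` `[0, 1]) x -> closure D x -> D x.
  move=> ze _ [lam /= + <-] cx; rewrite in_itv/= => l01; apply: contrapT => nx.
  have [l [tau [tau01 E]]] := frontier_arc cx nx.
  exact: (eP z ze lam l01 l tau tau01 E).
have p0 z : (path z @` `[0, 1]) (gam k t + z *: v).
  by exists 0; [rewrite /= in_itv/= lexx ler01|rewrite /path scale0r addr0].
have p1 z : (path z @` `[0, 1]) (gam k t + z *: w).
  by exists 1; [rewrite /= in_itv/= lexx ler01|rewrite /path scale1r [v + _]addrC subrK].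
have z1 : 0 < `|s| < e by rewrite gtr0_norm// s0.
have z2 : 0 < `|- s| < e by rewrite normrN.
split.
  rewrite -scaleNr; apply: (connected_frontier (@dom_open _ Omega) (cp (- s)) (nf _ z2)); last exact: p0.
  by exists (gam k t + (- s) *: w); split; [exact: p1|rewrite scaleNr].
(* On the outer side the end [v], if it were in [D], would pull the end [w] into [D]. *)
move=> Dv; apply: out1; apply: subset_closure.
apply: (connected_frontier (@dom_open _ Omega) (cp s) (nf _ z1)); last exact: p1.
by exists (gam k t + s *: v); split; first exact: p0.
Qed.

End Cone.

(** * Green's formula in the region *)

Section Green.
Variables (R : realType) (Omega : region R).
Local Notation mu := (@lebesgue_measure R).
Local Notation D := (dom Omega).
Local Notation gam := (@bdry_arc _ Omega).
Variables (f f' : R * R -> R).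
Hypothesis cf : forall p, closure D p -> {for p, continuous f}.
Hypothesis cf' : forall p, closure D p -> {for p, continuous f'}.

Let continuous_along k t : 0 <= t <= 1 -> {for t, continuous (f \o gam k)}.
Proof.
move=> t01; apply: (cvg_comp _ _ (@arc_continuous _ Omega k t)).
by apply: cf; have [] := arc_frontier k t01.
Qed.

Let bounded_dom := bounded_plane (@dom_bounded _ Omega).

(** With [b'] the second component of the tangent, the exit direction on a horizontal line is
    [(sg b', 0)]. Its product with the normal is [|b'|], so [arc_side] applies wherever [b'] is
    nonzero. *)
Lemma green_horizontal :
  (forall p, closure D p -> is_derive p ((1, 0) : R * R) f (f' p)) ->
  integral_dom Omega f' =
  \sum_k \int[mu]_(t in `[0, 1]) (f (gam k t) * (derive1 (gam k) t).2).
Proof.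
move=> df; have [K K0 KP] := bounded_dom.
have [mD _ eD _] := fubini_dom (@dom_open _ Omega) (@dom_bounded _ Omega) cf'.
have pc (y : R) : continuous (fun x : R => (x, y)).
  move=> x B [[A1 A2]/= [h1 h2] H]; apply: filterS h1 => z A1z.
  by apply: H; split => //=; exact: nbhs_singleton.
have clD (y x : R) : closure [set x | D (x, y)] x -> closure D (x, y).
  by move=> cx B /(pc y x)/cx[z [Dz Bz]]; exists (z, y).
rewrite /integral_dom -eD.
have := @slice_green R (narcs Omega) (fun y => [set x | D (x, y)])
  (fun k t => (gam k t).1) (fun k t => (gam k t).2)
  (fun x y => f (x, y)) (fun x y => f' (x, y)) K 1 (or_introl erefl).
move=> /(_ _ _ _ _ _ _ _ _ _ _ _)/wrap[]; last first.
  case=> _; rewrite mul1r => ->; apply: eq_bigr => k _; apply: eq_Rintegral => t _.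
  by rewrite -surjective_pairing arc_derive1E2.
- exact: mD.
- by move=> y x /clD/cf' c; apply: (cvg_comp _ _ (pc y x) c).
- move=> y x /clD/df d.
  apply: (@is_derive_affine R R (R * R)%type R f (fun x => (x, y)) x 1 (1, 0)) => // h.
  by transitivity ((h * 1 + x, h * 0 + y) : R * R) => //; rewrite mulr0 add0r.
- move=> k t t01.
  rewrite (_ : (fun t => f ((gam k t).1, (gam k t).2)) = f \o gam k); last first.
    by apply/funext => s; rewrite /= -surjective_pairing.
  exact: continuous_along.
- move=> k t t01 bn.
  have vn : 0 < dot ((Num.sg (derive1 (fun t => (gam k t).2) t), 0) : R * R)
      ((derive1 (gam k) t).2, - (derive1 (gam k) t).1).
    by rewrite /dot/= mul0r addr0 -[X in _ * X](congr1 (fun h => h t) (arc_derive1E2 k)) -normrEsg normr_gt0.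
  have [e e0 eP] := arc_side t01 vn; exists e => // s /eP[h1 h2].
  rewrite mul1r; split => /=.
    suff -> : ((gam k t).1 - Num.sg (derive1 (fun t => (gam k t).2) t) * s, (gam k t).2) =
      gam k t - s *: ((Num.sg (derive1 (fun t => (gam k t).2) t), 0) : R * R) by [].
    transitivity (((gam k t).1 - s * Num.sg (derive1 (fun t => (gam k t).2) t),
      (gam k t).2 - s * 0) : R * R) => //; by rewrite mulr0 subr0 mulrC.
  suff -> : ((gam k t).1 + Num.sg (derive1 (fun t => (gam k t).2) t) * s, (gam k t).2) =
    gam k t + s *: ((Num.sg (derive1 (fun t => (gam k t).2) t), 0) : R * R) by [].
  transitivity (((gam k t).1 + s * Num.sg (derive1 (fun t => (gam k t).2) t),
    (gam k t).2 + s * 0) : R * R) => //; by rewrite mulr0 addr0 mulrC.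
- move=> k l s t s01 t01 e1 e2; apply: (arc_simple s01 t01).
  by rewrite [LHS]surjective_pairing [RHS]surjective_pairing e1 e2.
- move=> y x /clD cx nx; have [k [t [t01 E]]] := frontier_arc cx nx.
  by exists k, t; rewrite E.
- exact: arc_continuous2.
- exact: arc_derivable2.
- by move=> y x /KP[].
- by move=> y; apply: (open_comp _ (@dom_open _ Omega)) => x _; exact: pc.
Qed.

(** The normal has second component [- a'], with [a'] the first component of the tangent; hence the
    exit direction [(0, - sg a')], the orientation -1 and the sign of the right-hand side. *)
Lemma green_vertical :
  (forall p, closure D p -> is_derive p ((0, 1) : R * R) f (f' p)) ->
  integral_dom Omega f' =
  - \sum_k \int[mu]_(t in `[0, 1]) (f (gam k t) * (derive1 (gam k) t).1).
Proof.
move=> df; have [K K0 KP] := bounded_dom.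
have [_ mD _ eD] := fubini_dom (@dom_open _ Omega) (@dom_bounded _ Omega) cf'.
have pc (x : R) : continuous (fun y : R => (x, y)).
  move=> y B [[A1 A2]/= [h1 h2] H]; apply: filterS h2 => z A2z.
  by apply: H; split => //=; exact: nbhs_singleton.
have clD (x y : R) : closure [set y | D (x, y)] y -> closure D (x, y).
  by move=> cy B /(pc x y)/cy[z [Dz Bz]]; exists (x, z).
rewrite /integral_dom -eD.
have := @slice_green R (narcs Omega) (fun x => [set y | D (x, y)])
  (fun k t => (gam k t).2) (fun k t => (gam k t).1)
  (fun y x => f (x, y)) (fun y x => f' (x, y)) K (-1) (or_intror erefl).
move=> /(_ _ _ _ _ _ _ _ _ _ _ _)/wrap[]; last first.
  case=> _; rewrite mulN1r => /eqP; rewrite eqr_oppLR => /eqP ->.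
  congr (- _); apply: eq_bigr => k _; apply: eq_Rintegral => t _.
  by rewrite -surjective_pairing arc_derive1E1.
- exact: mD.
- by move=> x y /clD/cf' c; apply: (cvg_comp _ _ (pc x y) c).
- move=> x y /clD/df d.
  apply: (@is_derive_affine R R (R * R)%type R f (fun y => (x, y)) y 1 (0, 1)) => // h.
  by transitivity ((h * 0 + x, h * 1 + y) : R * R) => //; rewrite mulr0 add0r.
- move=> k t t01.
  rewrite (_ : (fun t => f ((gam k t).1, (gam k t).2)) = f \o gam k); last first.
    by apply/funext => s; rewrite /= -surjective_pairing.
  exact: continuous_along.
- move=> k t t01 an.
  have vn : 0 < dot ((0, - Num.sg (derive1 (fun t => (gam k t).1) t)) : R * R)
      ((derive1 (gam k) t).2, - (derive1 (gam k) t).1).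
    rewrite /dot/= mul0r add0r mulrNN -[X in _ * X](congr1 (fun h => h t) (arc_derive1E1 k)).
    by rewrite -normrEsg normr_gt0.
  have [e e0 eP] := arc_side t01 vn; exists e => // s /eP[h1 h2].
  rewrite mulN1r; split => /=.
    suff -> : ((gam k t).1, (gam k t).2 - - Num.sg (derive1 (fun t => (gam k t).1) t) * s) =
      gam k t - s *: ((0, - Num.sg (derive1 (fun t => (gam k t).1) t)) : R * R) by [].
    transitivity (((gam k t).1 - s * 0,
      (gam k t).2 - s * - Num.sg (derive1 (fun t => (gam k t).1) t)) : R * R) => //.
    by rewrite mulr0 subr0 mulrC.
  suff -> : ((gam k t).1, (gam k t).2 + - Num.sg (derive1 (fun t => (gam k t).1) t) * s) =
    gam k t + s *: ((0, - Num.sg (derive1 (fun t => (gam k t).1) t)) : R * R) by [].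
  transitivity (((gam k t).1 + s * 0,
    (gam k t).2 + s * - Num.sg (derive1 (fun t => (gam k t).1) t)) : R * R) => //.
  by rewrite mulr0 addr0 mulrC.
- move=> k l s t s01 t01 e1 e2; apply: (arc_simple s01 t01).
  by rewrite [LHS]surjective_pairing [RHS]surjective_pairing e1 e2.
- move=> x y /clD cx nx; have [k [t [t01 E]]] := frontier_arc cx nx.
  by exists k, t; rewrite E.
- exact: arc_continuous1.
- exact: arc_derivable1.
- by move=> x y /KP[].
- by move=> x; apply: (open_comp _ (@dom_open _ Omega)) => y _; exact: pc.
Qed.

End Green.

(** * Mixed partial derivatives *)

Section Schwarz.
Variables (R : realType) (X : normedModType R).
Implicit Types (f F : X -> R) (p q v w : X) (W : set X).

Lemma line_MVT F F' q v (h : R) : 0 < h ->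
  (forall s, 0 <= s <= h -> is_derive (q + s *: v) v F (F' (q + s *: v))) ->
  exists2 s, 0 < s < h & F (q + h *: v) - F q = h * F' (q + s *: v).
Proof.
move=> h0 dF.
have dphi s : 0 <= s <= h ->
    is_derive s (1 : R) (fun s : R => F (q + s *: v)) (F' (q + s *: v)).
  move=> sh; apply: (@is_derive_affine R R X R F (fun s => q + s *: v) s 1 v) => [k|].
    by rewrite scalerDl -scalerA scale1r addrCA.
  exact: dF.
have [s|s|s si E] := @MVT R (fun s => F (q + s *: v)) (fun s => F' (q + s *: v)) 0 h h0.
- by rewrite in_itv/= => /andP[s0 sh]; apply: dphi; rewrite !ltW.
- apply: (derivable_within_continuous (f := fun s => F (q + s *: v))) => z; rewrite in_itv/=.
  by move=> /dphi[].
- exists s; first by move: si; rewrite in_itv.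
  by rewrite subr0 scale0r addr0 in E; rewrite E mulrC.
Qed.

(** The second difference of [f] over the parallelogram with sides [h *: v] and [h *: w] is, by two
    mean value theorems in either order, [h ^+ 2] times a value of each mixed derivative near
    [p]. *)
Lemma schwarz_pt f fv fw fvw fwv W p v w : open W -> W p ->
  (forall q, W q -> is_derive q v f (fv q)) -> (forall q, W q -> is_derive q w f (fw q)) ->
  (forall q, W q -> is_derive q w fv (fvw q)) -> (forall q, W q -> is_derive q v fw (fwv q)) ->
  {for p, continuous fvw} -> {for p, continuous fwv} -> fvw p = fwv p.
Proof.
move=> oW Wp dv dw dvw dwv c1 c2.
apply/eqP; rewrite -subr_eq0 -normr_le0; apply/ler_addgt0Pr => e e0; rewrite add0r.
have e20 : 0 < e / 2 by rewrite divr_gt0.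
have /nbhs_ballP[d1 /= d10 d1W] := open_nbhs_nbhs (conj oW Wp).
move/cvgrPdist_lt/(_ _ e20)/nbhs_ballP : c1 => [d2 /= d20 d2P].
move/cvgrPdist_lt/(_ _ e20)/nbhs_ballP : c2 => [d3 /= d30 d3P].
have [d [d0 dd1 dd2 dd3]] := exists_lt3 d10 d20 d30.
(* With [h = d / C] the whole parallelogram lies within distance [d] of [p]. *)
pose C := `|v| + `|w| + 1.
have C0 : 0 < C by rewrite ltr_wpDl// addr_ge0.
pose h := d / C; have h0 : 0 < h by rewrite divr_gt0.
have near_p s t : 0 <= s <= h -> 0 <= t <= h -> `|p - (p + s *: v + t *: w)| < d.
  move=> /andP[s0 sh] /andP[t0 th].
  rewrite -addrA opprD addNKr normrN (le_lt_trans (ler_normD _ _))// !normrZ.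
  rewrite (ger0_norm s0) (ger0_norm t0).
  have : s * `|v| + t * `|w| <= h * `|v| + h * `|w| by apply: lerD; apply: ler_wpM2r.
  move/le_lt_trans; apply; rewrite -mulrDr /h mulrAC ltr_pdivrMr// ltr_pM2l//.
  by rewrite /C ltrDl.
have inW s t : 0 <= s <= h -> 0 <= t <= h -> W (p + s *: v + t *: w).
  by move=> sh th; apply: d1W; rewrite -ball_normE/=; apply: lt_trans dd1; exact: near_p.
have hh : 0 <= h <= h by rewrite lexx ltW.
have h00 : 0 <= (0 : R) <= h by rewrite lexx ltW.
have W0 s : 0 <= s <= h -> W (p + s *: v).
  by move=> sh; have := inW s 0 sh h00; rewrite scale0r addr0.
have W0' t : 0 <= t <= h -> W (p + t *: w).
  by move=> th; have := inW 0 t h00 th; rewrite scale0r addr0.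
have wk s : 0 < s < h -> 0 <= s <= h by case/andP => *; rewrite !ltW.
have dphi (F F' : X -> R) u z q : is_derive (q + z) u F (F' (q + z)) ->
    is_derive q u F (F' q) -> is_derive q u (fun x => F (x + z) - F x) (F' (q + z) - F' q).
  move=> d1' d2'; apply: is_deriveB.
  by apply: (@is_derive_affine R X X R F (fun x => x + z) q u u) => // k; rewrite addrA.
have [s1 /wk s1h E1] := @line_MVT (fun x => f (x + h *: w) - f x)
  (fun x => fv (x + h *: w) - fv x) p v h h0 (fun s sh =>
  dphi f fv v (h *: w) (p + s *: v) (dv _ (inW s h sh hh)) (dv _ (W0 s sh))).
have [t1 /wk t1h E1'] := @line_MVT fv fvw _ w h h0 (fun t th => dvw _ (inW s1 t s1h th)).
have inW' t s : 0 <= t <= h -> 0 <= s <= h -> W (p + t *: w + s *: v).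
  by move=> th sh; rewrite addrAC; exact: inW.
have [t2 /wk t2h E2] := @line_MVT (fun x => f (x + h *: v) - f x)
  (fun x => fw (x + h *: v) - fw x) p w h h0 (fun t th =>
  dphi f fw w (h *: v) (p + t *: w) (dw _ (inW' t h th hh)) (dw _ (W0' t th))).
have [s2 /wk s2h E2'] := @line_MVT fw fwv _ v h h0 (fun s sh => dwv _ (inW' t2 s t2h sh)).
have EE : fvw (p + s1 *: v + t1 *: w) = fwv (p + t2 *: w + s2 *: v).
  have hn : h != 0 by rewrite gt_eqF.
  apply: (mulfI hn); apply: (mulfI hn).
  rewrite -E1' -E2' -E1 -E2 (addrAC p (h *: w)); clear.
  by set y1 := f _; set y2 := f _; set y3 := f _; set y4 := f _; ring.
have n1 : `|fvw p - fvw (p + s1 *: v + t1 *: w)| < e / 2.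
  by apply: d2P; rewrite -ball_normE/=; apply: lt_trans dd2; exact: near_p.
have n2 : `|fwv p - fwv (p + t2 *: w + s2 *: v)| < e / 2.
  by apply: d3P; rewrite -ball_normE/=; apply: lt_trans dd3; rewrite addrAC; exact: near_p.
move: n1 n2; rewrite EE !ltr_norml ler_norml; set y := fwv (p + _ + _).
by set a := fvw p; set b := fwv p; clear; lra.
Qed.

End Schwarz.

Section CkOn.
Variable R : realType.
Implicit Types (f g : R * (R * R) -> R) (W : set (R * (R * R))) (p v w : R * (R * R)).

Lemma Ck_on_continuous k W f p : Ck_on k W f -> W p -> {for p, continuous f}.
Proof. by case: k => [|k] [] cf _; exact: cf. Qed.

Lemma Ck_on_derivable k W f v p : v \in spacetime_axes R -> Ck_on k.+1 W f -> W p ->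
  derivable f p v.
Proof. by move=> vs [_ /(_ v vs)[H _]]; exact: H. Qed.

Lemma Ck_on_derive k W f v : v \in spacetime_axes R -> Ck_on k.+1 W f -> Ck_on k W ('D_v f).
Proof. by move=> vs [_ /(_ v vs)[_ H]]. Qed.

Lemma Ck_onW k W f : Ck_on k.+1 W f -> Ck_on k W f.
Proof.
elim: k f => [|k IH] f [cf H]; first by split.
by split => // v vs; have [dv /IH] := H v vs.
Qed.

Lemma Ck_onS k W W' f : W' `<=` W -> Ck_on k W f -> Ck_on k W' f.
Proof.
move=> WW; elim: k f => [|k IH] f [cf H]; first by split=> // p /WW/cf.
split=> [p /WW/cf //|v /H[dv /IH ?]].
by split => // p /WW/dv.
Qed.

(** On the open set [W] the equality holds near every point, hence passes to the derivatives. *)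
Lemma Ck_on_eq k W f g : open W -> (forall p, W p -> f p = g p) -> Ck_on k W f -> Ck_on k W g.
Proof.
move=> oW; elim: k f g => [|k IH] f g E [cf H].
  split => // p Wp; have fg : \forall q \near p, f q = g q.
    by apply: filterS (open_nbhs_nbhs (conj oW Wp)) => q; exact: E.
  rewrite /prop_for/continuous_at -E//.
  by apply: cvg_trans (cf p Wp); exact: near_eq_cvg.
have fg p : W p -> \forall q \near p, f q = g q.
  by move=> Wp; apply: filterS (open_nbhs_nbhs (conj oW Wp)) => q; exact: E.
split.
  move=> p Wp; rewrite /prop_for/continuous_at -E//.
  by apply: cvg_trans (cf p Wp); apply: near_eq_cvg; exact: fg.
move=> v vs; have [dv Hv] := H v vs; split.
  by move=> p Wp; apply: (near_eq_derivable (fg p Wp)); exact: dv.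
apply: IH Hv => p Wp; apply: near_eq_derive; exact: fg.
Qed.

Lemma Ck_onD k W f g : open W -> Ck_on k W f -> Ck_on k W g -> Ck_on k W (fun p => f p + g p).
Proof.
move=> oW; elim: k f g => [|k IH] f g [cf Hf] [cg Hg].
  by split => // p Wp; apply: cvgD; [exact: cf|exact: cg].
split; first by move=> p Wp; apply: cvgD; [exact: cf|exact: cg].
move=> v vs; have [df Hf'] := Hf v vs; have [dg Hg'] := Hg v vs; split.
  by move=> p Wp; apply: derivableD; [exact: df|exact: dg].
apply: (Ck_on_eq oW _ (IH _ _ Hf' Hg')) => p Wp.
by rewrite deriveD//; [exact: df|exact: dg].
Qed.

Lemma Ck_on_schwarz W f v w p : open W -> v \in spacetime_axes R -> w \in spacetime_axes R ->
  Ck_on 2 W f -> W p -> 'D_w ('D_v f) p = 'D_v ('D_w f) p.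
Proof.
move=> oW vs ws Hf Wp.
have Hv := Ck_on_derive vs Hf; have Hw := Ck_on_derive ws Hf.
apply: (@schwarz_pt R (R * (R * R))%type f ('D_v f) ('D_w f) ('D_w ('D_v f))
  ('D_v ('D_w f)) W p v w oW Wp).
- by move=> q Wq; apply: DeriveDef => //; exact: Ck_on_derivable vs Hf Wq.
- by move=> q Wq; apply: DeriveDef => //; exact: Ck_on_derivable ws Hf Wq.
- by move=> q Wq; apply: DeriveDef => //; exact: Ck_on_derivable ws Hv Wq.
- by move=> q Wq; apply: DeriveDef => //; exact: Ck_on_derivable vs Hw Wq.
- exact: (Ck_on_continuous (Ck_on_derive ws Hv)).
- exact: (Ck_on_continuous (Ck_on_derive vs Hw)).
Qed.

End CkOn.

(** * The physical domain *)

Lemma ord2P (i : 'I_2) : i = 0 \/ i = 1.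
Proof. by case: i => -[|[|//]] ii; [left|right]; exact: val_inj. Qed.

Section Matrix2.
Variable F : fieldType.
Implicit Type A : 'M[F]_2.

Lemma big_ord2 (V : nmodType) (f : 'I_2 -> V) : \sum_i f i = f 0 + f 1.
Proof. by rewrite !big_ord_recl big_ord0 addr0; congr (f _ + f _); apply: val_inj. Qed.

Lemma det_mx2 A : \det A = A 0 0 * A 1 1 - A 0 1 * A 1 0.
Proof.
rewrite (expand_det_row _ 0) big_ord2 /cofactor !det_mx11 !mxE /= expr0 expr1 mul1r mulN1r mulrN.
congr (_ * _ - _ * _); congr (A _ _); exact: val_inj.
Qed.

Lemma invmx2 A : \det A != 0 ->
  [/\ invmx A 0 0 = (\det A)^-1 * A 1 1, invmx A 0 1 = - ((\det A)^-1 * A 0 1),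
      invmx A 1 0 = - ((\det A)^-1 * A 1 0) & invmx A 1 1 = (\det A)^-1 * A 0 0].
Proof.
move=> d0; have uA : A \in unitmx by rewrite unitmxE unitfE.
rewrite /invmx uA !mxE /cofactor !det_mx11 !mxE /= expr0 expr1 sqrrN expr1n !mul1r !mulN1r !mulrN.
by split; (congr (_ * _) || congr (- (_ * _))); congr (A _ _); apply: val_inj.
Qed.

End Matrix2.

(** * The potential [Xi] and its derivatives *)

Section XiCalculus.
Variables (R : realType) (m : model R).
Implicit Types (c : R) (Q : 'M[R]_2).

Definition det_shift c Q : R :=
  (c^-1 * Q 0 0 + 2^-1) * (c^-1 * Q 1 1 + 2^-1) - c^-1 * Q 0 1 * (c^-1 * Q 1 0).

(* For symmetric traceless [Q] and [c > 0] the eigenvalue condition amounts to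
   det (Q / c + I / 2) > 0. *)
Definition admissible c Q := [/\ 0 < c < M m, Q 1 0 = Q 0 1, Q 1 1 = - Q 0 0 & 0 < det_shift c Q].

Lemma shiftE c Q i j : (c^-1 *: Q + half_id R) i j = c^-1 * Q i j + 2^-1 *+ (i == j).
Proof. by rewrite !mxE. Qed.

Lemma det_shiftE c Q : \det (c^-1 *: Q + half_id R) = det_shift c Q.
Proof. by rewrite det_mx2 !shiftE /= !mulr0n !addr0. Qed.

Lemma XiE c Q : Xi m c Q = c * ln c + (M m - c) * ln (1 - c / M m) +
  c * nu m * (- ln (det_shift c Q) + ln (\det (half_id R))).
Proof. by rewrite /Xi /q det_shiftE. Qed.

Lemma dXi_dQE c Q : det_shift c Q != 0 ->
  [/\ dXi_dQ m c Q 0 0 = - (nu m * ((det_shift c Q)^-1 * (c^-1 * Q 1 1 + 2^-1))),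
      dXi_dQ m c Q 0 1 = nu m * ((det_shift c Q)^-1 * (c^-1 * Q 0 1)),
      dXi_dQ m c Q 1 0 = nu m * ((det_shift c Q)^-1 * (c^-1 * Q 1 0)) &
      dXi_dQ m c Q 1 1 = - (nu m * ((det_shift c Q)^-1 * (c^-1 * Q 0 0 + 2^-1)))].
Proof.
rewrite -det_shiftE => d0; have [e1 e2 e3 e4] := invmx2 d0.
rewrite /dXi_dQ !mxE in e1 e2 e3 e4 *.
have := invmx2 d0; rewrite !shiftE /= !mulr0n !addr0 => -[-> -> -> ->].
by split; ring.
Qed.

Lemma dXi_dcE c Q : det_shift c Q != 0 ->
  dXi_dc m c Q = ln (M m * c / (M m - c)) +
    nu m * (- ln (det_shift c Q) + ln (\det (half_id R))) +
    nu m / c * ((det_shift c Q)^-1 * ((c^-1 * Q 1 1 + 2^-1) * Q 0 0 +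
      (c^-1 * Q 0 0 + 2^-1) * Q 1 1 - c^-1 * Q 0 1 * Q 0 1 - c^-1 * Q 1 0 * Q 1 0)).
Proof.
rewrite -det_shiftE => d0; have := invmx2 d0; rewrite !shiftE /= !mulr0n !addr0 => -[e1 e2 e3 e4].
rewrite /dXi_dc /q !big_ord2 e1 e2 e3 e4; congr (_ + _ + _ * _); ring.
Qed.

(** The largest eigenvalue of the symmetric traceless matrix with entries [a] and [b] is
    [l = sqrt (a^2 + b^2)], and the shifted determinant equals [((c / 2)^2 - l^2) / c^2]. *)
Lemma physical_admissible c Q : physical m c Q -> admissible c Q.
Proof.
move=> [cM symQ trQ eigQ]; have c0 : 0 < c by case/andP: cM.
have Q10 : Q 1 0 = Q 0 1 by rewrite {1}symQ mxE.
have Q11 : Q 1 1 = - Q 0 0.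
  by move/eqP: trQ; rewrite /mxtrace big_ord2 addrC addr_eq0 => /eqP.
split => //; set a := Q 0 0 in Q11 *; set b := Q 0 1 in Q10 *.
pose l := Num.sqrt (a ^+ 2 + b ^+ 2).
have l2 : l ^+ 2 = a ^+ 2 + b ^+ 2 by rewrite sqr_sqrtr// addr_ge0// sqr_ge0.
have l0 : 0 <= l by exact: sqrtr_ge0.
have row2 (x y z w : R) : x = z -> y = w ->
  (\row_j (if j == 0 then x else y) : 'rV[R]_2) = \row_j (if j == 0 then z else w).
  by move=> -> ->.
have eigl : eigenvalue Q l.
  have mulv (x y : R) : (\row_j (if j == 0 then x else y) : 'rV[R]_2) *m Q =
      \row_j (if j == 0 then x * a + y * b else x * b - y * a).
    apply/rowP => j; rewrite !mxE big_ord2 !mxE /=.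
    by case: (ord2P j) => -> /=; rewrite -/a -/b ?Q10 ?Q11; ring.
  have scalev (x y : R) : l *: (\row_j (if j == 0 then x else y) : 'rV[R]_2) =
      \row_j (if j == 0 then l * x else l * y).
    by apply/rowP => j; rewrite !mxE; case: ifP.
  (* The left eigenvector [(a + l, b)] vanishes when [b = 0] and [a = - l]; then [(0, 1)] serves
     instead. *)
  have [z|nz] := boolP ((a + l == 0) && (b == 0)).
    case/andP: z => /eqP al /eqP b0.
    apply/eigenvalueP; exists (\row_j (if j == 0 then 0 else 1)).
      by rewrite mulv scalev; apply: row2; rewrite ?b0; lra.
    by apply/eqP => /rowP/(_ 1); rewrite !mxE /= => /eqP; rewrite oner_eq0.
  apply/eigenvalueP; exists (\row_j (if j == 0 then a + l else b)).
    rewrite mulv scalev; apply: row2; last by ring.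
    have -> : l * (a + l) = l * a + l ^+ 2 by ring.
    by rewrite l2; ring.
  apply/eqP => v0; move: nz; move/rowP: (v0) => /(_ 0); rewrite !mxE/= => ->.
  by move/rowP: v0 => /(_ 1); rewrite !mxE/= => ->; rewrite eqxx.
have /andP[_ lc] := eigQ l eigl.
have ll : l ^+ 2 < (c / 2) ^+ 2 by rewrite ltr_pXn2r// nnegrE ?ltW// divr_gt0.
rewrite /det_shift Q10 Q11 -/a -/b.
have -> : (c^-1 * a + 2^-1) * (c^-1 * - a + 2^-1) - c^-1 * b * (c^-1 * b) =
    ((c / 2) ^+ 2 - l ^+ 2) / c ^+ 2 by rewrite l2; field; rewrite gt_eqF.
by rewrite divr_gt0 ?exprn_gt0// subr_gt0.
Qed.

Section Limits.
Variables (T : Type) (F : set_system T) (FF : Filter F).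
Variables (c : T -> R) (Q : T -> 'M[R]_2) (c0 : R) (Q0 : 'M[R]_2).
Hypothesis cc : c @ F --> c0.
Hypothesis cQ : forall i j, (fun x => Q x i j) @ F --> Q0 i j.
Hypothesis adm : admissible c0 Q0.

Let c0_gt0 : 0 < c0. Proof. by case: adm => /andP[]. Qed.
Let c0M : c0 < M m. Proof. by case: adm => /andP[]. Qed.
Let M0 : 0 < M m := M_gt0 m.
Let det0 : 0 < det_shift c0 Q0. Proof. by case: adm. Qed.

(** Stated for a nonzero limit of [c], so that it also applies at closure points whose admissibility
    is still to be shown. *)
Lemma cvg_det_shift_pos (c0_n0 : c0 != 0) :
  (fun x => det_shift (c x) (Q x)) @ F --> det_shift c0 Q0.
Proof.
have ci : (fun x => (c x)^-1) @ F --> c0^-1 by apply: cvgV.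
have ce i j : (fun x => (c x)^-1 * Q x i j) @ F --> c0^-1 * Q0 i j by apply: cvgM.
apply: cvgB; apply: cvgM => //; apply: cvgD => //; exact: cvg_cst.
Qed.

Let cdet : (fun x => det_shift (c x) (Q x)) @ F --> det_shift c0 Q0.
Proof. by apply: cvg_det_shift_pos; rewrite gt_eqF. Qed.

Let cvg_ln (f : T -> R) (l : R) : 0 < l -> f @ F --> l -> (fun x => ln (f x)) @ F --> ln l.
Proof. by move=> l0 fl; apply: (cvg_comp _ _ fl); exact: continuous_ln. Qed.

Lemma cvg_Xi : (fun x => Xi m (c x) (Q x)) @ F --> Xi m c0 Q0.
Proof.
rewrite XiE; under eq_fun do rewrite XiE.
apply: cvgD; first apply: cvgD.
- by apply: cvgM => //; exact: cvg_ln.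
- apply: cvgM; first by apply: cvgB => //; exact: cvg_cst.
  apply: cvg_ln; first by rewrite subr_gt0 ltr_pdivrMr// mul1r.
  by apply: cvgB; [exact: cvg_cst|apply: cvgM => //; exact: cvg_cst].
- apply: cvgM; first by apply: cvgM => //; exact: cvg_cst.
  by apply: cvgD; [apply: cvgN; exact: cvg_ln|exact: cvg_cst].
Qed.

(** The closed forms of the derivatives of [Xi] are available where the determinant is nonzero,
    which is the case eventually along [F]. *)
Let near_det : \forall x \near F, det_shift (c x) (Q x) != 0.
Proof.
by apply: filterS (cvgr_gt _ cdet _ det0) => x h; rewrite gt_eqF.
Qed.

Lemma cvg_dXi_dc : (fun x => dXi_dc m (c x) (Q x)) @ F --> dXi_dc m c0 Q0.
Proof.
have d0 : det_shift c0 Q0 != 0 by rewrite gt_eqF.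
have ci : (fun x => (c x)^-1) @ F --> c0^-1 by apply: cvgV => //; rewrite gt_eqF.
have ce i j : (fun x => (c x)^-1 * Q x i j) @ F --> c0^-1 * Q0 i j by apply: cvgM.
have cs i j : (fun x => (c x)^-1 * Q x i j + 2^-1) @ F --> c0^-1 * Q0 i j + 2^-1.
  by apply: cvgD => //; exact: cvg_cst.
rewrite dXi_dcE//; set rhs := (X in _ --> X).
suff : (fun x => ln (M m * c x / (M m - c x)) +
    nu m * (- ln (det_shift (c x) (Q x)) + ln (\det (half_id R))) +
    nu m / c x * ((det_shift (c x) (Q x))^-1 * (((c x)^-1 * Q x 1 1 + 2^-1) * Q x 0 0 +
      ((c x)^-1 * Q x 0 0 + 2^-1) * Q x 1 1 - (c x)^-1 * Q x 0 1 * Q x 0 1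
      - (c x)^-1 * Q x 1 0 * Q x 1 0))) @ F --> rhs.
  apply: cvg_trans; apply: near_eq_cvg; apply: filterS near_det => x dx.
  by rewrite dXi_dcE.
apply: cvgD; first apply: cvgD.
- apply: cvg_ln; first by rewrite divr_gt0 ?mulr_gt0// subr_gt0.
  apply: cvgM; first by apply: cvgM => //; exact: cvg_cst.
  apply: cvgV; first by rewrite subr_eq0 gt_eqF.
  by apply: cvgB => //; exact: cvg_cst.
- apply: cvgM; first exact: cvg_cst.
  by apply: cvgD; [apply: cvgN; exact: cvg_ln|exact: cvg_cst].
- apply: cvgM; first by apply: cvgM => //; exact: cvg_cst.
  apply: cvgM; first exact: cvgV.
  by apply: cvgB; [apply: cvgB; [apply: cvgD|]|]; apply: cvgM.
Qed.

Lemma cvg_dXi_dQ i j : (fun x => dXi_dQ m (c x) (Q x) i j) @ F --> dXi_dQ m c0 Q0 i j.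
Proof.
have d0 : det_shift c0 Q0 != 0 by rewrite gt_eqF.
have ci : (fun x => (c x)^-1) @ F --> c0^-1 by apply: cvgV => //; rewrite gt_eqF.
have ce k l : (fun x => (c x)^-1 * Q x k l) @ F --> c0^-1 * Q0 k l by apply: cvgM.
have cs k l : (fun x => (c x)^-1 * Q x k l + 2^-1) @ F --> c0^-1 * Q0 k l + 2^-1.
  by apply: cvgD => //; exact: cvg_cst.
have cd : (fun x => (det_shift (c x) (Q x))^-1) @ F --> (det_shift c0 Q0)^-1 by apply: cvgV.
have [e00 e01 e10 e11] := dXi_dQE d0.
have diag k l : (fun x => - (nu m * ((det_shift (c x) (Q x))^-1 * ((c x)^-1 * Q x k l + 2^-1)))) @ F -->
    - (nu m * ((det_shift c0 Q0)^-1 * (c0^-1 * Q0 k l + 2^-1))).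
  by apply: cvgN; apply: cvgM; [exact: cvg_cst|apply: cvgM].
have offd k l : (fun x => nu m * ((det_shift (c x) (Q x))^-1 * ((c x)^-1 * Q x k l))) @ F -->
    nu m * ((det_shift c0 Q0)^-1 * (c0^-1 * Q0 k l)).
  by apply: cvgM; [exact: cvg_cst|apply: cvgM].
case: (ord2P i) => ->; case: (ord2P j) => ->; rewrite ?e00 ?e01 ?e10 ?e11.
- apply: cvg_trans (diag 1 1); apply: near_eq_cvg; apply: filterS near_det => x dx.
  by have [-> _ _ _] := dXi_dQE dx.
- apply: cvg_trans (offd 0 1); apply: near_eq_cvg; apply: filterS near_det => x dx.
  by have [_ -> _ _] := dXi_dQE dx.
- apply: cvg_trans (offd 1 0); apply: near_eq_cvg; apply: filterS near_det => x dx.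
  by have [_ _ -> _] := dXi_dQE dx.
- apply: cvg_trans (diag 0 0); apply: near_eq_cvg; apply: filterS near_det => x dx.
  by have [_ _ _ ->] := dXi_dQE dx.
Qed.

End Limits.

(** Differentiating the determinant in one off-diagonal entry produces the other one, whereas the
    given formulas carry the same entry: the two agree because [Q t] is symmetric. *)
Lemma is_derive_Xi (c : R -> R) (Q : R -> 'M[R]_2) (t dc : R) (dQ : 'I_2 -> 'I_2 -> R) :
  is_derive t (1 : R) c dc -> (forall i j, is_derive t (1 : R) (fun s => Q s i j) (dQ i j)) ->
  admissible (c t) (Q t) ->
  is_derive t (1 : R) (fun s => Xi m (c s) (Q s))
    (dXi_dc m (c t) (Q t) * dc + \sum_i \sum_j dXi_dQ m (c t) (Q t) i j * dQ i j).
Proof.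
move=> hc hQ [/andP[c0 cM] Q10 Q11 d0]; have M0 := M_gt0 m.
have hn : det_shift (c t) (Q t) != 0 by rewrite gt_eqF.
have cn : c t != 0 by rewrite gt_eqF.
have -> : (fun s => Xi m (c s) (Q s)) = (fun s => c s * ln (c s) +
   (M m - c s) * ln (1 - c s / M m) +
   c s * nu m * (- ln (det_shift (c s) (Q s)) + ln (\det (half_id R)))).
  by apply/funext => s; rewrite XiE.
(* Each logarithm is hidden behind a fresh function [L], so that the search for derivatives picks up
   the given one and [field] treats its value as an atom. *)
have hln (f : R -> R) (df : R) : is_derive t (1 : R) f df -> 0 < f t ->
    exists L : R -> R, L = (fun s => ln (f s)) /\ is_derive t (1 : R) L (df / f t).
  move=> hf f0; exists (fun s => ln (f s)); split => //.
  by apply: (is_derive_eq (is_derive1_comp (is_derive1_ln f0) hf)); rewrite mulrC.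
have [V [VE hV]] : exists V : R -> R, V = (fun s => (c s)^-1) /\
    is_derive t (1 : R) V (- (c t) ^- 2 * dc).
  by exists (fun s => (c s)^-1); split => //; apply: (is_derive_eq (is_deriveV cn hc)).
have h00 := hQ 0 0; have h01 := hQ 0 1; have h10 := hQ 1 0; have h11 := hQ 1 1.
have hdet : is_derive t (1 : R) (fun s => det_shift (c s) (Q s))
   ((- (c t) ^- 2 * dc * Q t 0 0 + V t * dQ 0 0) * (V t * Q t 1 1 + 2^-1) +
    (V t * Q t 0 0 + 2^-1) * (- (c t) ^- 2 * dc * Q t 1 1 + V t * dQ 1 1) -
    ((- (c t) ^- 2 * dc * Q t 0 1 + V t * dQ 0 1) * (V t * Q t 1 0) +
    (V t * Q t 0 1) * (- (c t) ^- 2 * dc * Q t 1 0 + V t * dQ 1 0))).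
  have -> : (fun s => det_shift (c s) (Q s)) = (fun s => (V s * Q s 0 0 + 2^-1) *
      (V s * Q s 1 1 + 2^-1) - V s * Q s 0 1 * (V s * Q s 1 0)).
    by apply/funext => s; rewrite VE.
  by apply: is_derive_eq; rewrite /GRing.scale/=; ring.
have [L1 [L1E h1]] := hln _ _ hc c0.
have [L2 [L2E h2]] : exists L : R -> R, L = (fun s => ln (1 - c s / M m)) /\
    is_derive t (1 : R) L (- dc / M m / (1 - c t / M m)).
  apply: hln; last by rewrite subr_gt0 ltr_pdivrMr// mul1r.
  by apply: is_derive_eq; rewrite /GRing.scale/=; ring.
have [L3 [L3E h3]] := hln _ _ hdet d0.
have -> : (fun s => c s * ln (c s) + (M m - c s) * ln (1 - c s / M m) +
   c s * nu m * (- ln (det_shift (c s) (Q s)) + ln (\det (half_id R)))) =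
   (fun s => c s * L1 s + (M m - c s) * L2 s +
   c s * nu m * (- L3 s + ln (\det (half_id R)))).
  by apply/funext => s; rewrite L1E L2E L3E.
have LE : ln (M m * c t / (M m - c t)) = L1 t - L2 t.
  have p2 : 0 < 1 - c t / M m by rewrite subr_gt0 ltr_pdivrMr// mul1r.
  rewrite L1E L2E -ln_div//; congr ln; field.
  by rewrite !gt_eqF ?subr_gt0.
have L3t : ln (det_shift (c t) (Q t)) = L3 t by rewrite L3E.
have [e00 e01 e10 e11] := dXi_dQE hn.
rewrite dXi_dcE// !big_ord2 e00 e01 e10 e11 LE L3t.
move: h1 h2 h3 hV hc; rewrite (_ : V t = (c t)^-1) ?VE//.
move: hn d0; set d := det_shift _ _ => hn d0 h1 h2 h3 hV hc.
apply: is_derive_eq; rewrite /GRing.scale/= Q10; field.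
by rewrite hn cn !gt_eqF ?subr_gt0.
Qed.

End XiCalculus.

(** * Admissibility up to the boundary *)

Lemma closure_ge (R : realType) (T : topologicalType) (D : set T) (f : T -> R) x e :
  {for x, continuous f} -> closure D x -> (forall y, D y -> e <= f y) -> e <= f x.
Proof.
move=> cf cx H; rewrite leNgt; apply/negP => fe.
have [y [Dy fy]] := cx _ (cvgr_lt (f x) cf e fe).
by have := H y Dy; rewrite leNgt fy.
Qed.

Lemma closure_eq (R : realType) (T : topologicalType) (D : set T) (f : T -> R) x e :
  {for x, continuous f} -> closure D x -> (forall y, D y -> f y = e) -> f x = e.
Proof.
move=> cf cx H; apply/eqP; rewrite eq_le; apply/andP; split.
  rewrite -lerN2; apply: (closure_ge (f := fun y => - f y) _ cx); first exact: cvgN.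
  by move=> y /H ->.
by apply: (closure_ge cf cx) => y /H ->.
Qed.

Section AdmissibleClosure.
Variables (R : realType) (m : model R).
Implicit Types (c : R) (Q : 'M[R]_2).

Lemma det_shift_sym c Q : Q 1 0 = Q 0 1 -> Q 1 1 = - Q 0 0 ->
  det_shift c Q = 4^-1 - (c^-1 * Q 0 0) ^+ 2 - (c^-1 * Q 0 1) ^+ 2.
Proof. by rewrite /det_shift => -> ->; set z := c^-1; field. Qed.

(** With [a] and [b] the entries of [Q / c], the first two bounded quantities are [nu * a / D] and
    [nu * b / D], while [D = 1/4 - a^2 - b^2]: a small [D] would force [a] and [b] to be small,
    hence [D] close to 1/4. Given a lower bound on [D], the bound on [dXi_dc] becomes one on
    [ln (M c / (M - c))]. *)
Lemma admissible_uniform (B B2 : R) : exists d e : R, [/\ 0 < d, 0 < e &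
  forall c Q, admissible m c Q ->
    `|nu m * ((det_shift c Q)^-1 * (c^-1 * Q 0 0))| <= B ->
    `|nu m * ((det_shift c Q)^-1 * (c^-1 * Q 0 1))| <= B ->
    `|dXi_dc m c Q| <= B2 ->
    [/\ d <= det_shift c Q, e <= c & e <= M m - c]].
Proof.
have nu0 := nu_gt0 m; have M0 := M_gt0 m.
pose B' := `|B| / nu m + 1.
have B'0 : 0 < B' by rewrite ltr_wpDl// divr_ge0// ltW.
(* [D < d] would give [|a|, |b| <= B' * D < 1/4], hence [D >= 1/8 > d]. *)
have [d [d0 d1 d2]] : exists d, [/\ 0 < d, d < 8^-1 & d < (4 * B')^-1].
  by apply: exists_lt2; rewrite invr_gt0// mulr_gt0.
pose K := ln (\det (half_id R)).
(* Bounds [|ln (M c / (M - c))|], with one summand for each of the three terms of [LE]; the last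
   uses [2 (a^2 + b^2) <= 1/2]. *)
pose B3 := `|B2| + nu m * (- ln d + `|K|) + nu m / (2 * d).
pose E := expR B3.
have E0 : 0 < E by exact: expR_gt0.
have ME0 : 0 < M m * E + 1 by rewrite ltr_wpDl// mulr_ge0 ?ltW.
have p1 : 0 < M m / (M m * E + 1) by rewrite divr_gt0.
have p2 : 0 < M m * (M m / (M m * E + 1)) / E by rewrite !divr_gt0// mulr_gt0.
(* [M - c <= E M c] gives the first bound, on [c]; inserted in [M c <= E (M - c)], it gives the
   second, on [M - c]. *)
have [e [e0 e1 e2]] := exists_lt2 p1 p2.
exists d, e; split => // c Q [/andP[c0 cM] Q10 Q11 det0] b1 b2 b3.
have cn : c != 0 by rewrite gt_eqF.
have dE := det_shift_sym c Q10 Q11.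
set a := c^-1 * Q 0 0 in b1 dE; set b := c^-1 * Q 0 1 in b2 dE.
set D := det_shift c Q in b1 b2 dE det0.
have bnd (x : R) : `|nu m * (D^-1 * x)| <= B -> `|x| <= B' * D.
  move=> h; have -> : x = (nu m * (D^-1 * x)) * (D / nu m).
    by field; rewrite !gt_eqF.
  rewrite normrM [`|D / _|]gtr0_norm ?divr_gt0//.
  apply: (@le_trans _ _ (`|B| * (D / nu m))).
    by apply: ler_wpM2r; [rewrite divr_ge0 ?ltW|rewrite (le_trans h)// ler_norm].
  have -> : `|B| * (D / nu m) = (`|B| / nu m) * D by ring.
  by apply: ler_wpM2r; [exact: ltW|rewrite /B' lerDl].
have {}b1 := bnd _ b1; have {}b2 := bnd _ b2.
have dD : d <= D.
  rewrite leNgt; apply/negP => Dd.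
  have BD : B' * D < 4^-1.
    have : B' * D < B' * (4 * B')^-1 by rewrite ltr_pM2l// (lt_trans Dd).
    by have -> : B' * (4 * B')^-1 = 4^-1 by field; rewrite gt_eqF.
  have sq (x : R) : `|x| <= B' * D -> x ^+ 2 <= 16^-1.
    move=> h; rewrite -real_normK ?num_real//.
    have -> : 16^-1 = (4^-1) ^+ 2 :> R by field.
    by rewrite ler_pXn2r ?nnegrE// ?invr_ge0//; lra.
  by have := sq a b1; have := sq b b2; lra.
have D4 : D <= 4^-1 by rewrite dE; have := sqr_ge0 a; have := sqr_ge0 b; lra.
have lnD : `|ln D| <= - ln d.
  have h1 : ln d <= ln D by rewrite ler_ln// posrE.
  have h2 : ln D <= 0 by rewrite ln_le0//; lra.
  by rewrite ler_norml; lra.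
pose L := ln (M m * c / (M m - c)).
have LE : L = dXi_dc m c Q - nu m * (- ln D + K) + nu m * (2 * (a ^+ 2 + b ^+ 2) / D).
  rewrite dXi_dcE ?gt_eqF// -/D -/L -/K Q10 Q11.
  have -> : Q 0 0 = c * a by rewrite /a; field.
  have -> : Q 0 1 = c * b by rewrite /b; field.
  by field; rewrite cn gt_eqF.
have LB : `|L| <= B3.
  rewrite LE (le_trans (ler_normD _ _))// lerD//.
    rewrite (le_trans (ler_normB _ _))// lerD//; first by rewrite (le_trans b3)// ler_norm.
    rewrite normrM gtr0_norm//; apply: ler_wpM2l; first exact: ltW.
    by rewrite (le_trans (ler_normD _ _))// normrN lerD.
  rewrite normrM gtr0_norm//; apply: ler_wpM2l; first exact: ltW.
  have ab : 2 * (a ^+ 2 + b ^+ 2) <= 2^-1 by lra.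
  have ab0 : 0 <= 2 * (a ^+ 2 + b ^+ 2) by rewrite mulr_ge0// addr_ge0// sqr_ge0.
  rewrite ger0_norm ?divr_ge0 ?(ltW det0)//.
  rewrite invfM; apply: ler_pM => //; first by rewrite invr_ge0 ltW.
  by rewrite lef_pV2 ?posrE.
have Mc0 : 0 < M m - c by rewrite subr_gt0.
have x0 : 0 < M m * c / (M m - c) by rewrite divr_gt0// mulr_gt0.
have xE : M m * c / (M m - c) = expR L by rewrite lnK.
move: LB; rewrite ler_norml => /andP[L1 L2].
have u1 : M m * c <= E * (M m - c).
  by rewrite -ler_pdivrMr// xE ler_expR.
have u2 : M m - c <= E * (M m * c).
  have : E^-1 <= M m * c / (M m - c) by rewrite xE /E -expRN ler_expR.
  by rewrite ler_pdivlMr// ler_pdivrMl.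
have c1 : M m / (M m * E + 1) <= c by rewrite ler_pdivrMr//; lra.
split => //; first by apply: le_trans c1; exact: ltW.
apply: (le_trans (ltW e2)); rewrite ler_pdivrMr// [leRHS]mulrC.
apply: le_trans u1; apply: ler_wpM2l => //; exact: ltW.
Qed.

(** Strict inequalities may be lost in the closure, but the uniform ones of [admissible_uniform]
    survive. *)
Lemma admissible_closure (D : set (R * R)) (c : R * R -> R) (Q : R * R -> 'M[R]_2) (B B2 : R) r :
  {for r, continuous c} -> (forall i j, {for r, continuous (fun r => Q r i j)}) -> closure D r ->
  (forall r, D r -> admissible m (c r) (Q r)) ->
  (forall r, D r -> forall i j, `|projP (fun r => dXi_dQ m (c r) (Q r)) r i j| <= B) ->
  (forall r, D r -> `|dXi_dc m (c r) (Q r)| <= B2) ->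
  admissible m (c r) (Q r).
Proof.
move=> cc cQ cr adm b1 b2.
have [d [e [d0 e0 H]]] := admissible_uniform B B2.
have HD y : D y -> [/\ d <= det_shift (c y) (Q y), e <= c y & e <= M m - c y].
  move=> Dy; have ady := adm y Dy; apply: H => //; last exact: b2.
    have := b1 y Dy 0 0; rewrite /projP mxE !big_ord2 (_ : (0 == 0 :> 'I_2)%:R = 1 :> R)//.
    have [/andP[cp _] Q10 Q11 det0] := ady; have dn : det_shift (c y) (Q y) != 0 by rewrite gt_eqF.
    have [-> _ _ ->] := dXi_dQE m dn; rewrite Q11; congr (`|_| <= _); field.
    by rewrite dn gt_eqF.
  have := b1 y Dy 0 1; rewrite /projP mxE !big_ord2 (_ : (0 == 1 :> 'I_2)%:R = 0 :> R)//.
  have [/andP[cp _] Q10 Q11 det0] := ady; have dn : det_shift (c y) (Q y) != 0 by rewrite gt_eqF.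
  have [_ -> -> _] := dXi_dQE m dn; rewrite Q10; congr (`|_| <= _); field.
  by rewrite dn gt_eqF.
have er : e <= c r by apply: (closure_ge cc cr) => y /HD[].
have eMr : e <= M m - c r.
  apply: (closure_ge (f := fun y => M m - c y) _ cr); last by move=> y /HD[].
  by apply: cvgB => //; exact: cvg_cst.
have cn : c r != 0 by rewrite gt_eqF//; lra.
split.
- by apply/andP; split; lra.
- apply/eqP; rewrite -subr_eq0; apply/eqP.
  apply: (closure_eq (f := fun y => Q y 1 0 - Q y 0 1) _ cr); first by apply: cvgB; exact: cQ.
  by move=> y /adm[_ -> _ _]; rewrite subrr.
- apply/eqP; rewrite -addr_eq0; apply/eqP.
  apply: (closure_eq (f := fun y => Q y 1 1 + Q y 0 0) _ cr); first by apply: cvgD; exact: cQ.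
  by move=> y /adm[_ _ -> _]; rewrite addNr.
- apply: (lt_le_trans d0); apply: (closure_ge (f := fun y => det_shift (c y) (Q y)) _ cr).
    by apply: cvg_det_shift_pos => //; exact: cQ.
  by move=> y /HD[].
Qed.

End AdmissibleClosure.

(** * Calculus on space-time *)

Definition derivative_over (R : realType) (V : normedModType R) (W : set V) (v : V)
    (f f' : V -> R) :=
  forall p, W p -> is_derive p v f (f' p).

Section DerivativeRules.
Variables (R : realType) (V : normedModType R) (W : set V) (v : V).
Implicit Types (f g : V -> R).

Lemma derivative_overD f g f' g' : derivative_over W v f f' -> derivative_over W v g g' ->
  derivative_over W v (fun p => f p + g p) (fun p => f' p + g' p).
Proof. by move=> df dg p Wp; apply: is_deriveD; [exact: df|exact: dg]. Qed.

Lemma derivative_overN f f' : derivative_over W v f f' ->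
  derivative_over W v (fun p => - f p) (fun p => - f' p).
Proof. by move=> df p Wp; apply: is_deriveN; exact: df. Qed.

Lemma derivative_overM f g f' g' : derivative_over W v f f' -> derivative_over W v g g' ->
  derivative_over W v (fun p => f p * g p) (fun p => f' p * g p + f p * g' p).
Proof.
move=> df dg p Wp; apply: (is_derive_eq (is_deriveM (df p Wp) (dg p Wp))).
by rewrite addrC [f' p * g p]mulrC.
Qed.

Lemma derivative_overZ (k : R) f f' : derivative_over W v f f' ->
  derivative_over W v (fun p => k * f p) (fun p => k * f' p).
Proof. by move=> df p Wp; apply: is_deriveZ; exact: df. Qed.

Lemma derivative_over_sum (f f' : 'I_2 -> V -> R) :
  (forall i, derivative_over W v (f i) (f' i)) ->
  derivative_over W v (fun p => \sum_i f i p) (fun p => \sum_i f' i p).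
Proof.
have E (h : 'I_2 -> V -> R) : (fun p => \sum_i h i p) = (fun p => h 0 p + h 1 p).
  by apply/funext => p; rewrite big_ord2.
by move=> h; rewrite !E; exact: derivative_overD.
Qed.

End DerivativeRules.

(** Function and derivative are decomposed together, so the derivative has to be written exactly as
    the rules produce it; only the elementary factors remain as goals. *)
Ltac differentiate := lazymatch goal with
  | |- derivative_over _ _ (fun p => @?f p + @?g p) (fun p => @?f' p + @?g' p) =>
      refine (@derivative_overD _ _ _ _ f g f' g' _ _); differentiate
  | |- derivative_over _ _ (fun p => - @?f p) (fun p => - @?f' p) =>
      refine (@derivative_overN _ _ _ _ f f' _); differentiate
  | |- derivative_over _ _ (fun p => @?f p * @?g p)
        (fun p => @?f' p * @?g p + @?f p * @?g' p) =>
      refine (@derivative_overM _ _ _ _ f g f' g' _ _); differentiate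
  | |- derivative_over _ _ (fun p => _ * @?f p) (fun p => ?k * @?f' p) =>
      refine (@derivative_overZ _ _ _ _ k f f' _); differentiate
  | |- derivative_over _ _ (fun p => bigop.body _ _ _) _ =>
      refine (derivative_over_sum _); intro; differentiate
  | _ => idtac
  end.

Definition continuous_over (V : topologicalType) (W : set V) (R : realType) (f : V -> R) :=
  forall p, W p -> {for p, continuous f}.

Section ContinuityRules.
Variables (R : realType) (V : topologicalType) (W : set V).
Implicit Types (f g : V -> R).

Lemma continuous_over_cst (k : R) : continuous_over W (fun=> k).
Proof. by move=> p _; exact: cvg_cst. Qed.

Lemma continuous_overD f g : continuous_over W f -> continuous_over W g ->
  continuous_over W (fun y => f y + g y).
Proof. by move=> cf cg p Wp; apply: cvgD; [exact: cf|exact: cg]. Qed.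

Lemma continuous_overM f g : continuous_over W f -> continuous_over W g ->
  continuous_over W (fun y => f y * g y).
Proof. by move=> cf cg p Wp; apply: cvgM; [exact: cf|exact: cg]. Qed.

Lemma continuous_overN f : continuous_over W f -> continuous_over W (fun y => - f y).
Proof. by move=> cf p Wp; apply: cvgN; exact: cf. Qed.

Lemma continuous_over_sum (f : 'I_2 -> V -> R) : (forall i, continuous_over W (f i)) ->
  continuous_over W (fun y => \sum_i f i y).
Proof.
move=> h; rewrite (_ : (fun y => \sum_i f i y) = (fun y => f 0 y + f 1 y)).
  exact: continuous_overD.
by apply/funext => y; rewrite big_ord2.
Qed.

End ContinuityRules.

Ltac continuity := lazymatch goal with
  | |- continuous_over _ (fun _ => ?k) => refine (@continuous_over_cst _ _ _ k)
  | |- continuous_over _ (fun p => @?f p + @?g p) =>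
      refine (@continuous_overD _ _ _ f g _ _); continuity
  | |- continuous_over _ (fun p => - @?f p) =>
      refine (@continuous_overN _ _ _ f _); continuity
  | |- continuous_over _ (fun p => @?f p * @?g p) =>
      refine (@continuous_overM _ _ _ f g _ _); continuity
  | |- continuous_over _ (fun p => bigop.body _ _ _) =>
      refine (continuous_over_sum _); intro; continuity
  | _ => idtac
  end.

(** Reduces a space-time derivative to one real variable, the setting of [is_derive_Xi]. *)
Lemma is_derive_line (R : realType) (V : normedModType R) (F : V -> R) p v df :
  is_derive p v F df <-> is_derive (0 : R) (1 : R) (fun h => F (h *: v + p)) df.
Proof.
have E h : (h *: (1 : R) + 0) *: v + p = h *: v + (0 *: v + p).
  by rewrite addr0 scale0r add0r /GRing.scale/= mulr1.
have D := @derivable_affine R R V R F (fun h => h *: v + p) 0 1 v E.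
have D' := @derive_affine R R V R F (fun h => h *: v + p) 0 1 v E.
rewrite scale0r add0r in D D'.
split=> -[h1 h2].
  by apply: (DeriveDef (iffRL D h1)); exact: etrans D' h2.
by apply: (DeriveDef (iffLR D h1)); exact: etrans (esym D') h2.
Qed.

Section SpaceTime.
Variables (R : realType) (T : R) (Omega : region R).
Local Notation D := (dom Omega).
Local Notation point := (R * (R * R))%type.
Implicit Types (F G : point -> R) (p : point) (i j : 'I_2).

Definition slab : set point := [set p | 0 < p.1 < T /\ closure D p.2].

Definition smooth k F := exists W, [/\ open W, slab `<=` W & Ck_on k W F].

Definition dt F : point -> R := 'D_(1, (0, 0)) F.

Definition dx i F : point -> R := 'D_(0, unit_vec R i) F.

Lemma time_axis : ((1, (0, 0)) : point) \in spacetime_axes R.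
Proof. by rewrite !inE eqxx. Qed.

Lemma unit_vec0 : unit_vec R 0 = (1, 0).
Proof. by []. Qed.

Lemma unit_vec1 : unit_vec R 1 = (0, 1).
Proof. by []. Qed.

Lemma space_axis i : ((0, unit_vec R i) : point) \in spacetime_axes R.
Proof.
by have [->|->] := ord2P i; rewrite ?unit_vec0 ?unit_vec1 !inE eqxx ?orbT.
Qed.

Lemma smoothW k F : smooth k.+1 F -> smooth k F.
Proof. by move=> [W [oW sW h]]; exists W; split => //; exact: Ck_onW. Qed.

Lemma smooth_dt k F : smooth k.+1 F -> smooth k (dt F).
Proof.
move=> [W [oW sW h]]; exists W; split => //.
exact: Ck_on_derive time_axis h.
Qed.

Lemma smooth_dx k i F : smooth k.+1 F -> smooth k (dx i F).
Proof.
move=> [W [oW sW h]]; exists W; split => //.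
exact: Ck_on_derive (space_axis i) h.
Qed.

Lemma smoothD k F G : smooth k F -> smooth k G -> smooth k (fun p => F p + G p).
Proof.
move=> [W [oW sW h]] [W' [oW' sW' h']]; exists (W `&` W'); split.
- exact: openI.
- by move=> p sp; split; [exact: sW|exact: sW'].
- by apply: Ck_onD; [exact: openI|apply: Ck_onS h => p []|apply: Ck_onS h' => p []].
Qed.

Lemma smooth_continuous k F : smooth k F -> continuous_over slab F.
Proof. by move=> [W [oW sW h]] p /sW Wp; exact: Ck_on_continuous h Wp. Qed.

Lemma smooth_derivative_dt k F : smooth k.+1 F ->
  derivative_over slab ((1, (0, 0)) : point) F (dt F).
Proof.
move=> [W [oW sW h]] p /sW Wp; apply: DeriveDef => //.
exact: Ck_on_derivable time_axis h Wp.
Qed.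

Lemma smooth_derivative_dx k i F : smooth k.+1 F ->
  derivative_over slab ((0, unit_vec R i) : point) F (dx i F).
Proof.
move=> [W [oW sW h]] p /sW Wp; apply: DeriveDef => //.
exact: Ck_on_derivable (space_axis i) h Wp.
Qed.

(** The equality is stated near [p] because [dt_dx_dx] differentiates it once more. *)
Lemma smooth_dt_dx i F p : smooth 2 F -> slab p ->
  \forall p' \near p, dt (dx i F) p' = dx i (dt F) p'.
Proof.
move=> [W [oW sW h]] /sW Wp.
apply: (@filterS _ (nbhs p) _ W); last exact: open_nbhs_nbhs.
by move=> p' Wp'; exact: Ck_on_schwarz oW (space_axis i) time_axis h Wp'.
Qed.

Lemma smooth_dx_dx i j F p : smooth 2 F -> slab p -> dx i (dx j F) p = dx j (dx i F) p.
Proof.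
move=> [W [oW sW h]] /sW Wp.
exact: Ck_on_schwarz oW (space_axis j) (space_axis i) h Wp.
Qed.

Lemma near_dx i F G p : (\forall p' \near p, F p' = G p') -> dx i F p = dx i G p.
Proof.
move=> h; exact: near_eq_derive.
Qed.

Lemma dt_dx_dx i j F p : smooth 3 F -> slab p ->
  dt (dx i (dx j F)) p = dx i (dx j (dt F)) p.
Proof.
move=> sF sp; rewrite (nbhs_singleton (smooth_dt_dx i (smooth_dx j sF) sp)).
by apply: near_dx; apply: smooth_dt_dx => //; exact: smoothW.
Qed.

Lemma partialE i F (t : R) : partial i (fun r => F (t, r)) = (fun r => dx i F (t, r)).
Proof.
apply/funext => r; rewrite /partial /dx.
apply: (@derive_affine _ _ _ _ F (fun r => (t, r)) r (unit_vec R i) (0, unit_vec R i)).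
move=> h; transitivity ((h *: 0 + t, h *: unit_vec R i + r) : point) => //.
by rewrite scaler0 add0r.
Qed.

Lemma derive1_slice F t r : derive1 (fun s => F (s, r)) t = dt F (t, r).
Proof.
rewrite derive1E /dt.
apply: (@derive_affine _ _ _ _ F (fun s => (s, r)) t (1 : R) (1, (0, 0))).
move=> h; transitivity ((h *: 1 + t, (h *: 0 + r.1, h *: 0 + r.2)) : point) => //.
by rewrite scaler0 !add0r; case: r.
Qed.

Lemma is_derive_time F (t : R) r df : is_derive (t, r) ((1, (0, 0)) : point) F df ->
  is_derive t (1 : R) (fun s => F (s, r)) df.
Proof.
apply: (@is_derive_affine _ _ _ _ F (fun s => (s, r)) t (1 : R) (1, (0, 0))).
move=> h; transitivity ((h *: 1 + t, (h *: 0 + r.1, h *: 0 + r.2)) : point) => //.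
by rewrite scaler0 !add0r; case: r.
Qed.

Lemma is_derive_space i F (t : R) r df : is_derive (t, r) ((0, unit_vec R i) : point) F df ->
  is_derive r (unit_vec R i) (fun r => F (t, r)) df.
Proof.
apply: (@is_derive_affine _ _ _ _ F (fun r => (t, r)) r (unit_vec R i) (0, unit_vec R i)).
move=> h; transitivity ((h *: 0 + t, h *: unit_vec R i + r) : point) => //.
by rewrite scaler0 add0r.
Qed.

Lemma continuous_slice F t : 0 < t < T -> continuous_over slab F ->
  continuous_over (closure D) (fun r => F (t, r)).
Proof.
move=> t0T cF r cr; have h : {for (t, r), continuous F} by apply: cF.
apply: (cvg_comp _ _ _ h) => B [[A1 A2]/= [h1 h2] H].
by apply: filterS h2 => z A2z; apply: H; split => //=; exact: nbhs_singleton.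
Qed.

(** On a compact time interval around [t] this gives the constant that dominates the integrand when
    differentiating under the integral. *)
Lemma slab_bound F t : 0 < t < T -> continuous_over slab F ->
  exists a b K, [/\ 0 < a, a < t, t < b, b < T &
    forall s r, a <= s <= b -> closure D r -> `|F (s, r)| <= K].
Proof.
move=> /andP[t0 tT] cF.
pose a := t / 2; pose b := (t + T) / 2.
have a0 : 0 < a by rewrite /a; lra.
have at' : a < t by rewrite /a; lra.
have tb : t < b by rewrite /b; lra.
have bT : b < T by rewrite /b; lra.
pose C : set point := `[a, b]%classic `*` closure D.
have cC : compact C.
  by apply: compact_setX; [exact: segment_compact|exact: closure_bounded_compact (@dom_bounded _ Omega)].
have CE s r : a <= s <= b -> closure D r -> C (s, r) by move=> h1 h2; split; rewrite //= in_itv.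
have C0 : C !=set0.
  have [r Dr] := @dom_nonempty _ Omega.
  by exists (a, r); apply: CE; [rewrite lexx (ltW (lt_trans at' tb))|exact: subset_closure].
have cn : {within C, continuous (fun p => `|F p|)}.
  apply: continuous_in_subspaceT => p; rewrite inE => -[/=]; rewrite in_itv/= => /andP[h1 h2] h3.
  apply: (continuous_comp (g := fun x : R => `|x|)); last exact: norm_continuous.
  by apply: cF; split => //; lra.
have [p _ pP] := compact_EVT_max C0 cC cn.
exists a, b, `|F p|; split => // s r h1 h2.
by apply: (pP (s, r)); rewrite inE; exact: CE.
Qed.

End SpaceTime.

(** * Integrals over the region and its boundary *)

Section IntegralOverRegion.
Variables (R : realType) (T : R) (Omega : region R).
Local Notation D := (dom Omega).
Local Notation mu := (@lebesgue_measure R).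
Local Notation mu2 := (lebesgue2 R).
Implicit Types F G : R * R -> R.

Lemma integrable_dom F : continuous_over (closure D) F -> mu2.-integrable D (EFin \o F).
Proof.
move=> cF; apply: continuous_integrable_plane cF; first exact: dom_open.
exact: dom_bounded.
Qed.

Lemma measurable_dom : measurable D.
Proof. exact: open_measurable_plane (@dom_open _ Omega). Qed.

Lemma eq_integral_dom F G : (forall r, D r -> F r = G r) ->
  integral_dom Omega F = integral_dom Omega G.
Proof. by move=> FG; apply: eq_Rintegral => r; rewrite inE => /FG. Qed.

Lemma integral_domD F G : continuous_over (closure D) F -> continuous_over (closure D) G ->
  integral_dom Omega (fun r => F r + G r) = integral_dom Omega F + integral_dom Omega G.
Proof.
move=> /integrable_dom iF /integrable_dom iG.
apply: RintegralD iF iG; exact: measurable_dom.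
Qed.

Lemma integral_domZ (k : R) F : continuous_over (closure D) F ->
  integral_dom Omega (fun r => k * F r) = k * integral_dom Omega F.
Proof. by move=> /integrable_dom iF; apply: RintegralZl iF; exact: measurable_dom. Qed.

Lemma integral_dom_cst (k : R) : integral_dom Omega (fun=> k) = k * area Omega.
Proof. exact: (Rintegral_cst mu2 measurable_dom k). Qed.

(** The open region contains a box of positive measure. [projG] divides by the area, and has mean
    zero for this reason. *)
Lemma area_neq0 : area Omega != 0.
Proof.
have [[x y] Dr] := @dom_nonempty _ Omega.
have := open_nbhs_nbhs (conj (@dom_open _ Omega) Dr).
move=> [[A1 A2]/= [/nbhs_ballP[e1 /= e10 h1] /nbhs_ballP[e2 /= e20 h2]] H].
pose I1 : set R := `]x - e1, x + e1[%classic; pose I2 : set R := `]y - e2, y + e2[%classic.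
have m12 : measurable (I1 `*` I2) by apply: measurableX; exact: measurable_itv.
have S : I1 `*` I2 `<=` D.
  move=> [z w] [/=]; rewrite /I1 /I2 /= !in_itv/= => h3 h4; apply: H; split => /=.
    by apply: h1; rewrite /ball/= ltr_distlC.
  by apply: h2; rewrite /ball/= ltr_distlC.
have L : (mu2 (I1 `*` I2) <= mu2 D)%E.
  by apply: le_measure; rewrite ?inE//; exact: measurable_dom.
have mu_itv (u e : R) : 0 < e -> mu `]u - e, u + e[%classic = (e + e)%:E.
  move=> e0; rewrite lebesgue_measure_itv/= lte_fin ifT; last lra.
  by rewrite -EFinB; congr EFin; ring.
have E : mu2 (I1 `*` I2) = ((e1 + e1) * (e2 + e2))%:E.
  rewrite /lebesgue2 product_measure1E//; try exact: measurable_itv.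
  rewrite EFinM; congr (_ * _)%E; exact: mu_itv.
rewrite gt_eqF// fine_gt0//; apply/andP; split.
  apply: lt_le_trans L; rewrite E lte_fin; apply: mulr_gt0; lra.
by apply: bounded_plane_measure; [exact: dom_open|exact: dom_bounded].
Qed.

Lemma integral_domN F : continuous_over (closure D) F ->
  integral_dom Omega (fun r => - F r) = - integral_dom Omega F.
Proof.
move=> cF; rewrite -mulN1r -integral_domZ//; apply: eq_integral_dom => r _.
by rewrite mulN1r.
Qed.

Lemma projG_continuous F : continuous_over (closure D) F ->
  continuous_over (closure D) (projG Omega F).
Proof. by move=> cF; apply: continuous_overD => //; exact: continuous_over_cst. Qed.

Lemma integral_projG F : continuous_over (closure D) F -> integral_dom Omega (projG Omega F) = 0.
Proof.
move=> cF; rewrite integral_domD//; last exact: continuous_over_cst.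
rewrite integral_dom_cst mulNr mulrAC mulVf ?mul1r ?subrr//.
exact: area_neq0.
Qed.

(** [F] and its projection differ by a constant, which is orthogonal to functions of mean zero. *)
Lemma inner_projG F : continuous_over (closure D) F ->
  inner_scalar Omega F (projG Omega F) = inner_scalar Omega (projG Omega F) (projG Omega F).
Proof.
move=> cF; have cG := projG_continuous cF.
rewrite /inner_scalar; set a := (area Omega)^-1 * integral_dom Omega F.
transitivity (integral_dom Omega
    (fun r => projG Omega F r * projG Omega F r + a * projG Omega F r)).
  by apply: eq_integral_dom => r _; rewrite -mulrDl /projG -/a subrK.
rewrite integral_domD; last 2 first.
- exact: continuous_overM.
- by apply: continuous_overM => //; exact: continuous_over_cst.
by rewrite integral_domZ// integral_projG// mulr0 addr0.
Qed.

Lemma is_derive_integral_dom (I I' : R * (R * R) -> R) (t : R) : 0 < t < T ->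
  continuous_over (slab T Omega) I -> continuous_over (slab T Omega) I' ->
  derivative_over (slab T Omega) ((1, (0, 0)) : R * (R * R)) I I' ->
  is_derive t (1 : R) (fun s => integral_dom Omega (fun r => I (s, r)))
    (integral_dom Omega (fun r => I' (t, r))).
Proof.
move=> t0T cI cI' dI.
have [a [b [K [a0 at_ tb bT KP]]]] := slab_bound t0T cI'.
have [r0 Dr0] := @dom_nonempty _ Omega.
have K0 : 0 <= K.
  by apply: le_trans (KP t r0 _ _); [|rewrite !ltW|exact: subset_closure].
have sl s r : (`]a, b[%classic : set R) s -> D r -> slab T Omega (s, r).
  rewrite /= in_itv/= => /andP[h1 h2] Dr; split; last exact: subset_closure.
  by rewrite /= (lt_trans a0 h1) (lt_trans h2 bT).
pose f s r := I (s, r).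
have dE s r : (`]a, b[%classic : set R) s -> D r -> partial1of2 f s r = I' (s, r).
  by move=> h1 h2; rewrite /partial1of2 derive1E; have [_ ->] := is_derive_time (dI _ (sl _ _ h1 h2)).
have It : (`]a, b[%classic : set R) t by rewrite /= in_itv/= at_.
have intf s : (`]a, b[%classic : set R) s -> mu2.-integrable D (EFin \o f s).
  move=> h; apply: integrable_dom; apply: continuous_slice cI.
  move: h; rewrite /= in_itv/= => /andP[h1 h2].
  by rewrite (lt_trans a0 h1) (lt_trans h2 bT).
have df s r : (`]a, b[%classic : set R) s -> D r -> derivable (f ^~ r) s 1.
  by move=> h1 h2; have [] := is_derive_time (dI _ (sl _ _ h1 h2)).
have iK : mu2.-integrable D (EFin \o (fun=> K)).
  by apply: integrable_dom => r _; exact: cvg_cst.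
have ub s r : (`]a, b[%classic : set R) s -> D r -> `|partial1of2 f s r| <= K.
  move=> h1 h2; rewrite dE//; apply: KP; last exact: subset_closure.
  by move: h1; rewrite /= in_itv/= => /andP[h3 h4]; rewrite !ltW.
have := @derivable_under_integral R _ _ mu2 f D measurable_dom t a b It intf df (fun=> K)
  (fun=> K0) iK ub.
have := @differentiation_under_integral R _ _ mu2 f D measurable_dom t a b It intf df (fun=> K)
  (fun=> K0) iK ub.
move=> h1 h2; apply: DeriveDef => //.
rewrite derive1E in h1; rewrite [LHS]h1.
by apply: eq_integral_dom => r Dr; exact: dE.
Qed.

Definition continuous01 (f : R -> R) := forall s, 0 <= s <= 1 -> {for s, continuous f}.

Lemma continuous01_integrable (f : R -> R) : continuous01 f ->
  mu.-integrable `[0, 1] (EFin \o f).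
Proof.
move=> cf; apply: continuous_compact_integrable; first exact: segment_compact.
by apply: continuous_in_subspaceT => s; rewrite inE/= in_itv/=; exact: cf.
Qed.

Lemma continuous01_arc (h : R * R -> R) (k : 'I_(narcs Omega)) (b : R -> R) :
  continuous_over (closure D) h -> continuous b ->
  continuous01 (fun s => h (bdry_arc k s) * b s).
Proof.
move=> ch cb s s01; apply: cvgM; last exact: cb.
have [cs _] := @arc_frontier _ Omega k s s01.
exact: (cvg_comp _ _ (@arc_continuous _ Omega k s) (ch _ cs)).
Qed.

(** The dynamic boundary condition is imposed only inside the arcs, where the normal is unambiguous;
    the two end parameters form a null set. *)
Lemma eq_integral01 (f g : R -> R) : continuous01 f -> continuous01 g ->
  (forall s, 0 < s < 1 -> f s = g s) ->
  (\int[mu]_(s in `[0%R, 1%R]) f s = \int[mu]_(s in `[0%R, 1%R]) g s)%R.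
Proof.
have E (h : R -> R) : continuous01 h ->
    (\int[mu]_(s in `[0%R, 1%R]) h s = \int[mu]_(s in `]0%R, 1%R[) h s)%R.
  move=> /continuous01_integrable ih.
  rewrite -Rintegral_itv_obnd_cbnd; last first.
    by apply: integrableS ih => //; apply: subset_itvr; rewrite bnd_simp.
  rewrite -Rintegral_itv_bndo_bndc//.
  apply: integrableS ih => // s; rewrite /= !in_itv/= => /andP[s0 s1]; lra.
move=> cf cg fg; rewrite !E//; apply: eq_Rintegral => s; rewrite inE/= in_itv/=; exact: fg.
Qed.

Lemma divergence_theorem (f g f' g' : R * R -> R) :
  continuous_over (closure D) f -> continuous_over (closure D) g ->
  continuous_over (closure D) f' -> continuous_over (closure D) g' ->
  (forall r, closure D r -> is_derive r (unit_vec R 0) f (f' r)) ->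
  (forall r, closure D r -> is_derive r (unit_vec R 1) g (g' r)) ->
  integral_dom Omega (fun r => f' r + g' r) =
  \sum_(k < narcs Omega) (\int[mu]_(s in `[0%R, 1%R])
    (f (bdry_arc k s) * (derive1 (bdry_arc k) s).2 -
     g (bdry_arc k s) * (derive1 (bdry_arc k) s).1))%R.
Proof.
move=> cf cg cf' cg' df dg.
rewrite integral_domD// (green_horizontal cf cf' df) (green_vertical cg cg' dg).
rewrite -sumrB; apply: eq_bigr => k _; apply/esym/RintegralB => //.
- apply: continuous01_integrable; apply: continuous01_arc => // s.
  by apply: (cvg_comp _ _ (@arc_C1 _ Omega k s)); exact: cvg_snd.
- apply: continuous01_integrable; apply: continuous01_arc => // s.
  by apply: (cvg_comp _ _ (@arc_C1 _ Omega k s)); exact: cvg_fst.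
Qed.

Lemma arc_speed_continuous (k : 'I_(narcs Omega)) :
  continuous (fun s => euclid_norm (derive1 (bdry_arc k) s)).
Proof.
move=> s; have c1 : (fun s => (derive1 (bdry_arc k) s).1) @ s --> (derive1 (bdry_arc k) s).1.
  by apply: (cvg_comp _ _ (@arc_C1 _ Omega k s)); exact: cvg_fst.
have c2 : (fun s => (derive1 (bdry_arc k) s).2) @ s --> (derive1 (bdry_arc k) s).2.
  by apply: (cvg_comp _ _ (@arc_C1 _ Omega k s)); exact: cvg_snd.
have c3 : (fun s => (derive1 (bdry_arc k) s).1 ^+ 2 + (derive1 (bdry_arc k) s).2 ^+ 2) @ s -->
    (derive1 (bdry_arc k) s).1 ^+ 2 + (derive1 (bdry_arc k) s).2 ^+ 2.
  by apply: cvgD; apply: cvgM.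
exact: (cvg_comp _ _ c3 (@sqrt_continuous R _)).
Qed.

Lemma arc_speed_neq0 (k : 'I_(narcs Omega)) s : 0 <= s <= 1 ->
  euclid_norm (derive1 (bdry_arc k) s) != 0.
Proof.
move=> /(@arc_regular _ Omega k); apply: contra; rewrite /euclid_norm sqrtr_eq0.
case: (derive1 _ s) => a b /= h.
have /andP[/eqP a0 /eqP b0] : (a ^+ 2 == 0) && (b ^+ 2 == 0).
  by rewrite -paddr_eq0 ?sqr_ge0// eq_le h addr_ge0 ?sqr_ge0.
by apply/eqP; congr pair; apply/eqP; rewrite -sqrf_eq0 ?a0 ?b0.
Qed.

(* If the tangential parts of the flux vanish on the boundary, only the normal
   component [g] of the flux survives. *)
Lemma boundary_flux (f0 f1 g h0 h1 : R * R -> R) (b : R) :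
  continuous_over (closure D) f0 -> continuous_over (closure D) f1 ->
  continuous_over (closure D) g ->
  (forall r, boundary Omega r -> f0 r = b * (g r * h0 r)) ->
  (forall r, boundary Omega r -> f1 r = b * (g r * h1 r)) ->
  (forall (k : 'I_(narcs Omega)) s, 0 < s < 1 -> let n := unit_normal (bdry_arc k) s in
    n.1 * h0 (bdry_arc k s) + n.2 * h1 (bdry_arc k s) = - g (bdry_arc k s)) ->
  \sum_(k < narcs Omega) (\int[mu]_(s in `[0%R, 1%R])
    (f0 (bdry_arc k s) * (derive1 (bdry_arc k) s).2 -
     f1 (bdry_arc k s) * (derive1 (bdry_arc k) s).1))%R =
  - b * integral_boundary Omega (fun r => g r ^+ 2).
Proof.
move=> cf0 cf1 cg f0E f1E hg; rewrite /integral_boundary mulr_sumr.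
have cg2 : continuous_over (closure D) (fun r => g r ^+ 2) by exact: continuous_overM.
apply: eq_bigr => k _.
have i2 := continuous01_arc cg2 (@arc_speed_continuous k).
rewrite -RintegralZl//; last exact: continuous01_integrable.
apply: eq_integral01.
- move=> s s01; apply: cvgB.
    apply: (continuous01_arc cf0) s01 => z.
    by apply: (cvg_comp _ _ (@arc_C1 _ Omega k z)); exact: cvg_snd.
  apply: (continuous01_arc cf1) s01 => z.
  by apply: (cvg_comp _ _ (@arc_C1 _ Omega k z)); exact: cvg_fst.
- by move=> s s01; apply: cvgM; [exact: cvg_cst|exact: i2].
move=> s s01; have s01' : 0 <= s <= 1 by case/andP: s01 => ? ?; rewrite !ltW.
have bs : boundary Omega (bdry_arc k s) by exact: arc_frontier.
rewrite f0E// f1E//; have := hg k s s01; have := arc_speed_neq0 k s01'.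
rewrite /unit_normal/=; set N := euclid_norm _; move: N => N N0 E.
move: E; case: (derive1 _ s) => a' b' /= E.
(* The factor [N] of the line element cancels the normalisation of [unit_normal]. *)
have {}E : b' * h0 (bdry_arc k s) - a' * h1 (bdry_arc k s) = - g (bdry_arc k s) * N.
  rewrite -E; field.
  exact: N0.
transitivity (b * g (bdry_arc k s) * (b' * h0 (bdry_arc k s) - a' * h1 (bdry_arc k s))).
  by ring.
by rewrite E; ring.
Qed.

End IntegralOverRegion.

(** At each point [projP] is the orthogonal projection onto the symmetric traceless matrices. *)
Lemma inner_projP (R : realType) (X : R * R -> 'M[R]_2) r :
  \sum_i \sum_j X r i j * projP X r i j = \sum_i \sum_j projP X r i j * projP X r i j.
Proof.
rewrite !big_ord2 /projP !mxE !big_ord2 !eqxx /= !mulr1n !mulr0n.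
by field.
Qed.

(** * The energy balance *)

Section Expansion.
Variables (R : realType) (m : model R).
Implicit Types (c : R * R -> R) (Q : R * R -> 'M[R]_2) (r : R * R).

(** Splits off the singular term [dXi_dc] and replaces the spatial derivatives by values, later
    those of space-time functions. *)
Lemma dE_dc_expand c Q r lap bilap (ddq : 'I_2 -> 'I_2 -> R) :
  laplacian c r = lap -> bilaplacian c r = bilap ->
  (forall i j, partial i (partial j (entry Q i j)) r = ddq i j) ->
  dE_dc m c Q r = dXi_dc m (c r) (Q r) +
    (2 * c00 m * c r + - (2 * c20 m * lap) + - (c23 m * (\sum_i \sum_j ddq i j))
     + 2 * c40 m * bilap).
Proof.
move=> <- <- ddqE; rewrite /dE_dc.
have -> : \sum_i \sum_j partial i (partial j (entry Q i j)) r = \sum_i \sum_j ddq i j.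
  by apply: eq_bigr => i _; apply: eq_bigr => j _.
by rewrite !addrA.
Qed.

Lemma dE_dQ_expand c Q r i j ddc (ddq : 'I_2 -> 'I_2 -> 'I_2 -> 'I_2 -> R) :
  partial i (partial j c) r = ddc ->
  (forall k l i j, partial k (partial l (entry Q i j)) r = ddq k l i j) ->
  dE_dQ m c Q r i j = dXi_dQ m (c r) (Q r) i j +
    (2 * c02 m * Q r i j + - (2 * c21 m * (\sum_k ddq k k i j))
     + - (2 * c22 m * (\sum_k ddq i k k j)) + - (c23 m * ddc)).
Proof.
move=> <- ddqE; rewrite /dE_dQ mxE -!addrA; do 2 congr (_ + _).
congr (- (_ * _) + (- (_ * _) + _)); by apply: eq_bigr => k _; rewrite -ddqE.
Qed.

Lemma g_e_expand c Q r (dc : 'I_2 -> R) (ddc : 'I_2 -> R) (dq : 'I_2 -> 'I_2 -> 'I_2 -> R) :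
  (forall i, partial i c r = dc i) -> (forall i, partial i (partial i c) r = ddc i) ->
  (forall k i j, partial k (entry Q i j) r = dq k i j) ->
  g_e m c Q r = c20 m * (\sum_k dc k * dc k)
    + c21 m * (\sum_i \sum_j \sum_k dq k i j * dq k i j)
    + c22 m * (\sum_i \sum_j \sum_k dq i i j * dq k k j)
    + c23 m * (\sum_i \sum_j dc j * dq i i j)
    + c40 m * (\sum_i \sum_j ddc i * ddc j).
Proof.
move=> dcE ddcE dqE; rewrite /g_e; congr (_ * _ + _ * _ + _ * _ + _ * _ + _ * _);
  repeat (apply: eq_bigr => ? _); by rewrite ?ddcE ?dcE ?dqE.
Qed.

End Expansion.

Section EnergyBalance.
Variables (R : realType) (m : model R) (Omega : region R) (T : R).
Local Notation D := (dom Omega).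
Local Notation point := (R * (R * R))%type.
Local Notation slab := (slab T Omega).

(* [u] and [P] are the time derivatives of [c] and [Q], [w] is the Laplacian of
   [c]; a prefix [d] or [dd] marks the spatial derivatives, the first indices
   being the directions. *)
Variables (c u w : point -> R) (Q : point -> 'M[R]_2) (P : 'I_2 -> 'I_2 -> point -> R).
Variables (dc du dw : 'I_2 -> point -> R) (ddc ddu ddw : 'I_2 -> 'I_2 -> point -> R).
Variables (dQ dP : 'I_2 -> 'I_2 -> 'I_2 -> point -> R).
Variable ddQ : 'I_2 -> 'I_2 -> 'I_2 -> 'I_2 -> point -> R.

Local Notation time_derivative := (derivative_over slab ((1, (0, 0)) : point)).
Local Notation space_derivative i := (derivative_over slab ((0, unit_vec R i) : point)).

Hypothesis c_cont : continuous_over slab c.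
Hypothesis Q_cont : forall i j, continuous_over slab (fun p => Q p i j).
Hypothesis u_cont : continuous_over slab u.
Hypothesis P_cont : forall i j, continuous_over slab (P i j).
Hypothesis w_cont : continuous_over slab w.
Hypothesis dc_cont : forall i, continuous_over slab (dc i).
Hypothesis du_cont : forall i, continuous_over slab (du i).
Hypothesis dw_cont : forall i, continuous_over slab (dw i).
Hypothesis ddc_cont : forall i j, continuous_over slab (ddc i j).
Hypothesis ddu_cont : forall i j, continuous_over slab (ddu i j).
Hypothesis ddw_cont : forall i j, continuous_over slab (ddw i j).
Hypothesis dQ_cont : forall k i j, continuous_over slab (dQ k i j).
Hypothesis dP_cont : forall k i j, continuous_over slab (dP k i j).
Hypothesis ddQ_cont : forall k l i j, continuous_over slab (ddQ k l i j).

Hypothesis c_time : time_derivative c u.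
Hypothesis Q_time : forall i j, time_derivative (fun p => Q p i j) (P i j).
Hypothesis dc_time : forall i, time_derivative (dc i) (du i).
Hypothesis ddc_time : forall i j, time_derivative (ddc i j) (ddu i j).
Hypothesis dQ_time : forall k i j, time_derivative (dQ k i j) (dP k i j).

Hypothesis dc_space : forall k i, space_derivative k (dc i) (ddc k i).
Hypothesis u_space : forall k, space_derivative k u (du k).
Hypothesis du_space : forall k i, space_derivative k (du i) (ddu k i).
Hypothesis w_space : forall k, space_derivative k w (dw k).
Hypothesis dw_space : forall k i, space_derivative k (dw i) (ddw k i).
Hypothesis dQ_space : forall k l i j, space_derivative k (dQ l i j) (ddQ k l i j).
Hypothesis P_space : forall k i j, space_derivative k (P i j) (dP k i j).

Hypothesis wE : forall p, w p = \sum_i ddc i i p.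
Hypothesis ddQC : forall k l i j p, slab p -> ddQ k l i j p = ddQ l k i j p.

Hypothesis adm : forall p, slab p -> admissible m (c p) (Q p).

(* The variational derivatives, without the derivatives of [Xi]. *)
Definition dE_dc_reg (p : point) : R :=
  2 * c00 m * c p + - (2 * c20 m * w p)
  + - (c23 m * (\sum_i \sum_j ddQ i j i j p)) + 2 * c40 m * (\sum_i ddw i i p).

Definition dE_dQ_reg i j (p : point) : R :=
  2 * c02 m * Q p i j + - (2 * c21 m * (\sum_k ddQ k k i j p))
  + - (2 * c22 m * (\sum_k ddQ i k k j p)) + - (c23 m * ddc i j p).

Definition dE_dc_at p := dXi_dc m (c p) (Q p) + dE_dc_reg p.
Definition dE_dQ_at i j p := dXi_dQ m (c p) (Q p) i j + dE_dQ_reg i j p.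

Definition energy_density (p : point) : R :=
  Xi m (c p) (Q p) + c00 m * (c p * c p) + c02 m * (\sum_i \sum_j Q p i j * Q p i j)
  + (c20 m * (\sum_k dc k p * dc k p)
    + c21 m * (\sum_i \sum_j \sum_k dQ k i j p * dQ k i j p)
    + c22 m * (\sum_i \sum_j \sum_k dQ i i j p * dQ k k j p)
    + c23 m * (\sum_i \sum_j dc j p * dQ i i j p)
    + c40 m * (\sum_i \sum_j ddc i i p * ddc j j p)).

(** The time derivative of [energy_density], left in the shape of the product rule for
    [differentiate]; likewise [dflux] for [flux]. *)
Let rate (p : point) : R :=
  dXi_dc m (c p) (Q p) * u p + \sum_i \sum_j dXi_dQ m (c p) (Q p) i j * P i j p
  + c00 m * (u p * c p + c p * u p)
  + c02 m * (\sum_i \sum_j (P i j p * Q p i j + Q p i j * P i j p))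
  + (c20 m * (\sum_k (du k p * dc k p + dc k p * du k p))
    + c21 m * (\sum_i \sum_j \sum_k (dP k i j p * dQ k i j p + dQ k i j p * dP k i j p))
    + c22 m * (\sum_i \sum_j \sum_k (dP i i j p * dQ k k j p + dQ i i j p * dP k k j p))
    + c23 m * (\sum_i \sum_j (du j p * dQ i i j p + dc j p * dP i i j p))
    + c40 m * (\sum_i \sum_j (ddu i i p * ddc j j p + ddc i i p * ddu j j p))).

(** The last line, [w grad u - u grad w], is Green's second identity for the fourth-order term; the
    others come from single integrations by parts. *)
Let flux k (p : point) : R :=
  2 * c20 m * (u p * dc k p)
  + 2 * c21 m * (\sum_i \sum_j P i j p * dQ k i j p)
  + 2 * c22 m * (\sum_j P k j p * (\sum_l dQ l l j p))
  + c23 m * (u p * (\sum_i dQ i i k p) + \sum_j P k j p * dc j p)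
  + 2 * c40 m * (w p * du k p + - (u p * dw k p)).

Let dflux k (p : point) : R :=
  2 * c20 m * (du k p * dc k p + u p * ddc k k p)
  + 2 * c21 m * (\sum_i \sum_j (dP k i j p * dQ k i j p + P i j p * ddQ k k i j p))
  + 2 * c22 m * (\sum_j (dP k k j p * (\sum_l dQ l l j p) + P k j p * (\sum_l ddQ k l l j p)))
  + c23 m * (du k p * (\sum_i dQ i i k p) + u p * (\sum_i ddQ k i i k p)
      + \sum_j (dP k k j p * dc j p + P k j p * ddc k j p))
  + 2 * c40 m * (dw k p * du k p + w p * ddu k k p + - (du k p * dw k p + u p * ddw k k p)).

(** With all derivatives as independent symbols, this is a polynomial identity once [w] is expanded
    and the mixed derivatives of [Q] are identified. *)
Let rateE p : slab p ->
  rate p = dE_dc_at p * u p + \sum_i \sum_j dE_dQ_at i j p * P i j p + (dflux 0 p + dflux 1 p).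
Proof.
move=> sp; rewrite /rate /dE_dc_at /dE_dQ_at /dflux /dE_dc_reg /dE_dQ_reg wE !big_ord2.
rewrite !(@ddQC 1 0 _ _ p sp).
ring.
Qed.

Let Xi_cont : continuous_over slab (fun p => Xi m (c p) (Q p)).
Proof.
move=> p sp; apply: cvg_Xi (adm sp); first exact: c_cont.
by move=> i j; exact: Q_cont.
Qed.
Let dXi_dc_cont : continuous_over slab (fun p => dXi_dc m (c p) (Q p)).
Proof.
move=> p sp; apply: cvg_dXi_dc (adm sp); first exact: c_cont.
by move=> i j; exact: Q_cont.
Qed.
Let dXi_dQ_cont i j : continuous_over slab (fun p => dXi_dQ m (c p) (Q p) i j).
Proof.
move=> p sp; exact: (cvg_dXi_dQ _ (c_cont sp) (fun k l => @Q_cont k l p sp) (adm sp)).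
Qed.

(* Syntactic lookup of the hypothesis: unification would compare distinct
   functions up to the unfolding of continuity. *)
Ltac leaf := match goal with
  | H : continuous_over _ ?f |- continuous_over _ (fun p => ?f p) => exact H
  | H : forall i, continuous_over _ (?f i) |- continuous_over _ (fun p => ?f _ p) =>
      exact (H _)
  | H : forall i j, continuous_over _ (?f i j) |- continuous_over _ (fun p => ?f _ _ p) =>
      exact (H _ _)
  | H : forall k i j, continuous_over _ (?f k i j)
      |- continuous_over _ (fun p => ?f _ _ _ p) => exact (H _ _ _)
  | H : forall k l i j, continuous_over _ (?f k l i j)
      |- continuous_over _ (fun p => ?f _ _ _ _ p) => exact (H _ _ _ _)
  | |- continuous_over _ (fun p => Xi _ _ _) => exact Xi_cont
  | |- continuous_over _ (fun p => dXi_dc _ _ _) => exact dXi_dc_cont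
  | _ => first [exact (@Q_cont _ _) | exact (@dXi_dQ_cont _ _)]
  end.

Let A_cont : continuous_over slab dE_dc_at.
Proof. by rewrite /dE_dc_at /dE_dc_reg; continuity; leaf. Qed.
Let B_cont i j : continuous_over slab (dE_dQ_at i j).
Proof. by rewrite /dE_dQ_at /dE_dQ_reg; continuity; leaf. Qed.
Let density_cont : continuous_over slab energy_density.
Proof. by rewrite /energy_density; continuity; leaf. Qed.
Let rate_cont : continuous_over slab rate.
Proof. by rewrite /rate; continuity; leaf. Qed.
Let flux_cont k : continuous_over slab (flux k).
Proof. by rewrite /flux; continuity; leaf. Qed.
Let dflux_cont k : continuous_over slab (dflux k).
Proof. by rewrite /dflux; continuity; leaf. Qed.

Let Xi_time : time_derivative (fun p => Xi m (c p) (Q p))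
  (fun p => dXi_dc m (c p) (Q p) * u p + \sum_i \sum_j dXi_dQ m (c p) (Q p) i j * P i j p).
Proof.
move=> p sp; apply: (iffRL (is_derive_line _ _ _ _)).
have h := @is_derive_Xi R m (fun h : R => c (h *: ((1, (0, 0)) : point) + p))
  (fun h : R => Q (h *: ((1, (0, 0)) : point) + p)) 0 (u p) (fun i j => P i j p).
move: h; rewrite scale0r add0r; apply; last exact: adm.
- exact: (iffLR (is_derive_line _ _ _ _) (c_time sp)).
- move=> i j; exact: (iffLR (is_derive_line _ _ _ _) (@Q_time i j p sp)).
Qed.

Let density_time : time_derivative energy_density rate.
Proof.
rewrite /energy_density /rate; differentiate.
all: first [exact: Xi_time|exact: c_time|exact: Q_time|exact: dc_time|exact: ddc_time
  |exact: dQ_time].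
Qed.

Let flux_space k : space_derivative k (flux k) (dflux k).
Proof.
rewrite /flux /dflux; differentiate.
  all: first [exact: u_space|exact: w_space|exact: dc_space|exact: du_space
    |exact: dw_space|exact: dQ_space|exact: P_space].
Qed.

Theorem energy_balance t : 0 < t < T ->
  (forall r, D r -> u (t, r) = - projG Omega (fun r => dE_dc_at (t, r)) r) ->
  (forall r, D r -> forall i j,
     P i j (t, r) = - projP (fun r => \matrix_(i, j) dE_dQ_at i j (t, r)) r i j) ->
  (forall r, boundary Omega r -> u (t, r) = 0) ->
  (forall r, boundary Omega r -> forall i j, P i j (t, r) = 0) ->
  (forall (k : 'I_(narcs Omega)) s, 0 < s < 1 -> let n := unit_normal (bdry_arc k) s in
    n.1 * du 0 (t, bdry_arc k s) + n.2 * du 1 (t, bdry_arc k s) = - w (t, bdry_arc k s)) ->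
  is_derive t (1 : R) (fun s => integral_dom Omega (fun r => energy_density (s, r)))
   (- inner_scalar Omega (projG Omega (fun r => dE_dc_at (t, r)))
                         (projG Omega (fun r => dE_dc_at (t, r)))
    - inner_tensor Omega (projP (fun r => \matrix_(i, j) dE_dQ_at i j (t, r)))
                         (projP (fun r => \matrix_(i, j) dE_dQ_at i j (t, r)))
    - 2 * c40 m * integral_boundary Omega (fun r => w (t, r) ^+ 2)).
Proof.
move=> t0T uE PE u0 P0 normal_flux.
apply: (is_derive_eq (is_derive_integral_dom t0T density_cont rate_cont density_time)).
set a := fun r => dE_dc_at (t, r); set b := fun r => \matrix_(i, j) dE_dQ_at i j (t, r).
have ca : continuous_over (closure D) a by exact: continuous_slice t0T A_cont.
have cb i j : continuous_over (closure D) (fun r => projP b r i j).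
  rewrite (_ : (fun r => _) = fun r => 2^-1 * (dE_dQ_at i j (t, r) + dE_dQ_at j i (t, r))
    + - (2^-1 * (i == j)%:R * (\sum_k dE_dQ_at k k (t, r)))).
    by continuity; apply: continuous_slice t0T (@B_cont _ _).
  apply/funext => r; rewrite /projP mxE !mxE; congr (_ - _ * _).
  by apply: eq_bigr => k _; rewrite mxE.
have cbb : continuous_over (closure D) (fun r => \sum_i \sum_j projP b r i j * projP b r i j).
  by continuity; exact: cb.
have cG := projG_continuous ca.
have cslice (f : point -> R) : continuous_over slab f ->
    continuous_over (closure D) (fun r => f (t, r)).
  exact: continuous_slice.
transitivity (integral_dom Omega (fun r =>
  (- (a r * projG Omega a r) + - (\sum_i \sum_j projP b r i j * projP b r i j))
  + (dflux 0 (t, r) + dflux 1 (t, r)))).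
  apply: eq_integral_dom => r Dr; rewrite rateE; last by split => //; exact: subset_closure.
  congr (_ + _ + _); first by rewrite uE// mulrN.
  rewrite -inner_projP !big_ord2 !PE// -!/b ![b r _ _]mxE !mulrN.
  ring.
rewrite integral_domD; last 2 first.
- by continuity.
- by continuity; exact: cslice (@dflux_cont _).
have -> := divergence_theorem (cslice _ (@flux_cont 0)) (cslice _ (@flux_cont 1))
  (cslice _ (@dflux_cont 0)) (cslice _ (@dflux_cont 1))
  (fun r cr => is_derive_space (@flux_space 0 (t, r) (conj t0T cr)))
  (fun r cr => is_derive_space (@flux_space 1 (t, r) (conj t0T cr))).
have fluxE k r : boundary Omega r -> flux k (t, r) = 2 * c40 m * (w (t, r) * du k (t, r)).
  by move=> br; rewrite /flux u0// !big_ord2 !P0//; ring.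
have -> := boundary_flux (cslice _ (@flux_cont 0)) (cslice _ (@flux_cont 1))
  (cslice _ w_cont) (fluxE 0) (fluxE 1) normal_flux.
rewrite !mulNr; congr (_ - _); rewrite integral_domD; last 2 first.
- by continuity.
- by continuity.
rewrite !integral_domN//; last by continuity.
by congr (- _ - _); exact: inner_projG.
Qed.

End EnergyBalance.

Lemma energy_density_expand (R : realType) (m : model R) (c0 : R * R -> R) (Q0 : R * R -> 'M[R]_2)
    r c Q dc ddc dQ (p : R * (R * R)) :
  c0 r = c p -> Q0 r = Q p -> (forall i, partial i c0 r = dc i p) ->
  (forall i, partial i (partial i c0) r = ddc i i p) ->
  (forall k i j, partial k (entry Q0 i j) r = dQ k i j p) ->
  Xi m (c0 r) (Q0 r) + c00 m * c0 r ^+ 2 + c02 m * (\sum_i \sum_j Q0 r i j * Q0 r i j)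
    + g_e m c0 Q0 r = energy_density m c Q dc ddc dQ p.
Proof.
move=> cE QE dcE ddcE dQE.
by rewrite (g_e_expand m dcE ddcE dQE) cE QE /energy_density expr2.
Qed.

Lemma bounded_closure (R : realType) (Omega : region R) (F : R * R -> R) :
  continuous_over (closure (dom Omega)) F ->
  exists K, forall r, closure (dom Omega) r -> `|F r| <= K.
Proof.
move=> cF; have cn : {within closure (dom Omega), continuous (fun r => `|F r|)}.
  apply: continuous_in_subspaceT => r; rewrite inE => cr.
  by apply: (cvg_comp _ _ (cF r cr)); exact: norm_continuous.
have c0 : closure (dom Omega) !=set0.
  by have [r Dr] := @dom_nonempty _ Omega; exists r; exact: subset_closure.
have [r _ rP] := compact_EVT_max c0 (closure_bounded_compact (@dom_bounded _ Omega)) cn.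
by exists `|F r| => s cs; apply: rP; rewrite inE.
Qed.

(* The flow determines the singular part of the variational derivatives by
   functions that are bounded, so that [c] and [Q] stay away from the boundary
   of the physical domain. *)
Lemma flow_admissible (R : realType) (m : model R) (Omega : region R)
    (c u a : R * R -> R) (Q : R * R -> 'M[R]_2) (P b : 'I_2 -> 'I_2 -> R * R -> R) (mean : R) :
  let D := dom Omega in
  continuous_over (closure D) c -> (forall i j, continuous_over (closure D) (fun r => Q r i j)) ->
  continuous_over (closure D) u -> (forall i j, continuous_over (closure D) (P i j)) ->
  continuous_over (closure D) a -> (forall i j, continuous_over (closure D) (b i j)) ->
  (forall r, D r -> admissible m (c r) (Q r)) ->
  (forall r, D r -> u r = - (dXi_dc m (c r) (Q r) + a r - mean)) ->
  (forall r, D r -> forall i j,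
     P i j r = - projP (fun r => \matrix_(i, j) (dXi_dQ m (c r) (Q r) i j + b i j r)) r i j) ->
  forall r, closure D r -> admissible m (c r) (Q r).
Proof.
move=> D cc cQ cu cP ca cb adm uE PE r cr.
(* Up to sign this is the projection of [dXi_dQ], which the flow expresses through functions
   continuous on the closure. *)
pose F i j r := P i j r + (2^-1 * (b i j r + b j i r)
  + - (2^-1 * (i == j)%:R * (\sum_k b k k r))).
have cF i j : continuous_over (closure D) (F i j).
  by rewrite /F; continuity.
have [K KP] : exists K, forall r, closure D r -> forall i j, `|F i j r| <= K.
  have [[K00 K00P] [K01 K01P]] := (bounded_closure (cF 0 0), bounded_closure (cF 0 1)).
  have [[K10 K10P] [K11 K11P]] := (bounded_closure (cF 1 0), bounded_closure (cF 1 1)).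
  exists (Num.max (Num.max K00 K01) (Num.max K10 K11)) => s cs i j; rewrite !le_max.
  by have [->|->] := ord2P i; have [->|->] := ord2P j;
    rewrite ?K00P ?K01P ?K10P ?K11P ?orbT.
have [L LP] : exists L, forall r, closure D r -> `|- u r + - a r + mean| <= L.
  by apply: bounded_closure; continuity.
apply: (@admissible_closure R m D c Q K L) => //.
- exact: cc.
- by move=> i j; exact: cQ.
- move=> s Ds i j; have -> : projP (fun r => dXi_dQ m (c r) (Q r)) s i j = - F i j s.
    rewrite /F PE// /projP !mxE !big_ord2 !mxE; ring.
  by rewrite normrN; apply: KP; exact: subset_closure.
- move=> s Ds; have -> : dXi_dc m (c s) (Q s) = - u s + - a s + mean by rewrite uE//; ring.
  by apply: LP; exact: subset_closure.
Qed.

Lemma derivative_over_eq (R : realType) (V : normedModType R) (W : set V) (v : V)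
    (f f' g' : V -> R) : derivative_over W v f f' -> (forall p, W p -> f' p = g' p) ->
  derivative_over W v f g'.
Proof. by move=> df fg p Wp; rewrite -fg//; exact: df. Qed.

Lemma derive1_near_cst (R : realType) (f : R -> R) (k t : R) :
  (\forall s \near t, f s = k) -> derive1 f t = 0.
Proof.
move=> fk; rewrite derive1E -(derive_cst k t (1 : R)).
exact: near_eq_derive.
Qed.

(** * Solutions of the gradient flow *)

Section GradientFlow.
Variables (R : realType) (m : model R) (Omega : region R) (T : R).
Variables (c : R -> R * R -> R) (Q : R -> R * R -> 'M[R]_2).
Local Notation D := (dom Omega).
Local Notation point := (R * (R * R))%type.
Local Notation slab := (slab T Omega).
Local Notation smooth := (smooth T Omega).
Local Opaque dt dx.

Let cc (p : point) := c p.1 p.2.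
Let QQ (p : point) := Q p.1 p.2.
Let qq i j (p : point) := QQ p i j.

(** Order 4 is used up by [dx i (dx j w)], and order 2 for [Q] by its second spatial derivatives. *)
Hypothesis c_smooth : smooth 4 cc.
Hypothesis Q_smooth : forall i j, smooth 2 (qq i j).

Let u := dt cc.
Let P i j := dt (qq i j).
Let w (p : point) := \sum_i dx i (dx i cc) p.

Let u_smooth : smooth 3 u. Proof. exact: smooth_dt c_smooth. Qed.
Let P_smooth i j : smooth 1 (P i j). Proof. exact: smooth_dt (Q_smooth i j). Qed.
Let w_smooth : smooth 2 w.
Proof.
have -> : w = (fun p => dx 0 (dx 0 cc) p + dx 1 (dx 1 cc) p).
  by apply/funext => p; rewrite /w big_ord2.
by apply: smoothD; do 2 apply: smooth_dx.
Qed.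

Let partial_c i t : partial i (c t) = fun r => dx i cc (t, r).
Proof. exact: (partialE i cc t). Qed.
Let partial2_c i j t : partial i (partial j (c t)) = fun r => dx i (dx j cc) (t, r).
Proof. by rewrite partial_c; exact: partialE. Qed.
Let partial_Q k i j t : partial k (entry (Q t) i j) = fun r => dx k (qq i j) (t, r).
Proof. exact: (partialE k (qq i j) t). Qed.
Let partial2_Q k l i j t :
  partial k (partial l (entry (Q t) i j)) = fun r => dx k (dx l (qq i j)) (t, r).
Proof. by rewrite partial_Q; exact: partialE. Qed.
Let laplacian_c t : laplacian (c t) = fun r => w (t, r).
Proof.
by apply/funext => r; rewrite /laplacian /w; apply: eq_bigr => i _; rewrite partial2_c.
Qed.
Let bilaplacian_c t r : bilaplacian (c t) r = \sum_i dx i (dx i w) (t, r).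
Proof.
rewrite /bilaplacian laplacian_c /laplacian; apply: eq_bigr => i _.
by rewrite !partialE.
Qed.

Let A := dE_dc_reg m cc w (fun i j => dx i (dx j w)) (fun k l i j => dx k (dx l (qq i j))).
Let B := dE_dQ_reg m QQ (fun i j => dx i (dx j cc)) (fun k l i j => dx k (dx l (qq i j))).

Let dE_dcE t r : dE_dc m (c t) (Q t) r = dXi_dc m (c t r) (Q t r) + A (t, r).
Proof.
apply: (@dE_dc_expand R m (c t) (Q t) r (w (t, r)) (\sum_i dx i (dx i w) (t, r))
  (fun i j => dx i (dx j (qq i j)) (t, r))).
- by rewrite laplacian_c.
- by rewrite bilaplacian_c.
- by move=> i j; rewrite partial2_Q.
Qed.

Let dE_dQE t r i j : dE_dQ m (c t) (Q t) r i j = dXi_dQ m (c t r) (Q t r) i j + B i j (t, r).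
Proof.
apply: (@dE_dQ_expand R m (c t) (Q t) r i j (dx i (dx j cc) (t, r))
  (fun k l i j => dx k (dx l (qq i j)) (t, r))).
- by rewrite partial2_c.
- by move=> k l i' j'; rewrite partial2_Q.
Qed.

Let density := energy_density m cc QQ (fun i => dx i cc) (fun i j => dx i (dx j cc))
  (fun k i j => dx k (qq i j)).

Let energyE s : energy m Omega (c s) (Q s) = integral_dom Omega (fun r => density (s, r)).
Proof.
apply: eq_integral_dom => r _.
apply: (@energy_density_expand R m (c s) (Q s) r cc QQ (fun i => dx i cc)
  (fun i j => dx i (dx j cc)) (fun k i j => dx k (qq i j)) (s, r)).
- by [].
- by [].
- by move=> i; rewrite partial_c.
- by move=> i; rewrite partial2_c.
- by move=> k i j; rewrite partial_Q.
Qed.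

Hypothesis physical_dom : forall t r, 0 < t < T -> D r -> physical m (c t r) (Q t r).
Variables (c_bnd : R * R -> R) (Q_bnd : R * R -> 'M[R]_2).
Hypothesis solution : gradient_flow_solution m Omega T c_bnd Q_bnd c Q.

Let u_dom t r : 0 < t < T -> D r -> u (t, r) = - projG Omega (dE_dc m (c t) (Q t)) r.
Proof. by move=> /solution[h _ _ _ _] Dr; rewrite -[u _]derive1_slice; exact: h. Qed.

Let P_dom t r i j : 0 < t < T -> D r -> P i j (t, r) = - projP (dE_dQ m (c t) (Q t)) r i j.
Proof. by move=> /solution[_ h _ _ _] Dr; rewrite -[P _ _ _]derive1_slice; exact: h. Qed.

Let near_itv t : 0 < t < T -> \forall s \near t, 0 < s < T.
Proof.
move=> t0T; suff : nbhs t (`]0, T[%classic : set R) by apply: filterS => s; rewrite /= in_itv.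
by apply: open_nbhs_nbhs; split; [exact: interval_open|rewrite /= in_itv].
Qed.

Let u_boundary t r : 0 < t < T -> boundary Omega r -> u (t, r) = 0.
Proof.
move=> t0T br; rewrite -[u _]derive1_slice; apply: (@derive1_near_cst _ _ (c_bnd r)).
by apply: filterS (near_itv t0T) => s /solution[_ _ h _ _]; exact: h.
Qed.

Let P_boundary t r i j : 0 < t < T -> boundary Omega r -> P i j (t, r) = 0.
Proof.
move=> t0T br; rewrite -[P _ _ _]derive1_slice; apply: (@derive1_near_cst _ _ (Q_bnd r i j)).
by apply: filterS (near_itv t0T) => s /solution[_ _ _ h _]; rewrite /qq /QQ/= h.
Qed.

(** Exchanging time and space derivatives turns the time derivative of the normal derivative of [c]
    into the normal derivative of [u]. *)
Let normal_flux t (k : 'I_(narcs Omega)) s : 0 < t < T -> 0 < s < 1 ->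
  let n := unit_normal (bdry_arc k) s in
  n.1 * dx 0 u (t, bdry_arc k s) + n.2 * dx 1 u (t, bdry_arc k s) = - w (t, bdry_arc k s).
Proof.
move=> t0T s01 n; have [_ _ _ _ /(_ k s s01)] := solution t0T.
rewrite laplacian_c -/n => <-; set r := bdry_arc k s.
have sr : slab (t, r).
  by split => //; case/andP: s01 => s0 s1; have [] := @arc_frontier _ Omega k s _; rewrite ?ltW.
have c2 : smooth 2 cc by do 2 apply: smoothW.
have E i : derivative_over slab ((1, (0, 0)) : point) (dx i cc) (dx i u).
  apply: (derivative_over_eq (smooth_derivative_dt (smooth_dx i c_smooth))) => p sp.
  exact: nbhs_singleton (smooth_dt_dx i c2 sp).
have F : derivative_over slab ((1, (0, 0)) : point)
    (fun p => n.1 * dx 0 cc p + n.2 * dx 1 cc p) (fun p => n.1 * dx 0 u p + n.2 * dx 1 u p).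
  by differentiate; exact: E.
have E' : (fun v => directional_derivative n (c v) r) =
    (fun v => n.1 * dx 0 cc (v, r) + n.2 * dx 1 cc (v, r)).
  by apply/funext => v; rewrite /directional_derivative !partial_c.
by rewrite E' derive1E; have [_ ->] := is_derive_time (F _ sr).
Qed.

Let ddQ_continuous k l i j : continuous_over slab (dx k (dx l (qq i j))).
Proof. exact: smooth_continuous (smooth_dx k (smooth_dx l (Q_smooth i j))). Qed.

(** This makes [Xi] and its derivatives continuous up to the boundary, as the divergence theorem and
    the integrals require. *)
Let on_slab : forall p, slab p -> admissible m (cc p) (QQ p).
Proof.
move=> [t r] [/= t0T cr].
have slice (f : point -> R) : continuous_over slab f ->
    continuous_over (closure D) (fun r => f (t, r)) by exact: continuous_slice.
(* The average in [projG] enters as a mere number: that [dE_dc] is integrable is deduced later, from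
   the admissibility being proved. *)
apply: (@flow_admissible R m Omega (c t) (fun r => u (t, r)) (fun r => A (t, r)) (Q t)
  (fun i j r => P i j (t, r)) (fun i j r => B i j (t, r))
  ((area Omega)^-1 * integral_dom Omega (dE_dc m (c t) (Q t)))) => //.
- exact: slice (smooth_continuous c_smooth).
- by move=> i j; exact: slice (smooth_continuous (Q_smooth i j)).
- exact: slice (smooth_continuous u_smooth).
- by move=> i j; exact: slice (smooth_continuous (P_smooth i j)).
- apply: slice; rewrite /A /dE_dc_reg; continuity.
  + exact: smooth_continuous c_smooth.
  + exact: smooth_continuous w_smooth.
  + exact: ddQ_continuous.
  + exact: smooth_continuous (smooth_dx _ (smooth_dx _ w_smooth)).
- move=> i j; apply: slice; rewrite /B /dE_dQ_reg; continuity.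
  + exact: smooth_continuous (Q_smooth i j).
  + exact: ddQ_continuous.
  + exact: ddQ_continuous.
  + exact: smooth_continuous (smooth_dx _ (smooth_dx _ c_smooth)).
- by move=> s Ds; apply: physical_admissible; exact: physical_dom.
- by move=> s Ds; rewrite u_dom// /projG dE_dcE.
- move=> s Ds i j; rewrite P_dom//; congr (- projP _ _ _ _).
  by apply/funext => v; apply/matrixP => k l; rewrite [RHS]mxE dE_dQE.
Qed.


Let mixed k F : smooth 2 F -> derivative_over slab ((1, (0, 0)) : point) (dx k F) (dx k (dt F)).
Proof.
move=> F2; apply: (derivative_over_eq (smooth_derivative_dt (smooth_dx k F2))) => p sp.
exact: nbhs_singleton (smooth_dt_dx k F2 sp).
Qed.

Let mixed2 k l F : smooth 3 F ->
  derivative_over slab ((1, (0, 0)) : point) (dx k (dx l F)) (dx k (dx l (dt F))).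
Proof.
move=> F3; apply: (derivative_over_eq (smooth_derivative_dt (smooth_dx k (smooth_dx l F3)))).
by move=> p sp; exact: dt_dx_dx F3 sp.
Qed.

Theorem energy_dissipation t : 0 < t < T ->
  is_derive t (1 : R) (fun s => energy m Omega (c s) (Q s))
    (- inner_scalar Omega (projG Omega (dE_dc m (c t) (Q t)))
                          (projG Omega (dE_dc m (c t) (Q t)))
     - inner_tensor Omega (projP (dE_dQ m (c t) (Q t)))
                          (projP (dE_dQ m (c t) (Q t)))
     - 2 * c40 m * integral_boundary Omega (fun r => laplacian (c t) r ^+ 2)).
Proof.
move=> t0T; rewrite (funext energyE) laplacian_c.
have dE_dcE' : dE_dc m (c t) (Q t) = fun r => dE_dc_at m cc w QQ
    (fun i j => dx i (dx j w)) (fun k l i j => dx k (dx l (qq i j))) (t, r).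
  by apply/funext => r; rewrite dE_dcE.
have dE_dQE' : dE_dQ m (c t) (Q t) = fun r => \matrix_(i, j) dE_dQ_at m cc QQ
    (fun i j => dx i (dx j cc)) (fun k l i j => dx k (dx l (qq i j))) i j (t, r).
  by apply/funext => r; apply/matrixP => i j; rewrite [RHS]mxE dE_dQE.
rewrite dE_dcE' dE_dQE'.
apply: (@energy_balance R m Omega T cc u w QQ P (fun i => dx i cc) (fun i => dx i u)
  (fun i => dx i w) (fun i j => dx i (dx j cc)) (fun i j => dx i (dx j u))
  (fun i j => dx i (dx j w)) (fun k i j => dx k (qq i j)) (fun k i j => dx k (P i j))
  (fun k l i j => dx k (dx l (qq i j)))).
- exact: smooth_continuous c_smooth.
- by move=> i j; exact: smooth_continuous (Q_smooth i j).
- exact: smooth_continuous u_smooth.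
- by move=> i j; exact: smooth_continuous (P_smooth i j).
- exact: smooth_continuous w_smooth.
- by move=> i; exact: smooth_continuous (smooth_dx i c_smooth).
- by move=> i; exact: smooth_continuous (smooth_dx i u_smooth).
- by move=> i; exact: smooth_continuous (smooth_dx i w_smooth).
- by move=> i j; exact: smooth_continuous (smooth_dx i (smooth_dx j c_smooth)).
- by move=> i j; exact: smooth_continuous (smooth_dx i (smooth_dx j u_smooth)).
- by move=> i j; exact: smooth_continuous (smooth_dx i (smooth_dx j w_smooth)).
- by move=> k i j; exact: smooth_continuous (smooth_dx k (Q_smooth i j)).
- by move=> k i j; exact: smooth_continuous (smooth_dx k (P_smooth i j)).
- exact: ddQ_continuous.
- exact: smooth_derivative_dt c_smooth.
- by move=> i j; exact: smooth_derivative_dt (Q_smooth i j).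
- by move=> i; exact: mixed (smoothW (smoothW c_smooth)).
- by move=> i j; exact: mixed2 (smoothW c_smooth).
- by move=> k i j; exact: mixed (Q_smooth i j).
- by move=> k i; exact: smooth_derivative_dx (smooth_dx i c_smooth).
- by move=> k; exact: smooth_derivative_dx u_smooth.
- by move=> k i; exact: smooth_derivative_dx (smooth_dx i u_smooth).
- by move=> k; exact: smooth_derivative_dx w_smooth.
- by move=> k i; exact: smooth_derivative_dx (smooth_dx i w_smooth).
- by move=> k l i j; exact: smooth_derivative_dx (smooth_dx l (Q_smooth i j)).
- by move=> k i j; exact: smooth_derivative_dx (P_smooth i j).
- by [].
- by move=> k l i j p; exact: smooth_dx_dx (Q_smooth i j).
- exact: on_slab.
- exact: t0T.
- by move=> r Dr; rewrite u_dom// dE_dcE'.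
- by move=> r Dr i j; rewrite P_dom// dE_dQE'.
- by move=> r br; exact: u_boundary.
- by move=> r br i j; exact: P_boundary.
- by move=> k s s01; exact: normal_flux.
Qed.

End GradientFlow.

Unset Implicit Arguments.

Theorem theorem2p6 (R : realType) (m : model R) (Omega : region R) (T : R)
    (c : R -> R * R -> R) (Q : R -> R * R -> 'M[R]_2)
    (c_bnd : R * R -> R) (Q_bnd : R * R -> 'M[R]_2)
    (c_smooth : Ck_spacetime 4 T (closure (dom Omega)) c)
    (Q_smooth : forall i j,
       Ck_spacetime 2 T (closure (dom Omega)) (fun t r => Q t r i j))
    (cQ_physical : forall t r, 0 < t < T -> dom Omega r ->
       physical m (c t r) (Q t r))
    (cQ_solution : gradient_flow_solution m Omega T c_bnd Q_bnd c Q)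
    (t : R) (ht : 0 < t < T) :
  is_derive t (1 : R) (fun s => energy m Omega (c s) (Q s))
    (- inner_scalar Omega (projG Omega (dE_dc m (c t) (Q t)))
                          (projG Omega (dE_dc m (c t) (Q t)))
     - inner_tensor Omega (projP (dE_dQ m (c t) (Q t)))
                          (projP (dE_dQ m (c t) (Q t)))
     - 2 * c40 m * integral_boundary Omega (fun r => laplacian (c t) r ^+ 2)).
Proof.
apply: (@energy_dissipation R m Omega T c Q _ _ cQ_physical c_bnd Q_bnd cQ_solution t ht).
- have [W [oW WP CW]] := c_smooth; exists W; split => // -[s r] [/= sT cr]; exact: WP.
- move=> i j; have [W [oW WP CW]] := Q_smooth i j.
  exists W; split => // -[s r] [/= sT cr]; exact: WP.
Qed.
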